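(* Let $(\mathbb X,\mathcal X)$ be a Borel space and $\alpha$ a $\sigma$-finite measure on $\mathbb X$. The operators $k^\pm(\varphi), k^0(\varphi):\mathcal D\to\mathfrak F$, $\varphi\in\mathcal C$, form a Fock representation of the $su(1,1)$ current algebra in the extended Fock space $\mathfrak F$ with vacuum $\Psi=(1,0,0,\ldots)$.
   Context: Test functions: $\mathcal C$ is the algebra of bounded measurable $\varphi:\mathbb X\to\mathbb C$ with $\alpha(\{x:\varphi(x)\neq 0\})<\infty$. Scalar products are antilinear in the first argument. Fock representation. A family $k^\pm(\varphi),k^0(\varphi)$, $\varphi\in\mathcal C$, of operators in a Hilbert space $\mathcal H$ is a Fock representation of the $su(1,1)$ current algebra with vacuum $\Psi$ if: (i) the operators are defined on a common domain $\mathcal D$ dense in $\mathcal H$ and map $\mathcal D$ to itself; (ii) $k^+(\varphi)$ and $k^0(\varphi)$ are linear in $\varphi$, and $k^-(\varphi)$ is antilinear in $\varphi$; (iii) for all $\varphi,\theta\in\mathcal C$, on $\mathcal D$: $[k^-(\varphi),k^+(\theta)]=2k^0(\overline\varphi\theta)$, $[k^0(\varphi),k^+(\theta)]=k^+(\varphi\theta)$, $[k^0(\varphi),k^-(\theta)]=-k^-(\overline\varphi\theta)$, and $[k^\#(\varphi),k^\#(\theta)]=0$ for each $\#\in\{0,+,-\}$; (iv) for all $f,g\in\mathcal D$, $\varphi\in\mathcal C$: $\langle f,k^0(\varphi)g\rangle=\langle k^0(\overline\varphi)f,g\rangle$ and $\langle f,k^+(\varphi)g\rangle=\langle k^-(\varphi)f,g\rangle$;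 (v) $\Psi\in\mathcal D$, $\|\Psi\|=1$ and $k^-(\varphi)\Psi=0$ for all $\varphi\in\mathcal C$; (vi) $\Psi$ is cyclic: the linear combinations of $\Psi$ and $k^+(\varphi_1)\cdots k^+(\varphi_n)\Psi$, $n\in\mathbb N$, $\varphi_1,\ldots,\varphi_n\in\mathcal C$, are dense in $\mathcal H$. Extended Fock space. For $\sigma$ in the set $\mathfrak S_n$ of permutations of $\{1,\ldots,n\}$ let $|\sigma|$ be its number of cycles (fixed points included). For $f_n:\mathbb X^n\to\mathbb C$ let $f_n^\sigma:\mathbb X^{|\sigma|}\to\mathbb C$ be obtained by identifying variables in the same cycle of $\sigma$. The measure $\lambda_n$ on $\mathbb X^n$ is the unique measure with $\int f_n\,d\lambda_n=\sum_{\sigma\in\mathfrak S_n}\int f_n^\sigma\,d\alpha^{|\sigma|}$ for all measurable $f_n\ge0$. $L^2_{\mathrm s}(\lambda_n)$ is the subspace of ($\lambda_n$-a.e.) symmetric functions in the complex space $L^2(\mathbb X^n,\lambda_n)$. $\mathfrak F$ is the Hilbert space of sequences $(f_n)_{n\in\mathbb N_0}$, $f_0\in\mathbb C$, $f_n\in L^2_{\mathrm s}(\lambda_n)$, with $|f_0|^2+\sum_{n\ge1}\frac1{n!}\int|f_n|^2d\lambda_n<\infty$ and scalar product $\overline{f_0}g_0+\sum_{n\ge1}\frac1{n!}\int\overline{f_n}g_n\,d\lambda_n$. A function on $\mathbb X^n$ is identified with the sequence having it as $n$-th entry and zeros elsewhere. $(f_1\otimes_{\mathrm s}\cdots\otimes_{\mathrm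 s}f_n)(x_1,\ldots,x_n)=\frac1{n!}\sum_{\sigma\in\mathfrak S_n}f_1(x_{\sigma(1)})\cdots f_n(x_{\sigma(n)})$. $\mathcal D$ is the space of finite linear combinations of $\Psi=(1,0,0,\ldots)$ and of symmetrized tensor products $f_1\otimes_{\mathrm s}\cdots\otimes_{\mathrm s}f_n$, $n\in\mathbb N$, $f_i\in\mathcal C$. Operators. For $\varphi\in\mathcal C$, $f=(f_n)\in\mathcal D$, $n\in\mathbb N_0$ (empty sums are $0$, so $(k^+(\varphi)f)_0=0$): $(k^+(\varphi)f)_n(x_1,\ldots,x_n)=\sum_{i=1}^n\varphi(x_i)f_{n-1}(x_1,\ldots,x_{i-1},x_{i+1},\ldots,x_n)$, $(k^-(\varphi)f)_n(x_1,\ldots,x_n)=\int\overline{\varphi(y)}f_{n+1}(y,x_1,\ldots,x_n)\,\alpha(dy)+\sum_{i=1}^n\overline{\varphi(x_i)}f_{n+1}(x_1,\ldots,x_n,x_i)$, $(k^0(\varphi)f)_n(x_1,\ldots,x_n)=\big(\sum_{i=1}^n\varphi(x_i)+\frac12\int\varphi\,d\alpha\big)f_n(x_1,\ldots,x_n)$. *)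

(* Defs.v *)
From HB Require Import structures.
From mathcomp Require Import all_boot all_order all_algebra all_fingroup.
From mathcomp Require Import ring_quotient complex ring lra.
From mathcomp Require Import all_classical all_reals all_analysis.
From mathcomp Require Import measurable_realfun.

Set Implicit Arguments.
Unset Strict Implicit.
Unset Printing Implicit Defensive.

Import Order.TTheory GRing.Theory Num.Theory.
Import numFieldNormedType.Exports.

Local Open Scope classical_set_scope.
Local Open Scope ring_scope.

Definition borel_space (R : realType) d (X : measurableType d) : Prop :=
  exists h : X -> R,
    [/\ injective h,
        measurable_fun setT h,
        range h `<=` `[0, 1]%classic &
        forall A : set X, measurable A -> measurable (h @` A)].

Section complex_functions.
Context d (T : measurableType d) (R : realType).
Implicit Types f g : T -> R[i].

Definition cmeasurable f : Prop :=
  measurable_fun setT (fun x => complex.Re (f x)) /\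
  measurable_fun setT (fun x => complex.Im (f x)).

Definition cintegral (mu : {measure set T -> \bar R}) f : R[i] :=
  Complex (\int[mu]_x complex.Re (f x)) (\int[mu]_x complex.Im (f x)).

Definition sqnorm (z : R[i]) : R := ComplexField.Normc.normc z ^+ 2.

Lemma sqnormE z : sqnorm z = complex.Re z ^+ 2 + complex.Im z ^+ 2.
Proof.
by case: z => a b; rewrite /sqnorm /= sqr_sqrtr ?addr_ge0 ?sqr_ge0.
Qed.

Lemma sqnorm_ge0 z : 0 <= sqnorm z.
Proof. by rewrite sqnormE addr_ge0 ?sqr_ge0. Qed.

Lemma sqnorm_lin a z w :
  sqnorm (a * z + w) <= 2 * sqnorm a * sqnorm z + 2 * sqnorm w.
Proof.
have -> : 2 * sqnorm a * sqnorm z = 2 * sqnorm (a * z).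
  by rewrite -mulrA /sqnorm -exprMn ComplexField.Normc.normcM.
rewrite !sqnormE; case: (a * z) w => x y [x' y'] /=.
have := sqr_ge0 (x - x'); have := sqr_ge0 (y - y'); nra.
Qed.

Lemma cmeasurable0 : cmeasurable (fun=> 0).
Proof. by split; exact: measurable_cst. Qed.

Lemma cmeasurable_lin a f g :
  cmeasurable f -> cmeasurable g -> cmeasurable (fun x => a * f x + g x).
Proof.
move=> [fr fi] [gr gi]; case: a => a b; split.
- rewrite (_ : (fun _ => _) = fun x =>
    a * complex.Re (f x) - b * complex.Im (f x) + complex.Re (g x)).
    by apply: measurable_funD => //; apply: measurable_funB; exact: measurable_funM.
  by apply/funext => x; case: (f x) (g x) => ? ? [].
- rewrite (_ : (fun _ => _) = fun x =>
    a * complex.Im (f x) + b * complex.Re (f x) + complex.Im (g x)).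
    by apply: measurable_funD => //; apply: measurable_funD; exact: measurable_funM.
  by apply/funext => x; case: (f x) (g x) => ? ? [].
Qed.

Lemma measurable_sqnorm f :
  cmeasurable f -> measurable_fun setT (fun x => sqnorm (f x)).
Proof.
move=> [fr fi]; under eq_fun do rewrite sqnormE.
by apply: measurable_funD; exact: measurable_funX.
Qed.

End complex_functions.

Section power_measure.
Context d (X : measurableType d) (R : realType).
Variable alpha : {sigma_finite_measure set X -> \bar R}.
Local Open Scope ereal_scope.

Definition cons_pair m (p : X * m.-tuple X) : m.+1.-tuple X :=
  [tuple of p.1 :: p.2].

Lemma measurable_cons_pair m : measurable_fun setT (@cons_pair m).
Proof. exact: measurable_cons. Qed.

Section step.
Variables (m : nat) (mu : {sigma_finite_measure set (m.-tuple X) -> \bar R}).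

Definition power_succ := pushforward (alpha \x mu) (@cons_pair m).

Let power_succ0 : power_succ set0 = 0.
Proof. by rewrite /power_succ /pushforward preimage_set0 measure0. Qed.

Let power_succ_ge0 A : 0 <= power_succ A.
Proof. have mcons := @measurable_cons_pair m; exact: measure_ge0. Qed.

Let power_succ_sigma_additive : semi_sigma_additive power_succ.
Proof.
have mcons := @measurable_cons_pair m; exact: measure_semi_sigma_additive.
Qed.

HB.instance Definition _ := isMeasure.Build _ _ _ power_succ
  power_succ0 power_succ_ge0 power_succ_sigma_additive.

Let power_succ_sigma_finite : sigma_finite setT power_succ.
Proof.
pose uncons (t : m.+1.-tuple X) := (thead t, [tuple of behead t]).
have muncons : measurable_fun setT uncons.
  by apply: measurable_fun_pair; [exact: measurable_tnth|exact: measurable_behead].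
have consK p : uncons (cons_pair p) = p.
  by case: p => x t; congr pair; apply: val_inj.
have /sigma_finiteP[F [FT ndF Foo]] := sigma_finiteT alpha.
have /sigma_finiteP[G [GT ndG Goo]] := sigma_finiteT mu.
exists (fun k => uncons @^-1` (F k `*` G k)).
  apply/esym; rewrite -subTset => t _.
  have : setT (uncons t).1 by [].
  have : setT (uncons t).2 by [].
  rewrite FT GT => -[j _ Gj] [k _ Fk].
  exists (maxn j k) => //; split.
    by move: Fk; exact/subsetPset/ndF/leq_maxr.
  by move: Gj; exact/subsetPset/ndG/leq_maxl.
move=> k; have [mF Fk] := Foo k; have [mG Gk] := Goo k.
have mFG : measurable (F k `*` G k) by exact: measurableX.
split; first by rewrite -[X in measurable X]setTI; exact: muncons.
rewrite /power_succ /pushforward -comp_preimage (_ : _ @^-1` _ = F k `*` G k).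
  by rewrite product_measure1E// lte_mul_pinfty// ge0_fin_numE.
by rewrite (_ : _ \o _ = id)//; apply/funext => p; exact: consK.
Qed.

HB.instance Definition _ := Measure_isSigmaFinite.Build _ _ _ power_succ
  power_succ_sigma_finite.

End step.

Fixpoint power_measure m : {sigma_finite_measure set (m.-tuple X) -> \bar R} :=
  match m with
  | 0 => dirac [tuple]
  | m'.+1 => power_succ (power_measure m')
  end.

End power_measure.

Section extended_measure.
Context d (X : measurableType d) (R : realType).
Variable alpha : {sigma_finite_measure set X -> \bar R}.
Variable n : nat.
Implicit Type s : 'S_n.
Local Open Scope ereal_scope.

Lemma porbit_in_porbits s i : porbit s i \in porbits s.
Proof. exact: imset_f. Qed.

Definition cycle_rank s i : 'I_#|porbits s| :=
  enum_rank_in (porbit_in_porbits s i) (porbit s i).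

(* [f \o diagonal s] is f with the variables in each cycle of s identified; the
   order in which the cycles are listed is immaterial because the powers of
   alpha are invariant under permutations of the coordinates. *)
Definition diagonal s (t : #|porbits s|.-tuple X) : n.-tuple X :=
  [tuple tnth t (cycle_rank s i) | i < n].

Lemma cycle_rankE s i j : (cycle_rank s i == cycle_rank s j) = (j \in porbit s i).
Proof.
rewrite -eq_porbit_mem eq_sym; apply/eqP/eqP => [/(congr1 enum_val)|].
  by rewrite !enum_rankK_in ?porbit_in_porbits.
move=> ij; apply: enum_val_inj.
by rewrite !enum_rankK_in ?porbit_in_porbits// ij.
Qed.

Lemma measurable_diagonal s : measurable_fun setT (@diagonal s).
Proof.
apply/measurable_fun_tnthP => i.
rewrite (_ : _ \o _ = fun t => tnth t (cycle_rank s i)).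
  exact: measurable_tnth.
by apply/funext => t; rewrite /= tnth_mktuple.
Qed.

Definition cycle_measure s :=
  pushforward (power_measure alpha #|porbits s|) (@diagonal s).

Section cycle_measure_instance.
Variable s : 'S_n.

Let cycle_measure0 : cycle_measure s set0 = 0.
Proof. by rewrite /cycle_measure /pushforward preimage_set0 measure0. Qed.

Let cycle_measure_ge0 A : 0 <= cycle_measure s A.
Proof. have ms := @measurable_diagonal s; exact: measure_ge0. Qed.

Let cycle_measure_sigma_additive : semi_sigma_additive (cycle_measure s).
Proof.
have ms := @measurable_diagonal s; exact: measure_semi_sigma_additive.
Qed.

HB.instance Definition _ := isMeasure.Build _ _ _ (cycle_measure s)
  cycle_measure0 cycle_measure_ge0 cycle_measure_sigma_additive.

End cycle_measure_instance.

Definition lambda (A : set (n.-tuple X)) : \bar R :=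
  \sum_(s : 'S_n) cycle_measure s A.

Let lambda0 : lambda set0 = 0.
Proof. by rewrite /lambda big1. Qed.

Let lambda_ge0 A : 0 <= lambda A.
Proof. by apply: sume_ge0 => s _; exact: measure_ge0. Qed.

Let lambda_sigma_additive : semi_sigma_additive lambda.
Proof.
move=> F mF tF mUF; rewrite [X in _ --> X](_ : _ =
    lim ((fun n => \sum_(0 <= i < n) lambda (F i)) @ \oo)).
  by apply: is_cvg_ereal_nneg_natsum => k _; exact: lambda_ge0.
rewrite nneseries_sum//; apply: eq_bigr => /= s _.
exact: measure_semi_bigcup.
Qed.

HB.instance Definition _ := isMeasure.Build _ _ _ lambda
  lambda0 lambda_ge0 lambda_sigma_additive.

Lemma ge0_integral_lambda (f : n.-tuple X -> \bar R) :
  measurable_fun setT f -> (forall x, 0 <= f x) ->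
  \int[lambda]_x f x =
  \sum_(s : 'S_n) \int[power_measure alpha #|porbits s|]_t f (diagonal t).
Proof.
move=> mf f0.
pose m_ k : {measure set (n.-tuple X) -> \bar R} :=
  cycle_measure (nth 1%g (enum 'S_n) k).
have sumE (g : 'S_n -> \bar R) :
    \sum_(k < size (enum 'S_n)) g (nth 1%g (enum 'S_n) k) = \sum_s g s.
  by rewrite -(big_mkord xpredT (fun k => g (nth 1%g (enum 'S_n) k)))
    -(big_nth 1%g xpredT) big_enum.
rewrite (eq_measure_integral (msum m_ (size (enum 'S_n)))); last first.
  by move=> A mA _; exact/esym/(sumE (fun s => cycle_measure s A)).
rewrite ge0_integral_measure_sum//.
rewrite (sumE (fun s => \int[cycle_measure s]_x f x)).
apply: eq_bigr => s _; rewrite ge0_integral_pushforward//.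
exact: measurable_diagonal.
Qed.

End extended_measure.
Arguments lambda {d X R} alpha n A.

Lemma lambda0T d (X : measurableType d) (R : realType)
    (alpha : {sigma_finite_measure set X -> \bar R}) :
  lambda alpha 0 setT = 1%E.
Proof.
have card1 : #|{perm 'I_0}| = 1%N by rewrite card_Sn.
rewrite /lambda (eq_bigr (fun=> 1%E)) => [|s _].
  by rewrite sumr_const card1.
have -> : cycle_measure alpha s setT = power_measure alpha #|porbits s| setT by [].
suff -> : #|porbits s| = 0%N by rewrite /= diracT.
by apply/eqP; rewrite cards_eq0; apply/eqP/setP => A; rewrite inE; apply/imsetP => -[[]].
Qed.

Definition lin_span (K : pzRingType) (V : lmodType K) (S : set V) : set V :=
  [set v | exists m (c : 'I_m -> K) (w : 'I_m -> V),
    (forall i, S (w i)) /\ v = \sum_(i < m) c i *: w i].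

Section hilbert.
Context (R : realType) (H : lmodType R[i]).
Variable ip : H -> H -> R[i].

Definition hnorm (u : H) : R := Num.sqrt (complex.Re (ip u u)).

Record hilbert_space : Prop := HilbertSpace {
  ip_linear_r : forall a u v w, ip u (a *: v + w) = a * ip u v + ip u w ;
  ip_conj : forall u v, ip v u = (ip u v)^*%C ;
  ip_ge0 : forall u, 0 <= ip u u ;
  ip_eq0 : forall u, ip u u = 0 -> u = 0 ;
  ip_complete : forall u_ : nat -> H,
    (forall e : R, 0 < e -> exists N, forall m n,
       (N <= m)%N -> (N <= n)%N -> hnorm (u_ m - u_ n) < e) ->
    exists l, forall e : R, 0 < e -> exists N, forall n,
       (N <= n)%N -> hnorm (u_ n - l) < e }.

Definition hdense (S : set H) : Prop :=
  forall u (e : R), 0 < e -> exists2 v, S v & hnorm (u - v) < e.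

End hilbert.

Section fock_representation.
Context d (X : measurableType d) (R : realType).
Variable alpha : {sigma_finite_measure set X -> \bar R}.

Definition test_fun (phi : X -> R[i]) : Prop :=
  [/\ cmeasurable phi,
      exists M : R, forall x, ComplexField.Normc.normc (phi x) <= M &
      (alpha [set x | phi x != 0%R] < +oo)%E].

Definition cconj (phi : X -> R[i]) : X -> R[i] := fun x => (phi x)^*%C.

Definition comm (V : zmodType) (A B : V -> V) (u : V) : V := A (B u) - B (A u).

(* Operators with domain D are total functions whose values off D are
   irrelevant: every clause evaluates them on D only. *)
Record fock_representation (H : lmodType R[i]) (ip : H -> H -> R[i])
    (D : set H) (kp km k0 : (X -> R[i]) -> H -> H) (Psi : H) : Prop :=
  FockRepresentation {
  fr_hilbert : hilbert_space ip ;
  fr_dom_submod : D 0 /\ forall a u v, D u -> D v -> D (a *: u + v) ;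
  fr_dom_dense : hdense ip D ;
  fr_dom_stable : forall phi u, test_fun phi -> D u ->
    [/\ D (kp phi u), D (km phi u) & D (k0 phi u)] ;
  fr_linear : forall phi a u v, test_fun phi -> D u -> D v ->
    [/\ kp phi (a *: u + v) = a *: kp phi u + kp phi v,
        km phi (a *: u + v) = a *: km phi u + km phi v &
        k0 phi (a *: u + v) = a *: k0 phi u + k0 phi v] ;
  fr_test_linear : forall a phi theta u, test_fun phi -> test_fun theta -> D u ->
    [/\ kp (a *: phi + theta) u = a *: kp phi u + kp theta u,
        k0 (a *: phi + theta) u = a *: k0 phi u + k0 theta u &
        km (a *: phi + theta) u = a^*%C *: km phi u + km theta u] ;
  fr_comm_mp : forall phi theta u, test_fun phi -> test_fun theta -> D u ->
    comm (km phi) (kp theta) u = 2 *: k0 (cconj phi \* theta) u ;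
  fr_comm_0p : forall phi theta u, test_fun phi -> test_fun theta -> D u ->
    comm (k0 phi) (kp theta) u = kp (phi \* theta) u ;
  fr_comm_0m : forall phi theta u, test_fun phi -> test_fun theta -> D u ->
    comm (k0 phi) (km theta) u = - km (cconj phi \* theta) u ;
  fr_comm_same : forall phi theta u, test_fun phi -> test_fun theta -> D u ->
    [/\ comm (k0 phi) (k0 theta) u = 0,
        comm (kp phi) (kp theta) u = 0 &
        comm (km phi) (km theta) u = 0] ;
  fr_adj_0 : forall phi f g, test_fun phi -> D f -> D g ->
    ip f (k0 phi g) = ip (k0 (cconj phi) f) g ;
  fr_adj_pm : forall phi f g, test_fun phi -> D f -> D g ->
    ip f (kp phi g) = ip (km phi f) g ;
  fr_vac_dom : D Psi ;
  fr_vac_norm : hnorm ip Psi = 1 ;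
  fr_vac_annih : forall phi, test_fun phi -> km phi Psi = 0 ;
  fr_vac_cyclic : hdense ip (lin_span [set u | exists2 phis : seq (X -> R[i]),
    {in phis, forall phi, test_fun phi} & u = foldr kp Psi phis]) }.

End fock_representation.

(* [0.-tuple X] is a point, to which [lambda alpha 0] gives mass 1 (lambda0T), so
   that the entry of degree 0 is a complex number. *)
Definition pre_fock (X : Type) (R : realType) : Type :=
  forall n, n.-tuple X -> R[i].

Section pre_fock_lmod.
Context (X : Type) (R : realType).
Local Notation pre_fock := (pre_fock X R).
Implicit Types f g h : pre_fock.

HB.instance Definition _ := gen_eqMixin pre_fock.
HB.instance Definition _ := gen_choiceMixin pre_fock.

Lemma pre_fockP f g : (forall n x, f n x = g n x) -> f = g.
Proof.
by move=> fg; apply: functional_extensionality_dep => n; apply/funext => x.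
Qed.

Let addA : associative (fun f g : pre_fock => fun n x => f n x + g n x).
Proof. by move=> f g h; apply: pre_fockP => n x; rewrite addrA. Qed.

Let addC : commutative (fun f g : pre_fock => fun n x => f n x + g n x).
Proof. by move=> f g; apply: pre_fockP => n x; rewrite addrC. Qed.

Let add0 : left_id (fun _ _ => 0) (fun f g : pre_fock => fun n x => f n x + g n x).
Proof. by move=> f; apply: pre_fockP => n x; rewrite add0r. Qed.

Let addN : left_inverse (fun _ _ => 0) (fun f : pre_fock => fun n x => - f n x)
  (fun f g : pre_fock => fun n x => f n x + g n x).
Proof. by move=> f; apply: pre_fockP => n x; rewrite addNr. Qed.

HB.instance Definition _ := GRing.isZmodule.Build pre_fock addA addC add0 addN.

Let scale (a : R[i]) f : pre_fock := fun n x => a * f n x.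

Let scaleA a b f : scale a (scale b f) = scale (a * b) f.
Proof. by apply: pre_fockP => n x; rewrite /scale mulrA. Qed.

Let scale1 : left_id 1 scale.
Proof. by move=> f; apply: pre_fockP => n x; rewrite /scale mul1r. Qed.

Let scaleDr : right_distributive scale +%R.
Proof. by move=> a f g; apply: pre_fockP => n x; rewrite /scale mulrDr. Qed.

Let scaleDl f : {morph scale^~ f : a b / a + b}.
Proof. by move=> a b; apply: pre_fockP => n x; rewrite /scale mulrDl. Qed.

HB.instance Definition _ := GRing.Zmodule_isLmodule.Build R[i] pre_fock
  scaleA scale1 scaleDr scaleDl.

End pre_fock_lmod.

Section fock_space.
Context d (X : measurableType d) (R : realType).
Variable alpha : {sigma_finite_measure set X -> \bar R}.
Local Notation lambda := (lambda alpha).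

Definition permute n (s : 'S_n) (x : n.-tuple X) : n.-tuple X :=
  [tuple tnth x (s i) | i < n].

Definition square_summable (f : pre_fock X R) : Prop :=
  [/\ forall n, cmeasurable (f n),
      forall n (s : 'S_n), {ae lambda n, forall x, f n (permute s x) = f n x} &
      (\sum_(0 <= n <oo)
         ((n`!%:R)^-1)%:E * \int[lambda n]_x (sqnorm (f n x))%:E < +oo)%E].

Definition fock_pred : {pred pre_fock X R} := fun f => `[< square_summable f >].

Let fock_pred_submod : submod_closed fock_pred.
Proof.
split.
  apply/asboolP; split => [n|n s|].
  - exact: cmeasurable0.
  - exact: aeW.
  - rewrite eseries0// => n _ _.
    by rewrite integral0_eq ?mule0// => x _; rewrite sqnormE/= expr0n addr0.
move=> a f g /asboolP[mf sf lf] /asboolP[mg sg lg]; apply/asboolP; split.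
- by move=> n; exact: cmeasurable_lin.
- move=> n s; have := sf n s; have := sg n s; apply: filterS2 => x gx fx.
  by congr (a * _ + _).
- pose c := 2 * sqnorm a; have c0 : 0 <= c by rewrite mulr_ge0 ?sqnorm_ge0.
  pose N (h : pre_fock X R) n : \bar R :=
    (((n`!%:R)^-1)%:E * \int[lambda n]_x (sqnorm (h n x))%:E)%E.
  have I0 (h : pre_fock X R) n : (0 <= \int[lambda n]_x (sqnorm (h n x))%:E)%E.
    by apply: integral_ge0 => x _; rewrite lee_fin sqnorm_ge0.
  have N0 h n : (0 <= N h n)%E.
    by rewrite mule_ge0 ?lee_fin ?invr_ge0.
  have mN (h : pre_fock X R) n : cmeasurable (h n) ->
      measurable_fun setT (fun x => (sqnorm (h n x))%:E).
    by move=> mh; apply/measurable_EFinP; exact: measurable_sqnorm.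
  apply: (@le_lt_trans _ _ (c%:E * \sum_(0 <= n <oo) N f n +
      2%:E * \sum_(0 <= n <oo) N g n)%E); last first.
    by rewrite lte_add_pinfty// lte_mul_pinfty// lee_fin.
  rewrite -!nneseriesZl//; [|by move=> *; exact: N0..].
  rewrite -nneseriesD; last 2 first.
  + by move=> n _ _; rewrite mule_ge0 ?lee_fin.
  + by move=> n _ _; rewrite mule_ge0.
  apply: lee_nneseries => [n _ _|n _]; first exact: (N0 (a *: f + g) n).
  apply: (@le_trans _ _ (((n`!%:R)^-1)%:E *
    (c%:E * \int[lambda n]_x (sqnorm (f n x))%:E +
     2%:E * \int[lambda n]_x (sqnorm (g n x))%:E))%E); last first.
    by rewrite ge0_muleDr ?mule_ge0 ?lee_fin// !(muleCA _ c%:E) !(muleCA _ 2%:E).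
  rewrite lee_pmul2l ?lte_fin ?invr_gt0 ?ltr0n ?fact_gt0//.
  have mfn := mN f n (mf n); have mgn := mN g n (mg n).
  rewrite -!ge0_integralZl_EFin//; try by move=> x _; rewrite lee_fin sqnorm_ge0.
  rewrite -ge0_integralD//; [|by move=> x _; rewrite mule_ge0 ?lee_fin ?sqnorm_ge0
    |exact: measurable_funeM|by move=> x _; rewrite mule_ge0 ?lee_fin ?sqnorm_ge0
    |exact: measurable_funeM].
  apply: ge0_le_integral => //.
  + by move=> x _; rewrite lee_fin sqnorm_ge0.
  + by apply: (mN (a *: f + g)); exact: cmeasurable_lin.
  + by apply: emeasurable_funD; exact: measurable_funeM.
  + by move=> x _; rewrite -!EFinM -EFinD lee_fin; exact: sqnorm_lin.
Qed.

HB.instance Definition _ := GRing.isSubmodClosed.Build R[i] (pre_fock X R)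
  fock_pred fock_pred_submod.

Record fock_seq := FockSeq { fock_fun :> pre_fock X R ; _ : fock_fun \in fock_pred }.
Arguments fock_fun : clear implicits.

HB.instance Definition _ := [isSub for fock_fun].
HB.instance Definition _ := [Choice of fock_seq by <:].
HB.instance Definition _ := [SubChoice_isSubLmodule of fock_seq by <:].

Definition fock_null : {pred fock_seq} :=
  fun f => `[< forall n, {ae lambda n, forall x, fock_fun f n x = 0} >].

Let fock_null_zmod : zmod_closed fock_null.
Proof.
split; first by apply/asboolP => n; exact: aeW.
move=> f g /asboolP f0 /asboolP g0; apply/asboolP => n.
by have := f0 n; have := g0 n; apply: filterS2 => x gx fx;
  transitivity (fock_fun f n x - fock_fun g n x); rewrite // gx fx subrr.
Qed.

HB.instance Definition _ := GRing.isZmodClosed.Build fock_seq fock_null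
  fock_null_zmod.

Definition fock : Type := Quotient.quot fock_null.
HB.instance Definition _ := GRing.Zmodule.on fock.
HB.instance Definition _ := Choice.on fock.

Local Open Scope quotient_scope.

Definition fock_class (f : fock_seq) : fock := \pi_(Quotient.quot fock_null) f.

Definition fock_repr (u : fock) : fock_seq := generic_quotient.repr u.

Lemma fock_reprK : cancel fock_repr fock_class.
Proof. exact: reprK. Qed.

Lemma fock_classP (f g : fock_seq) :
  fock_class f = fock_class g <->
  forall n, {ae lambda n, forall x, fock_fun f n x = fock_fun g n x}.
Proof.
have -> : fock_class f = fock_class g <-> f - g \in fock_null.
  by rewrite (Quotient.idealrBE fock_null); split => [/eqP|/eqP].
split => [/asboolP fg n|fg]; last apply/asboolP => n; have := fg n; apply: filterS => x.
  by move=> /eqP; rewrite -[fock_fun (f - g) n x]/(fock_fun f n x - fock_fun g n x) subr_eq0 => /eqP.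
by move=> fgx; rewrite -[fock_fun (f - g) n x]/(fock_fun f n x - fock_fun g n x) fgx subrr.
Qed.

Lemma fock_classD : {morph fock_class : f g / f + g}.
Proof. by move=> f g; rewrite /fock_class piE. Qed.

Definition fock_scale (a : R[i]) (u : fock) : fock :=
  fock_class (a *: fock_repr u).

Lemma fock_classZ a f : fock_class (a *: f) = fock_scale a (fock_class f).
Proof.
apply/fock_classP => n.
have /esym/fock_classP/(_ n) := fock_reprK (fock_class f).
by apply: filterS => x fx; congr (a * _).
Qed.

Let fock_scaleA a b u : fock_scale a (fock_scale b u) = fock_scale (a * b) u.
Proof. by rewrite -(fock_reprK u) -!fock_classZ scalerA. Qed.

Let fock_scale1 : left_id 1 fock_scale.
Proof. by move=> u; rewrite -(fock_reprK u) -fock_classZ scale1r. Qed.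

Let fock_scaleDr : right_distributive fock_scale +%R.
Proof.
move=> a u v; rewrite -(fock_reprK u) -(fock_reprK v).
by rewrite -fock_classD -!fock_classZ -fock_classD scalerDr.
Qed.

Let fock_scaleDl u : {morph fock_scale^~ u : a b / a + b}.
Proof.
by move=> a b; rewrite -(fock_reprK u) -!fock_classZ -fock_classD scalerDl.
Qed.

HB.instance Definition _ := GRing.Zmodule_isLmodule.Build R[i] fock
  fock_scaleA fock_scale1 fock_scaleDr fock_scaleDl.

Definition fock_term (f g : pre_fock X R) n : R[i] :=
  (n`!%:R)^-1 * cintegral (lambda n) (fun x => (f n x)^*%C * g n x).

Definition fock_ip (u v : fock) : R[i] :=
  Complex
    (limn (series (fun n => complex.Re (fock_term (fock_repr u) (fock_repr v) n))))
    (limn (series (fun n => complex.Im (fock_term (fock_repr u) (fock_repr v) n)))).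

Definition represents (u : fock) (f : pre_fock X R) : Prop :=
  exists2 g : fock_seq, fock_fun g = f & fock_class g = u.

(* [insub (tval x)] is x itself seen in [n.-tuple X] when x has length n, and
   None otherwise. *)
Definition at_degree n (g : n.-tuple X -> R[i]) : pre_fock X R :=
  fun m x => oapp g 0 (insub (tval x)).

Definition vacuum_seq : pre_fock X R := fun n _ => (n == 0%N)%:R.

Lemma vacuum_seq_subproof : vacuum_seq \in fock_pred.
Proof.
apply/asboolP; split => [n|n s|]; first by split; exact: measurable_cst.
  exact: aeW.
rewrite (@nneseriesD1 _ _ 0%N)//; last first.
  move=> n _; rewrite mule_ge0 ?lee_fin ?invr_ge0//.
  by apply: integral_ge0 => x _; rewrite lee_fin sqnorm_ge0.
rewrite eseries0 => [|n _ /= n0]; last first.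
  rewrite integral0_eq ?mule0// => x _.
  by rewrite /vacuum_seq (negbTE n0) sqnormE/= expr0n addr0.
rewrite adde0 fact0 invr1 mul1e (eq_integral (cst 1%E)) => [|x _].
  by rewrite integral_cst// mul1e [ltLHS]lambda0T ltry.
by rewrite sqnormE/= expr1n expr0n addr0.
Qed.

Definition vacuum : fock := fock_class (FockSeq vacuum_seq_subproof).

Definition sym_tensor n (fs : n.-tuple (X -> R[i])) (x : n.-tuple X) : R[i] :=
  (n`!%:R)^-1 * \sum_(s : 'S_n) \prod_(i < n) tnth fs i (tnth x (s i)).

Definition fock_dom : set (pre_fock X R) :=
  lin_span [set f | f = vacuum_seq \/
    exists n (fs : n.-tuple (X -> R[i])),
      [/\ (0 < n)%N, forall i, test_fun alpha (tnth fs i) &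
          f = at_degree (sym_tensor fs)]].

Definition k_plus (phi : X -> R[i]) (f : pre_fock X R) : pre_fock X R :=
  fun n => match n return n.-tuple X -> R[i] with
  | 0 => fun=> 0
  | m.+1 => fun x => \sum_(i < m.+1)
      phi (tnth x i) * f m [tuple tnth x (lift i j) | j < m]
  end.

Definition k_minus (phi : X -> R[i]) (f : pre_fock X R) : pre_fock X R :=
  fun n x =>
    cintegral alpha (fun y => (phi y)^*%C * f n.+1 [tuple of y :: x]) +
    \sum_(i < n) (phi (tnth x i))^*%C * f n.+1 [tuple of rcons x (tnth x i)].

Definition k_zero (phi : X -> R[i]) (f : pre_fock X R) : pre_fock X R :=
  fun n x =>
    (\sum_(i < n) phi (tnth x i) + 2^-1 * cintegral alpha phi) * f n x.

Definition fock_dom_class : set fock :=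
  [set u | exists2 f, fock_dom f & represents u f].

(* T acts on functions and k on classes; that k exists says that the class of
   T f depends on the class of f only. *)
Definition induces (T : pre_fock X R -> pre_fock X R) (k : fock -> fock) : Prop :=
  forall f u, fock_dom f -> represents u f -> represents (k u) (T f).

End fock_space.

Arguments fock_fun {d X R alpha} f n x.
Arguments fock_ip {d X R} alpha u v.
Arguments fock_dom {d X R} alpha f.
Arguments fock_dom_class {d X R} alpha u.
Arguments square_summable {d X R} alpha f.
Arguments k_plus {d X R} phi f n x.
Arguments k_minus {d X R} alpha phi f n x.
Arguments k_zero {d X R} alpha phi f n x.
Arguments induces {d X R alpha} T k.

(* Main.v *)
Require Import Defs.
From HB Require Import structures.
From mathcomp Require Import all_boot all_order all_algebra all_fingroup.
From mathcomp Require Import complex ring lra finmap.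
From mathcomp Require Import all_classical all_reals all_analysis.
From mathcomp Require Import measurable_realfun.

Set Implicit Arguments.
Unset Strict Implicit.
Unset Printing Implicit Defensive.

Import Order.TTheory GRing.Theory Num.Theory.
Import numFieldNormedType.Exports.

Local Open Scope ring_scope.

(** Everything rests on a recursion for the measures lambda_n. A permutation of
    n+1 points arises from one of n points by making the new point a cycle of
    its own or by inserting it behind one of the old points. Since lambda_n of a
    box is a sum over permutations of products over cycles [lambda_box], this
    gives
      int f d(lambda_{n+1}) = int int f(y, x) alpha(dy) lambda_n(dx)
                              + sum_i int f(x_i, x) lambda_n(dx),
    first for indicators of boxes [lambda_succ_box], then for nonnegative
    functions [ge0_integral_lambda_succ] and for bounded complex functions
    supported in cubes of finite measure [cintegral_lambda_succ]. The right-hand side has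
    the two terms of k^-(phi), and by the symmetry of lambda_n
    [lambda_permute] the n+1 summands of k^+(phi) contribute equally to a scalar
    product. Hence k^+(phi) and k^-(phi) are adjoint to each other
    [fock_term_k_plus].

    The algebra is done on functions. Up to the factor n!, a symmetrized tensor
    product of f_1, ..., f_n is k^+(f_1) ... k^+(f_n) Psi
    [at_degree_sym_tensor], so that the domain is spanned by such creation
    monomials [fock_domE] and the cyclicity of Psi is the density of the domain.
    The relations of k^0 with k^+ [k_zero_plus] and of k^- with k^+
    [k_minus_plus] hold pointwise. They move k^0 and k^- to the right until they
    meet Psi, and so show that the domain is stable.

    The entries of a Fock vector are functions modulo null functions. An operator
    with an adjoint on the dense domain respects this identification
    [induced_cls]. The relations pass to classes, and those that were not
    checked on functions, namely [k^0, k^-] and [k^-, k^-], are adjoints of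
    [k^0, k^+] and [k^+, k^+] [representation_on_classes].

    Completeness is the Riesz-Fischer theorem in every degree [L2_complete],
    together with the fact that mean square limits of symmetric functions are
    symmetric [ae_symmetric_limit]. For the density of the domain, finite
    linear combinations of indicators of boxes approximate every square
    integrable function, and symmetrizing turns such an indicator into a creation
    monomial [approximable_msq], [fock_dom_density]. *)

(** * Cycles of permutations *)

Section cycles.
Local Open Scope group_scope.
Import GroupScope.

Lemma porbit_ind (T : finType) (s : {perm T}) (P : T -> Prop) x :
  P x -> (forall y, P y -> P (s y)) -> forall y, y \in porbit s x -> P y.
Proof.
move=> Px Ps _ /porbitP[k ->].
by elim: k => [|k IH]; rewrite ?expg0 ?perm1// expgSr permM; exact: Ps.
Qed.

Lemma porbit_step (T : finType) (s : {perm T}) x y :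
  y \in porbit s x -> s y \in porbit s x.
Proof. by rewrite -!eq_porbit_mem -(expg1 s) porbit_perm expg1. Qed.

Lemma porbits_conj (T : finType) (s t : {perm T}) :
  porbits (s ^ t) = [set t @: C | C : {set T} in porbits s].
Proof.
have tstep x : (s ^ t) (t x) = t (s x) by rewrite permJ.
have orb x : porbit (s ^ t) (t x) = t @: porbit s x.
  apply/eqP; rewrite finset.eqEsubset; apply/andP; split.
    apply/fintype.subsetP; apply: porbit_ind; first by apply/imset_f/porbit_id.
    by move=> _ /imsetP[z zx ->]; rewrite tstep; exact/imset_f/porbit_step.
  apply/fintype.subsetP => _ /imsetP[z zx ->].
  move: z zx; apply: porbit_ind; first exact: porbit_id.
  by move=> y; rewrite -tstep; exact: porbit_step.
apply/setP => C; apply/imsetP/imsetP.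
  move=> [x _ ->]; exists (porbit s (t^-1 x)); first exact: imset_f.
  by rewrite -orb permKV.
by move=> [_ /imsetP[x _ ->] ->]; exists (t x); rewrite ?orb.
Qed.

Section insertion.
Variables (n : nat) (s : 'S_n).

(** [insert0 s j] puts the new point 0 into the cycle of s through i when
    [j = lift ord0 i], just after i, and makes it a fixed point when [j = 0]. *)
Definition insert0 (j : 'I_n.+1) : 'S_n.+1 :=
  tperm ord0 j * lift_perm ord0 ord0 s.

Lemma insert0_fix : insert0 ord0 ord0 = ord0.
Proof. by rewrite permM tpermL lift_perm_id. Qed.

Lemma insert0_fix_lift i : insert0 ord0 (lift ord0 i) = lift ord0 (s i).
Proof. by rewrite permM tperm1 perm1 lift_perm_lift. Qed.

Lemma insert0_0 i : insert0 (lift ord0 i) ord0 = lift ord0 (s i).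
Proof. by rewrite permM tpermL lift_perm_lift. Qed.

Lemma insert0_pred i : insert0 (lift ord0 i) (lift ord0 i) = ord0.
Proof. by rewrite permM tpermR lift_perm_id. Qed.

Lemma insert0_lift i k : k != i ->
  insert0 (lift ord0 i) (lift ord0 k) = lift ord0 (s k).
Proof.
by move=> ki; rewrite permM tpermD ?neq_lift ?lift_perm_lift// (inj_eq lift_inj) eq_sym.
Qed.

(** The cycle of [insert0 s (lift ord0 i)] that the cycle C of s grows into. *)
Definition insert_cycle (i : 'I_n) (C : {set 'I_n}) : {set 'I_n.+1} :=
  (lift ord0 @: C) :|: (if i \in C then [set ord0] else finset.set0).

Lemma lift_insert_cycle i C k : (lift ord0 k \in insert_cycle i C) = (k \in C).
Proof.
rewrite inE (mem_imset _ _ lift_inj).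
by case: ifP; rewrite inE ?orbF// (eq_sym _ ord0) (negbTE (neq_lift _ _)) orbF.
Qed.

Lemma ord0_insert_cycle i C : (ord0 \in insert_cycle i C) = (i \in C).
Proof.
rewrite inE (_ : (_ \in lift _ @: _) = false); first by case: ifP; rewrite inE.
by apply/imsetP => -[k _ /eqP]; rewrite (negbTE (neq_lift _ _)).
Qed.

Lemma insert_cycle_inj i : injective (insert_cycle i).
Proof.
by move=> C D CD; apply/setP => k; rewrite -(lift_insert_cycle i) CD lift_insert_cycle.
Qed.

Lemma porbit_insert0 i k :
  porbit (insert0 (lift ord0 i)) (lift ord0 k) = insert_cycle i (porbit s k).
Proof.
set t := insert0 _; apply/eqP; rewrite finset.eqEsubset; apply/andP; split.
  apply/fintype.subsetP; apply: porbit_ind; first by rewrite lift_insert_cycle porbit_id.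
  move=> y; case: (unliftP ord0 y) => [l ->|->].
    rewrite lift_insert_cycle => lk.
    have [li|li] := eqVneq l i.
      by rewrite /t li insert0_pred ord0_insert_cycle -li.
    by rewrite /t insert0_lift// lift_insert_cycle porbit_step.
  by rewrite ord0_insert_cycle => ik; rewrite /t insert0_0 lift_insert_cycle porbit_step.
have sub l : l \in porbit s k -> lift ord0 l \in porbit t (lift ord0 k).
  move: l; apply: porbit_ind; first exact: porbit_id.
  move=> y /porbit_step.
  have [->|yi] := eqVneq y i; last by rewrite /t insert0_lift.
  by move=> /porbit_step; rewrite /t insert0_pred insert0_0.
apply/fintype.subsetP => y; case: (unliftP ord0 y) => [l ->|->].
  by rewrite lift_insert_cycle; exact: sub.
by rewrite ord0_insert_cycle => /sub/porbit_step; rewrite /t insert0_pred.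
Qed.

Lemma porbits_insert0 i :
  porbits (insert0 (lift ord0 i)) = insert_cycle i @: porbits s.
Proof.
apply/setP => C; apply/imsetP/imsetP.
  move=> [y _ ->]; case: (unliftP ord0 y) => [l ->|->].
    by exists (porbit s l); [exact: imset_f|rewrite porbit_insert0].
  exists (porbit s i); first exact: imset_f.
  apply/esym/eqP; rewrite -porbit_insert0 eq_porbit_mem.
  by rewrite porbit_sym -[X in X \in _](insert0_pred i) porbit_step ?porbit_id.
by move=> [_ /imsetP[k _ ->] ->]; exists (lift ord0 k); rewrite ?porbit_insert0.
Qed.

Lemma porbits_insert0_fix : porbits (insert0 ord0) =
  [set ord0] |: [set lift ord0 @: C | C : {set 'I_n} in porbits s].
Proof.
have orb k : porbit (insert0 ord0) (lift ord0 k) = lift ord0 @: porbit s k.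
  apply/eqP; rewrite finset.eqEsubset; apply/andP; split.
    apply/fintype.subsetP; apply: porbit_ind; first by apply/imset_f/porbit_id.
    move=> _ /imsetP[l lk ->]; rewrite insert0_fix_lift.
    exact/imset_f/porbit_step.
  apply/fintype.subsetP => _ /imsetP[l lk ->].
  move: l lk; apply: porbit_ind; first exact: porbit_id.
  by move=> y /porbit_step; rewrite insert0_fix_lift.
have orb0 : porbit (insert0 ord0) ord0 = [set ord0].
  apply/eqP; rewrite finset.eqEsubset finset.sub1set porbit_id andbT.
  by apply/fintype.subsetP; apply: porbit_ind => [|y]; rewrite ?set11// !inE => /eqP->; rewrite insert0_fix.
apply/setP => C; rewrite !inE; apply/imsetP/orP.
  move=> [y _ ->]; case: (unliftP ord0 y) => [l ->|->].
    by right; rewrite orb imset_f// imset_f.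
  by left; rewrite orb0.
move=> [/eqP->|/imsetP[_ /imsetP[k _ ->] ->]]; first by exists ord0.
by exists (lift ord0 k); rewrite ?orb.
Qed.

End insertion.

(** Every permutation of n+1 points arises once by deleting 0 from its cycle:
    [insert0] reinserts it. *)
Lemma sum_perm_insert0 (V : nmodType) n (F : 'S_n.+1 -> V) :
  (\sum_(s : 'S_n.+1) F s = \sum_(s : 'S_n) \sum_(j < n.+1) F (insert0 s j))%R.
Proof.
rewrite pair_bigA/= (reindex (fun p : 'S_n * 'I_n.+1 => insert0 p.1 p.2))//=.
apply: onW_bij.
apply: inj_card_bij; last by rewrite card_prod !card_Sn card_ord mulnC factS.
move=> [s i] [t j]; rewrite /insert0/= => st.
have ij : i = j.
  move/(congr1 (fun u : 'S_n.+1 => u^-1 ord0)): st.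
  have l0 (u : 'S_n) : (lift_perm ord0 ord0 u)^-1 ord0 = ord0.
    by rewrite lift_permV lift_perm_id.
  by rewrite !invMg !tpermV !permM !l0 !tpermL.
move: st; rewrite ij => /mulgI st; congr (_, _); apply/permP => k.
have := congr1 (fun u : 'S_n.+1 => u (lift ord0 k)) st.
by rewrite !lift_perm_lift => /lift_inj.
Qed.

End cycles.

Local Open Scope classical_set_scope.

(** * Boxes and the measures lambda_n *)

Section boxes.
Context d (X : measurableType d).

Definition box n (B : 'I_n -> set X) : set (n.-tuple X) :=
  [set t | forall i, B i (tnth t i)].

Lemma measurable_box n (B : 'I_n -> set X) :
  (forall i, measurable (B i)) -> measurable (box B).
Proof.
move=> mB; rewrite (_ : box B = \bigcap_(i in [set: 'I_n]) ((@tnth n X)^~ i @^-1` B i)).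
  apply: fin_bigcap_measurable => // i _.
  by rewrite -[X in measurable X]setTI; exact: measurable_tnth.
by apply/seteqP; split => t /= tB i; [move=> _|]; exact: tB.
Qed.

Lemma box_setI n (B C : 'I_n -> set X) :
  box B `&` box C = box (fun i => B i `&` C i).
Proof.
apply/seteqP; split => t /=; first by move=> [tB tC] i; split; [exact: tB|exact: tC].
by move=> tBC; split => i; have [] := tBC i.
Qed.

Definition measurable_boxes n : set (set (n.-tuple X)) :=
  [set D | exists2 B : 'I_n -> set X, (forall i, measurable (B i)) & D = box B].

Lemma measurable_boxes_setI n : setI_closed (@measurable_boxes n).
Proof.
move=> _ _ [B mB ->] [C mC ->]; rewrite box_setI.
by exists (fun i => B i `&` C i) => // i; exact: measurableI.
Qed.

Lemma measurable_tuple_boxes n :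
  @measurable _ (n.-tuple X) = <<s @measurable_boxes n >>.
Proof.
apply/seteqP; split; last first.
  apply: smallest_sub; first exact: sigma_algebra_measurable.
  by move=> _ [B mB ->]; exact: measurable_box.
apply: smallest_sub; first exact: smallest_sigma_algebra.
rewrite -bigcup_seq; apply: bigcup_sub => i _ _ [B mB <-].
apply: sub_sigma_algebra; exists (fun j => if j == i then B else setT).
  by move=> j; case: ifP.
apply/seteqP; split => t /=; first by move=> [_ Bt] j; case: eqP => // ->.
by move=> /(_ i); rewrite eqxx.
Qed.

(** Two measures on tuples agree as soon as they agree on boxes and one of them
    is finite on the cubes of an exhaustion of X. *)
Lemma measure_boxes_unique (R : realType) n (F : (set X)^nat)
    (mu nu : {measure set (n.-tuple X) -> \bar R}) :
  (forall k, measurable (F k)) -> {homo F : k l / (k <= l)%N >-> k `<=` l} ->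
  \bigcup_k F k = setT ->
  (forall k, (mu (box (fun=> F k)) < +oo)%E) ->
  (forall B, (forall i, measurable (B i)) -> mu (box B) = nu (box B)) ->
  forall A, measurable A -> mu A = nu A.
Proof.
move=> mF ndF FT Foo munu; apply: (measure_unique (@measurable_boxes n)
  (fun k => box (fun=> F k))) => //.
- exact: measurable_tuple_boxes.
- exact: measurable_boxes_setI.
- by move=> k; exists (fun=> F k).
- rewrite -subTset => t _.
  have tF i : exists k, F k (tnth t i).
    by have : setT (tnth t i) by []; rewrite -FT => -[k _ ?]; exists k.
  have [k kF] := choice tF; exists (\max_(i < n) k i)%N => // i.
  by apply: ndF (kF i); exact: leq_bigmax.
- by move=> _ [B mB ->]; exact: munu.
Qed.

End boxes.

Section lambda_boxes.
Context d (X : measurableType d) (R : realType).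
Variable alpha : {sigma_finite_measure set X -> \bar R}.
Local Open Scope ereal_scope.

Lemma power_measure_box m (B : 'I_m -> set X) : (forall i, measurable (B i)) ->
  power_measure alpha m (box B) = \prod_(i < m) alpha (B i).
Proof.
elim: m B => [|m IH] B mB.
  by rewrite big_ord0/= diracE mem_set//= => -[].
rewrite big_ord_recl/= /power_succ /pushforward.
rewrite (_ : _ @^-1` _ = B ord0 `*` box (fun i => B (lift ord0 i))).
  by rewrite product_measure1E ?IH//; exact: measurable_box.
apply/seteqP; split => -[x t]/=.
  by move=> Bt; split => [|i]; [have := Bt ord0|have := Bt (lift ord0 i); rewrite tnthS].
move=> [Bx Bt] i; case: (unliftP ord0 i) => [j ->|->]; last by [].
by rewrite tnthS; exact: Bt.
Qed.

Definition meet n (B : 'I_n -> set X) (C : {set 'I_n}) : set X :=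
  [set x | forall i, i \in C -> B i x].

Lemma measurable_meet n (B : 'I_n -> set X) C :
  (forall i, measurable (B i)) -> measurable (meet B C).
Proof.
move=> mB; rewrite (_ : meet B C = \bigcap_(i in [set i : 'I_n | i \in C]) B i).
  by apply: fin_bigcap_measurable.
by apply/seteqP; split => t.
Qed.

(** The variables of one cycle are identified, so that their common value has to
    lie in all the sides of the box that belong to the cycle. *)
Lemma cycle_measure_box n (s : 'S_n) (B : 'I_n -> set X) :
  (forall i, measurable (B i)) ->
  cycle_measure alpha s (box B) = \prod_(C in porbits s) alpha (meet B C).
Proof.
move=> mB; rewrite big_enum_val/= -power_measure_box; last first.
  by move=> k; exact: measurable_meet.
rewrite /cycle_measure /pushforward; congr (power_measure _ _ _).
have memC i k : (i \in (enum_val k : {set 'I_n})) = (cycle_rank s i == k).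
  have /imsetP[j _ kj] := enum_valP k.
  have -> : k = cycle_rank s j.
    by apply: enum_val_inj; rewrite kj enum_rankK_in ?porbit_in_porbits.
  rewrite cycle_rankE enum_rankK_in ?porbit_in_porbits//.
  by rewrite porbit_sym.
apply/seteqP; split => t /=.
  move=> Bt k i; rewrite memC => /eqP <-.
  by have := Bt i; rewrite tnth_mktuple.
by move=> Bt i; rewrite tnth_mktuple; apply: Bt; rewrite memC.
Qed.

Lemma lambda_box n (B : 'I_n -> set X) : (forall i, measurable (B i)) ->
  lambda alpha n (box B) =
  \sum_(s : 'S_n) \prod_(C in porbits s) alpha (meet B C).
Proof. by move=> mB; apply: eq_bigr => s _; exact: cycle_measure_box. Qed.

Lemma lambda_box_lty n (B : 'I_n -> set X) : (forall i, measurable (B i)) ->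
  (forall i, alpha (B i) < +oo) -> lambda alpha n (box B) < +oo.
Proof.
move=> mB Boo; rewrite lambda_box// -ge0_fin_numE; last first.
  by apply: sume_ge0 => s _; exact: prode_ge0.
apply/sum_fin_numP => s _ _.
apply: prode_fin_num => C /imsetP[i _ ->].
rewrite ge0_fin_numE//; apply: le_lt_trans (Boo i); apply: le_measure.
- by rewrite inE; exact: measurable_meet.
- by rewrite inE.
- by move=> x; apply; exact: porbit_id.
Qed.

(** One exhaustion of X serves all the lambda_n, since every cycle of a
    permutation puts a factor alpha (F k) on the cube with side F k. *)
Lemma sigma_finite_cubes : exists F : (set X)^nat,
  [/\ forall k, measurable (F k) /\ alpha (F k) < +oo,
      {homo F : k l / (k <= l)%N >-> k `<=` l}, \bigcup_k F k = setT &
      forall n k, lambda alpha n (box (fun=> F k)) < +oo].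
Proof.
have /sigma_finiteP[F [FT ndF Foo]] := sigma_finiteT alpha.
exists F; split => //.
  by move=> k l kl; exact/subsetPset/ndF.
by move=> n k; apply: lambda_box_lty => i; have [] := Foo k.
Qed.

Let lambda_sigma_finite n : sigma_finite setT (lambda alpha n).
Proof.
have [F [mF ndF FT Foo]] := sigma_finite_cubes.
exists (fun k => box (fun=> F k)); last first.
  by move=> k; split; [apply: measurable_box => i; case: (mF k)|exact: Foo].
apply/esym; rewrite -subTset => t _.
have tF i : exists k, F k (tnth t i).
  by have : setT (tnth t i) by []; rewrite -FT => -[k _ ?]; exists k.
have [k kF] := choice tF; exists (\max_(i < n) k i)%N => // i.
by apply: ndF (kF i); exact: leq_bigmax.
Qed.

HB.instance Definition _ n := Measure_isSigmaFinite.Build _ _ _ (lambda alpha n)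
  (@lambda_sigma_finite n).

Lemma measurable_permute n (s : 'S_n) : measurable_fun setT (@permute _ X n s).
Proof.
apply/measurable_fun_tnthP => i.
rewrite (_ : _ \o _ = (@tnth n X)^~ (s i)); first exact: measurable_tnth.
by apply/funext => t; rewrite /= tnth_mktuple.
Qed.

Lemma preimage_permute_box n (s : 'S_n) (B : 'I_n -> set X) :
  permute s @^-1` box B = box (fun i => B (s^-1%g i)).
Proof.
apply/seteqP; split => t /= Bt i; last by rewrite tnth_mktuple -{1}(permK s i).
by have := Bt (s^-1%g i); rewrite tnth_mktuple permKV.
Qed.

(** Conjugating by t carries the cycles of a permutation to their images under
    t, so that the formula for boxes is invariant under permutations of the
    coordinates. *)
Lemma lambda_permute n (t : 'S_n) A : measurable A ->
  lambda alpha n (permute t @^-1` A) = lambda alpha n A.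
Proof.
move=> mA; have mt := @measurable_permute n t.
have [F [mF ndF FT Foo]] := sigma_finite_cubes.
apply/esym; apply: (measure_boxes_unique (F := F)
  (nu := pushforward (lambda alpha n) (permute t))) => //.
- by move=> k; case: (mF k).
- exact: Foo.
move=> B mB; rewrite /= /pushforward preimage_permute_box !lambda_box//.
rewrite [RHS](reindex_inj (conjg_inj t)); apply: eq_bigr => s _ /=.
rewrite porbits_conj [RHS]big_imset/=; last by move=> C D _ _; exact: (finset.imset_inj perm_inj).
apply: eq_bigr => C _; congr (alpha _); apply/seteqP; split => x /= Bx i.
  by move=> /imsetP[j Cj ->]; rewrite permK; exact: Bx.
by move=> Ci; have := Bx (t i); rewrite permK; apply; exact: imset_f.
Qed.

(** ** Chinese restaurant recursion

    The recursion expresses that a permutation of n+1 points is obtained by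
    making the new point a cycle of its own or by putting it after one of the n
    old points. *)

Definition dup n (i : 'I_n) (x : n.-tuple X) : n.+1.-tuple X :=
  [tuple of tnth x i :: x].

Lemma measurable_dup n (i : 'I_n) : measurable_fun setT (@dup n i).
Proof. by apply: measurable_cons => //; exact: measurable_tnth. Qed.

Section dup_measure.
Variables (n : nat) (i : 'I_n).

Definition dup_measure := pushforward (lambda alpha n) (@dup n i).

Let dup_measure0 : dup_measure set0 = 0.
Proof. by rewrite /dup_measure /pushforward preimage_set0 measure0. Qed.

Let dup_measure_ge0 A : 0 <= dup_measure A.
Proof. have md := measurable_dup i; exact: measure_ge0. Qed.

Let dup_measure_sigma_additive : semi_sigma_additive dup_measure.
Proof. have md := measurable_dup i; exact: measure_semi_sigma_additive. Qed.

HB.instance Definition _ := isMeasure.Build _ _ _ dup_measure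
  dup_measure0 dup_measure_ge0 dup_measure_sigma_additive.

End dup_measure.

(** A new fixed point contributes the factor alpha (B ord0). Inserting the new
    point behind i intersects the side i of the box with B ord0, which is also
    the effect of duplicating the i-th coordinate. *)
Lemma lambda_succ_box n (B : 'I_n.+1 -> set X) : (forall i, measurable (B i)) ->
  lambda alpha n.+1 (box B) =
  power_succ alpha (lambda alpha n) (box B) + \sum_(i < n) dup_measure i (box B).
Proof.
move=> mB; rewrite lambda_box// sum_perm_insert0.
have -> : power_succ alpha (lambda alpha n) (box B) =
    \sum_(s : 'S_n) \prod_(C in porbits (insert0 s ord0)) alpha (meet B C).
  rewrite /power_succ /pushforward.
  rewrite (_ : _ @^-1` _ = B ord0 `*` box (fun i => B (lift ord0 i))); last first.
    apply/seteqP; split => -[x t]/=.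
      move=> Bt; split => [|i]; first exact: (Bt ord0).
      by have := Bt (lift ord0 i); rewrite tnthS.
    move=> [Bx Bt] i; case: (unliftP ord0 i) => [j ->|->]; last by [].
    by rewrite tnthS; exact: Bt.
  rewrite product_measure1E//; last exact: measurable_box.
  rewrite [X in _ * X](lambda_box (B := fun i => B (lift ord0 i)))//.
  rewrite ge0_sume_distrr; last by move=> s _; exact: prode_ge0.
  apply: eq_bigr => s _; rewrite porbits_insert0_fix big_setU1/=; last first.
    apply/imsetP => -[C _ /setP/(_ ord0)]; rewrite inE eqxx => /esym/imsetP[j _] /eqP.
    by rewrite (negbTE (neq_lift _ _)).
  congr (alpha _ * _).
    apply/seteqP; split => x; first by move=> Bx i; rewrite inE => /eqP ->.
    by apply; rewrite inE.
  rewrite [RHS]big_imset/=; last by move=> C D _ _; exact: (finset.imset_inj lift_inj).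
  apply: eq_bigr => C _; congr (alpha _); apply/seteqP; split => x /= Bx i.
    by move=> /imsetP[j Cj ->]; exact: Bx.
  by move=> Ci; apply: Bx; exact: imset_f.
have dupE (i : 'I_n) : dup_measure i (box B) = \sum_(s : 'S_n)
    \prod_(C in porbits (insert0 s (lift ord0 i))) alpha (meet B C).
  (* The preimage of the box under the duplication of coordinate i. *)
  pose B' j := if j == i then B (lift ord0 j) `&` B ord0 else B (lift ord0 j).
  have mB' j : measurable (B' j).
    by rewrite /B'; case: ifP => // _; exact: measurableI.
  have -> : dup_measure i (box B) = lambda alpha n (box B').
    rewrite /dup_measure /pushforward; congr (lambda alpha n _).
    apply/seteqP; split => t /= Bt j.
      rewrite /B'; case: eqP => [->|_]; last by have := Bt (lift ord0 j); rewrite tnthS.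
      by have := Bt (lift ord0 i); have := Bt ord0; rewrite tnthS.
    case: (unliftP ord0 j) => [k ->|->]; last by have := Bt i; rewrite /B' eqxx => -[].
    by rewrite tnthS; have := Bt k; rewrite /B'; case: ifP => // _ [].
  rewrite lambda_box//; apply: eq_bigr => s _.
  rewrite porbits_insert0 [RHS]big_imset/=; last by move=> C D _ _; exact: insert_cycle_inj.
  apply: eq_bigr => C _; congr (alpha _); apply/seteqP; split => x /= Bx j.
    case: (unliftP ord0 j) => [k ->|->].
      by rewrite lift_insert_cycle => /Bx; rewrite /B'; case: ifP => // _ [].
    by rewrite ord0_insert_cycle => /Bx; rewrite /B' eqxx => -[].
  rewrite /B' => Cj; case: eqP => [ji|_]; last by apply: Bx; rewrite lift_insert_cycle.
  by split; apply: Bx; rewrite ?lift_insert_cycle// ord0_insert_cycle -ji.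
rewrite [X in _ + X](eq_bigr _ (fun i _ => dupE i)) [X in _ + X]exchange_big/= -big_split/=.
by apply: eq_bigr => s _; rewrite big_ord_recl.
Qed.

(** The two sides are integrals against measures that agree on boxes. *)
Lemma ge0_integral_lambda_succ n (f : n.+1.-tuple X -> \bar R) :
  measurable_fun setT f -> (forall x, 0 <= f x) ->
  \int[lambda alpha n.+1]_x f x =
  \int[lambda alpha n]_x \int[alpha]_y f [tuple of y :: x] +
  \sum_(i < n) \int[lambda alpha n]_x f (dup i x).
Proof.
move=> mf f0.
(* [msum] takes a sequence of measures, of which it adds the first n. *)
pose m_ k : {measure set (n.+1.-tuple X) -> \bar R} :=
  if insub k is Some i then @dup_measure n i else mzero.
have [F [mF ndF FT Foo]] := sigma_finite_cubes.
pose nu := measure_add (power_succ alpha (lambda alpha n)) (msum m_ n).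
rewrite (eq_measure_integral nu); last first.
  move=> A mA _; apply: (measure_boxes_unique (F := F)) mA => //.
  - by move=> k; case: (mF k).
  - exact: Foo.
  move=> B mB; transitivity (power_succ alpha (lambda alpha n) (box B) + msum m_ n (box B)).
    rewrite [LHS]lambda_succ_box// /msum.
    by congr (_ + _); apply: eq_bigr => i _; rewrite /m_ valK.
  exact/esym/measure_addE.
rewrite ge0_integral_measure_add// ge0_integral_measure_sum//; congr (_ + _).
  rewrite ge0_integral_pushforward//; last exact: measurable_cons_pair.
  have mfc : measurable_fun setT (f \o @cons_pair _ X n).
    by apply: measurableT_comp => //; exact: measurable_cons_pair.
  by rewrite fubini_tonelli1 ?fubini_tonelli// => p; exact: f0.
apply: eq_bigr => i _; rewrite /m_ valK ge0_integral_pushforward//.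
exact: measurable_dup.
Qed.

End lambda_boxes.

(** * Complex square-integrable functions *)

Section complex_parts.
Context (R : realType).
Implicit Types (a b : R[i]) (x y : R).

Lemma eq_complexP a b :
  complex.Re a = complex.Re b -> complex.Im a = complex.Im b -> a = b.
Proof. by case: a b => ? ? [? ?] /= -> ->. Qed.

Lemma Re_add a b : complex.Re (a + b) = complex.Re a + complex.Re b.
Proof. by case: a b => ? ? []. Qed.

Lemma Im_add a b : complex.Im (a + b) = complex.Im a + complex.Im b.
Proof. by case: a b => ? ? []. Qed.

Lemma Re_mul a b : complex.Re (a * b) =
  complex.Re a * complex.Re b - complex.Im a * complex.Im b.
Proof. by case: a b => ? ? []. Qed.

Lemma Im_mul a b : complex.Im (a * b) =
  complex.Re a * complex.Im b + complex.Im a * complex.Re b.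
Proof. by case: a b => ? ? []. Qed.

Lemma Re_of_conj a : complex.Re (a^*)%C = complex.Re a.
Proof. by case: a. Qed.

Lemma Im_of_conj a : complex.Im (a^*)%C = - complex.Im a.
Proof. by case: a. Qed.

Lemma Re_opp a : complex.Re (- a) = - complex.Re a.
Proof. by case: a. Qed.

Lemma Im_opp a : complex.Im (- a) = - complex.Im a.
Proof. by case: a. Qed.

Lemma conj_conj a : (a^*%C)^*%C = a.
Proof. by case: a => x y; rewrite /= opprK. Qed.

Lemma conjM a b : (a * b)^*%C = a^*%C * b^*%C.
Proof. exact: rmorphM. Qed.

Lemma conjD a b : (a + b)^*%C = a^*%C + b^*%C.
Proof. exact: rmorphD. Qed.

Lemma conjN a : (- a)^*%C = - a^*%C.
Proof. exact: rmorphN. Qed.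

Lemma conj0 : (0 : R[i])^*%C = 0.
Proof. exact: rmorph0. Qed.

Lemma sqnorm0 : sqnorm (0 : R[i]) = 0.
Proof. by rewrite sqnormE /= expr0n addr0. Qed.

Lemma sqnorm_eq0 a : sqnorm a = 0 -> a = 0.
Proof.
rewrite sqnormE => /eqP; rewrite paddr_eq0 ?sqr_ge0// !sqrf_eq0.
by move=> /andP[/eqP ar /eqP ai]; exact: eq_complexP.
Qed.

Lemma sqnormN a : sqnorm (- a) = sqnorm a.
Proof. by rewrite !sqnormE Re_opp Im_opp !sqrrN. Qed.

Lemma sqnormM a b : sqnorm (a * b) = sqnorm a * sqnorm b.
Proof. by rewrite /sqnorm ComplexField.Normc.normcM exprMn. Qed.

Lemma sqnorm1 : sqnorm (1 : R[i]) = 1.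
Proof. by rewrite sqnormE /= expr1n expr0n addr0. Qed.

Lemma sqnorm_conj a : sqnorm (a^*)%C = sqnorm a.
Proof. by rewrite !sqnormE Re_of_conj Im_of_conj sqrrN. Qed.

Lemma sqnorm_triangle a b c : sqnorm (a - c) <= 2 * sqnorm (a - b) + 2 * sqnorm (b - c).
Proof.
have := sqnorm_lin 1 (a - b) (b - c).
by rewrite mul1r sqnorm1 mulr1 addrA subrK.
Qed.

Lemma Re_conj_mul a b : `|complex.Re ((a^*)%C * b)| <= (sqnorm a + sqnorm b).
Proof.
rewrite Re_mul Re_of_conj Im_of_conj !sqnormE ler_norml.
case: a b => p q [r s] /=.
have := sqr_ge0 (p + r); have := sqr_ge0 (p - r).
have := sqr_ge0 (q + s); have := sqr_ge0 (q - s).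
have := sqr_ge0 p; have := sqr_ge0 q; have := sqr_ge0 r; have := sqr_ge0 s.
by move=> *; apply/andP; split; nra.
Qed.

Lemma Im_conj_mul a b : `|complex.Im ((a^*)%C * b)| <= (sqnorm a + sqnorm b).
Proof.
rewrite Im_mul Re_of_conj Im_of_conj !sqnormE ler_norml.
case: a b => p q [r s] /=.
have := sqr_ge0 (p + s); have := sqr_ge0 (p - s).
have := sqr_ge0 (q + r); have := sqr_ge0 (q - r).
have := sqr_ge0 p; have := sqr_ge0 q; have := sqr_ge0 r; have := sqr_ge0 s.
by move=> *; apply/andP; split; nra.
Qed.

Lemma conj_mul_self a : (a^*)%C * a = Complex (sqnorm a) 0.
Proof.
apply: eq_complexP; rewrite ?Re_mul ?Im_mul Re_of_conj Im_of_conj ?sqnormE /=; first ring.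
ring.
Qed.

End complex_parts.

Section complex_measurable.
Context d (T : measurableType d) (R : realType).
Implicit Types f g : T -> R[i].

Lemma cmeasurableM f g : cmeasurable f -> cmeasurable g ->
  cmeasurable (fun x => f x * g x).
Proof.
move=> [fr fi] [gr gi]; split.
  under eq_fun do rewrite Re_mul.
  by apply: measurable_funB; exact: measurable_funM.
under eq_fun do rewrite Im_mul.
by apply: measurable_funD; exact: measurable_funM.
Qed.

Lemma cmeasurable_conj f : cmeasurable f -> cmeasurable (fun x => (f x)^*%C).
Proof.
move=> [fr fi]; split; first by under eq_fun do rewrite Re_of_conj.
by under eq_fun do rewrite Im_of_conj; exact: measurableT_comp.
Qed.

Lemma cmeasurable_cst (c : R[i]) : cmeasurable (fun _ : T => c).
Proof. by split; exact: measurable_cst. Qed.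

Lemma cmeasurableD f g : cmeasurable f -> cmeasurable g ->
  cmeasurable (fun x => f x + g x).
Proof.
move=> [fr fi] [gr gi]; split.
  by under eq_fun do rewrite Re_add; exact: measurable_funD.
by under eq_fun do rewrite Im_add; exact: measurable_funD.
Qed.

Lemma cmeasurableB f g : cmeasurable f -> cmeasurable g ->
  cmeasurable (fun x => f x - g x).
Proof.
move=> [fr fi] [gr gi]; split.
  by under eq_fun do rewrite Re_add Re_opp; exact: measurable_funB.
by under eq_fun do rewrite Im_add Im_opp; exact: measurable_funB.
Qed.

Lemma cmeasurable_sum (I : Type) (r : seq I) (F : I -> T -> R[i]) :
  (forall i, cmeasurable (F i)) -> cmeasurable (fun x => \sum_(i <- r) F i x).
Proof.
move=> mF; elim: r => [|i r IH].
  by under eq_fun do rewrite big_nil; exact: cmeasurable0.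
by under eq_fun do rewrite big_cons; exact: cmeasurableD.
Qed.

Lemma cmeasurable_comp d' (S : measurableType d') (h : S -> T) f :
  measurable_fun setT h -> cmeasurable f -> cmeasurable (f \o h).
Proof. by move=> mh [fr fi]; split; [exact: measurableT_comp fr mh|exact: measurableT_comp fi mh]. Qed.

End complex_measurable.

Section complex_integral.
Context d (T : measurableType d) (R : realType).
Variable mu : {measure set T -> \bar R}.
Implicit Types f g : T -> R[i].

Definition cintegrable f : Prop :=
  mu.-integrable setT (EFin \o (fun x => complex.Re (f x))) /\
  mu.-integrable setT (EFin \o (fun x => complex.Im (f x))).

Lemma cintegrableZD a f g : cintegrable f -> cintegrable g ->
  cintegrable (fun x => a * f x + g x).
Proof.
move=> [fr fi] [gr gi]; case: a => a b; split.
- rewrite (_ : _ \o _ = fun x => (a%:E * (complex.Re (f x))%:E -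
      b%:E * (complex.Im (f x))%:E + (complex.Re (g x))%:E)%E).
    apply: integrableD => //; apply: integrableB => //;
    exact: integrableZl.
  by apply/funext => x /=; rewrite Re_add Re_mul -!EFinM -EFinB.
- rewrite (_ : _ \o _ = fun x => (a%:E * (complex.Im (f x))%:E +
      b%:E * (complex.Re (f x))%:E + (complex.Im (g x))%:E)%E).
    apply: integrableD => //; apply: integrableD => //;
    exact: integrableZl.
  by apply/funext => x /=; rewrite Im_add Im_mul -!EFinM -EFinD.
Qed.

Lemma cintegralZD a f g : cintegrable f -> cintegrable g ->
  cintegral mu (fun x => a * f x + g x) = a * cintegral mu f + cintegral mu g.
Proof.
move=> If Ig; have [fr fi] := If; have [gr gi] := Ig.
have Z (c : R) (h : T -> R) : mu.-integrable setT (EFin \o h) ->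
    mu.-integrable setT (EFin \o (fun x => c * h x)).
  by move=> Ih; exact: (integrableZl measurableT c Ih).
case: a => a b; apply: eq_complexP.
- rewrite Re_add Re_mul /=; under eq_Rintegral do rewrite Re_add Re_mul/=.
  rewrite RintegralD//; last first.
    by apply: (integrableB measurableT (Z a _ fr) (Z b _ fi)).
  by rewrite RintegralB ?RintegralZl//; [exact: Z|exact: Z].
- rewrite Im_add Im_mul /=; under eq_Rintegral do rewrite Im_add Im_mul/=.
  rewrite RintegralD//; last first.
    by apply: (integrableD measurableT (Z a _ fi) (Z b _ fr)).
  by rewrite RintegralD ?RintegralZl//; [exact: Z|exact: Z].
Qed.

Lemma cintegrable0 : cintegrable (fun=> 0).
Proof. by split; exact: integrable0. Qed.

Lemma cintegral0 : cintegral mu (fun=> 0) = 0.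
Proof.
by apply: eq_complexP; rewrite /= /Rintegral integral0_eq.
Qed.

Lemma cintegrableD f g : cintegrable f -> cintegrable g ->
  cintegrable (fun x => f x + g x).
Proof.
move=> If Ig; have := cintegrableZD 1 If Ig.
by under [X in cintegrable X -> _]eq_fun do rewrite mul1r.
Qed.

Lemma cintegrable_conj f : cintegrable f -> cintegrable (fun x => (f x)^*%C).
Proof.
move=> [fr fi]; split.
  by rewrite (_ : _ \o _ = EFin \o (fun x => complex.Re (f x)))//; apply/funext => x /=; rewrite Re_of_conj.
rewrite (_ : _ \o _ = -%E \o (EFin \o (fun x => complex.Im (f x)))); first exact: integrableN.
by apply/funext => x /=; rewrite Im_of_conj.
Qed.

Lemma cintegralZ a f : cintegrable f ->
  cintegral mu (fun x => a * f x) = a * cintegral mu f.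
Proof.
move=> If; have := cintegralZD a If cintegrable0.
by under [X in cintegral _ X = _ -> _]eq_fun do rewrite addr0; rewrite cintegral0 addr0.
Qed.

Lemma cintegralD f g : cintegrable f -> cintegrable g ->
  cintegral mu (fun x => f x + g x) = cintegral mu f + cintegral mu g.
Proof.
move=> If Ig; have := cintegralZD 1 If Ig.
by under [X in cintegral _ X = _ -> _]eq_fun do rewrite mul1r; rewrite mul1r.
Qed.

Lemma cintegrable_sum (I : Type) (r : seq I) (F : I -> T -> R[i]) :
  (forall i, cintegrable (F i)) -> cintegrable (fun x => \sum_(i <- r) F i x).
Proof.
move=> IF; elim: r => [|i r IH].
  by under eq_fun do rewrite big_nil; exact: cintegrable0.
by under eq_fun do rewrite big_cons; exact: cintegrableD.
Qed.

Lemma cintegral_sum (I : Type) (r : seq I) (F : I -> T -> R[i]) :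
  (forall i, cintegrable (F i)) ->
  cintegral mu (fun x => \sum_(i <- r) F i x) = \sum_(i <- r) cintegral mu (F i).
Proof.
move=> IF; elim: r => [|i r IH].
  by under [in LHS]eq_fun do rewrite big_nil; rewrite big_nil cintegral0.
under [in LHS]eq_fun do rewrite big_cons; rewrite big_cons cintegralD ?IH//.
exact: cintegrable_sum.
Qed.

Lemma cintegral_conj f : cintegrable f ->
  cintegral mu (fun x => (f x)^*%C) = (cintegral mu f)^*%C.
Proof.
move=> [fr fi]; apply: eq_complexP; rewrite ?Re_of_conj ?Im_of_conj /=.
  by under eq_Rintegral do rewrite Re_of_conj.
under eq_Rintegral do rewrite Im_of_conj -mulN1r.
by rewrite RintegralZl// mulN1r.
Qed.

Lemma ae_eq_cintegral f g : cmeasurable f -> cmeasurable g ->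
  {ae mu, forall x, f x = g x} -> cintegral mu f = cintegral mu g.
Proof.
move=> [fr fi] [gr gi] fg; apply: eq_complexP; rewrite /= /Rintegral; congr fine.
  apply: ae_eq_integral => //; [exact/measurable_EFinP|exact/measurable_EFinP|].
  by move: fg; apply: filterS => x -> _.
apply: ae_eq_integral => //; [exact/measurable_EFinP|exact/measurable_EFinP|].
by move: fg; apply: filterS => x -> _.
Qed.

(** The squared L2 seminorm. It takes extended values so that square
    integrability is the finiteness of it. *)
Definition msq f : \bar R := (\int[mu]_x (sqnorm (f x))%:E)%E.

Lemma measurable_sqnormE f : cmeasurable f ->
  measurable_fun setT (fun x => (sqnorm (f x))%:E).
Proof. by move=> mf; apply/measurable_EFinP; exact: measurable_sqnorm. Qed.

Lemma msq_ge0 f : (0 <= msq f)%E.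
Proof. by apply: integral_ge0 => x _; rewrite lee_fin sqnorm_ge0. Qed.

Lemma msq_le f g (a b : R) h : cmeasurable f -> cmeasurable g -> cmeasurable h ->
  0 <= a -> 0 <= b ->
  (forall x, sqnorm (h x) <= a * sqnorm (f x) + b * sqnorm (g x)) ->
  (msq h <= a%:E * msq f + b%:E * msq g)%E.
Proof.
move=> mf mg mh a0 b0 hfg.
have sf := measurable_sqnormE mf; have sg := measurable_sqnormE mg.
have s0 (k : T -> R[i]) x : [set: T] x -> (0 <= (sqnorm (k x))%:E)%E.
  by rewrite lee_fin sqnorm_ge0.
rewrite -!ge0_integralZl_EFin//; [|exact: s0..].
rewrite -ge0_integralD//; last 4 first.
- by move=> x _; rewrite mule_ge0 ?lee_fin ?sqnorm_ge0.
- exact: measurable_funeM.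
- by move=> x _; rewrite mule_ge0 ?lee_fin ?sqnorm_ge0.
- exact: measurable_funeM.
apply: ge0_le_integral => //.
- exact: s0.
- exact: measurable_sqnormE.
- by apply: emeasurable_funD; exact: measurable_funeM.
- by move=> x _; rewrite -!EFinM -EFinD lee_fin.
Qed.

(** The factor 2 makes up for squaring the triangle inequality. *)
Lemma msq_triangle f g h : cmeasurable f -> cmeasurable g -> cmeasurable h ->
  (msq (fun x => f x - h x)%R
    <= 2%:E * msq (fun x => f x - g x)%R + 2%:E * msq (fun x => g x - h x)%R)%E.
Proof.
move=> mf mg mh; apply: msq_le; rewrite ?ler0n//; try exact: cmeasurableB.
by move=> x; exact: sqnorm_triangle.
Qed.

Lemma ae_eq_msq f g : cmeasurable f -> cmeasurable g ->
  {ae mu, forall x, f x = g x} -> msq f = msq g.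
Proof.
move=> mf mg fg; apply: ge0_ae_eq_integral => //.
- exact: measurable_sqnormE.
- exact: measurable_sqnormE.
- by move=> x _; rewrite lee_fin sqnorm_ge0.
- by move=> x _; rewrite lee_fin sqnorm_ge0.
- by move: fg; apply: filterS => x -> _.
Qed.

Lemma msq_eq0 f : cmeasurable f -> msq f = 0%E -> {ae mu, forall x, f x = 0}.
Proof.
move=> mf f0.
have := (ae_eq_integral_abs mu measurableT (measurable_sqnormE mf)).1.
have -> : (\int[mu]_x `|(sqnorm (f x))%:E|)%E = 0%E.
  by rewrite -[RHS]f0; apply: eq_integral => x _; rewrite gee0_abs// lee_fin sqnorm_ge0.
move=> /(_ erefl); apply: filterS => x /(_ I) [].
exact: sqnorm_eq0.
Qed.

Lemma cintegrable_conj_mul f g : cmeasurable f -> cmeasurable g ->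
  (msq f < +oo)%E -> (msq g < +oo)%E -> cintegrable (fun x => (f x)^*%C * g x).
Proof.
move=> mf mg foo goo.
have I : mu.-integrable setT (EFin \o (fun x => sqnorm (f x) + sqnorm (g x))).
  have S (k : T -> R[i]) : cmeasurable k -> (msq k < +oo)%E ->
      mu.-integrable setT (EFin \o (fun x => sqnorm (k x))).
    move=> mk koo; apply/integrableP; split; first exact: measurable_sqnormE.
    by under eq_integral do rewrite gee0_abs ?lee_fin ?sqnorm_ge0//.
  exact: (integrableD measurableT (S _ mf foo) (S _ mg goo)).
have [mr mi] := cmeasurableM (cmeasurable_conj mf) mg.
split; apply: le_integrable I => //; do ?exact/measurable_EFinP.
  move=> x _; rewrite lee_fin (le_trans (Re_conj_mul _ _))//.
  by rewrite ger0_norm// addr_ge0 ?sqnorm_ge0.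
move=> x _; rewrite lee_fin (le_trans (Im_conj_mul _ _))//.
by rewrite ger0_norm// addr_ge0 ?sqnorm_ge0.
Qed.

Lemma cintegral_conj_mul_self f : cintegral mu (fun x => (f x)^*%C * f x) =
  Complex (fine (msq f)) 0.
Proof.
apply: eq_complexP; rewrite /= /Rintegral; first by under eq_integral do rewrite conj_mul_self/=.
by under eq_integral do rewrite conj_mul_self/=; rewrite integral0_eq.
Qed.

End complex_integral.

(** * Completeness of L2 *)

Section L2_complete.
Context d (T : measurableType d) (R : realType).
Variable mu : {measure set T -> \bar R}.

(** Increments that are square summable with geometric weights are absolutely
    summable; the weights 4^j against the bounds 2^-j replace Minkowski's
    inequality. *)
Lemma cvg_weighted_increments (u : R^nat) (S : R) :
  (forall j, 4 ^+ j * (u j.+1 - u j) ^+ 2 <= S) -> cvgn u.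
Proof.
move=> uS; have S0 : 0 <= S by apply: le_trans (uS 0%N); rewrite mulr_ge0 ?sqr_ge0.
have le j : `|u j.+1 - u j| <= geometric (S + 1) 2^-1 j.
  rewrite /geometric/= -ler_sqr ?nnegrE ?mulr_ge0 ?exprn_ge0 ?addr_ge0//.
  rewrite real_normK ?num_real// exprMn -exprM mulnC exprM.
  have -> : 2^-1 ^+ 2 = 4^-1 :> R by rewrite exprVn -natrX.
  rewrite exprVn ler_pdivlMr ?exprn_gt0// mulrC (le_trans (uS j))//; nra.
have c : cvgn (series (telescope u)).
  apply: (@normed_cvg _ R^o); apply: (series_le_cvg (v_ := geometric (S + 1) 2^-1)).
  - by move=> n; exact: normr_ge0.
  - by move=> n; rewrite /geometric/= mulr_ge0 ?exprn_ge0 ?addr_ge0.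
  - exact: le.
  - by apply: is_cvg_geometric_series; rewrite ger0_norm// invf_lt1// ltr1n.
have -> : u = cst (u 0%N) \+ series (telescope u).
  by apply/funext => j; rewrite /= {1}(eq_sum_telescope u j).
by apply: is_cvgD => //; exact: is_cvg_cst.
Qed.

Lemma measurable_fun_limn_einf (h : nat -> T -> \bar R) :
  (forall j, measurable_fun setT (h j)) ->
  measurable_fun setT (fun x => limn_einf (h ^~ x)).
Proof.
move=> mh; rewrite (_ : (fun _ => _) = fun x => (- limn_esup (fun j => - h j x))%E).
  apply: measurableT_comp => //; apply: measurable_fun_limn_esup => j.
  exact: measurableT_comp.
by apply/funext => x; rewrite (limn_esupN (h ^~ x)) oppeK.
Qed.

Lemma limn_einf_ge0 (u : (\bar R)^nat) : (forall j, 0 <= u j)%E -> (0 <= limn_einf u)%E.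
Proof.
move=> u0; rewrite limn_einf_lim; apply: lime_ge; first exact: is_cvg_einfs.
by apply: nearW => n; apply: le_ereal_inf_tmp => _ [j _ <-].
Qed.

(** The limes superior is measurable in any case, and it is the limit wherever
    there is one. *)
Definition climit (g : nat -> T -> R[i]) (x : T) : R[i] :=
  Complex (fine (limn_esup (fun j => (complex.Re (g j x))%:E)))
          (fine (limn_esup (fun j => (complex.Im (g j x))%:E))).

Lemma cmeasurable_climit g : (forall j, cmeasurable (g j)) ->
  cmeasurable (climit g).
Proof.
move=> mg; split; apply: measurableT_comp => //; apply: measurable_fun_limn_esup.
  by move=> j; apply/measurable_EFinP; case: (mg j).
by move=> j; apply/measurable_EFinP; case: (mg j).
Qed.

Lemma cvg_climit (g : nat -> T -> R[i]) x :
  cvgn (fun j => complex.Re (g j x)) -> cvgn (fun j => complex.Im (g j x)) ->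
  (fun j => complex.Re (g j x)) @ \oo --> complex.Re (climit g x) /\
  (fun j => complex.Im (g j x)) @ \oo --> complex.Im (climit g x).
Proof.
have E (u : R^nat) : cvgn u -> u @ \oo --> fine (limn_esup (fun j => (u j)%:E)).
  move=> /cvg_ex[l ul]; rewrite (_ : fine _ = l)//.
  have ulE : (fun j => (u j)%:E) @ \oo --> l%:E by apply: cvg_EFin; [exact: nearW|exact: ul].
  by rewrite is_cvg_limn_esupE ?(cvg_lim _ ulE)//; apply/cvg_ex; exists l%:E.
by move=> /E ? /E ?.
Qed.

Lemma cvg_sqnorm (a : R[i]) (u : nat -> R[i]) (l : R[i]) :
  (fun j => complex.Re (u j)) @ \oo --> complex.Re l ->
  (fun j => complex.Im (u j)) @ \oo --> complex.Im l ->
  (fun j => sqnorm (a - u j)) @ \oo --> sqnorm (a - l).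
Proof.
move=> ur ui; rewrite sqnormE; under eq_fun do rewrite sqnormE !Re_add !Im_add !Re_opp !Im_opp.
rewrite Re_add Im_add Re_opp Im_opp; apply: cvgD.
  by rewrite expr2; under eq_fun do rewrite expr2;
    apply: cvgM; apply: cvgB => //; exact: cvg_cst.
by rewrite expr2; under eq_fun do rewrite expr2;
  apply: cvgM; apply: cvgB => //; exact: cvg_cst.
Qed.

(** The sum of 4^j |g_{j+1} - g_j|^2 has a finite integral, as 4^j 16^-j is
    summable. Hence it is finite almost everywhere and bounds each of its
    terms. *)
Lemma ae_cvg_climit (g : nat -> T -> R[i]) : (forall j, cmeasurable (g j)) ->
  (forall j, msq mu (fun x => g j.+1 x - g j x)%R <= ((16 ^- j : R))%:E)%E ->
  {ae mu, forall x,
    (fun j => complex.Re (g j x)) @ \oo --> complex.Re (climit g x) /\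
    (fun j => complex.Im (g j x)) @ \oo --> complex.Im (climit g x)}.
Proof.
move=> mg g16.
pose D j x := (4 ^+ j * sqnorm (g j.+1 x - g j x)).
have D0 j x : 0 <= D j x by apply: mulr_ge0; [exact: exprn_ge0|exact: sqnorm_ge0].
have mD j : measurable_fun setT (fun x => (D j x)%:E).
  by apply/measurable_EFinP/measurable_funM => //; exact/measurable_sqnorm/cmeasurableB.
pose S x := (\sum_(0 <= j <oo) (D j x)%:E)%E.
have mS : measurable_fun setT S.
  by apply: ge0_emeasurable_sum => // j x _ _; rewrite lee_fin.
have S0 x : (0 <= S x)%E by apply: nneseries_ge0 => j _ _; rewrite lee_fin.
have Soo : (\int[mu]_x S x < +oo)%E.
  rewrite integral_nneseries//; last by move=> j x _; rewrite lee_fin.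
  have half := @cvg_geometric_eseries_half R 2 0.
  apply: (@le_lt_trans _ _ (\sum_(0 <= j <oo) (2 / (2 ^ (j + 1))%:R : R)%:E)%E); last first.
    by move/cvg_lim : half => ->//; rewrite ltry.
  apply: lee_nneseries => [j _ _|j _].
    by apply: integral_ge0 => x _; rewrite lee_fin.
  under eq_integral do rewrite EFinM.
  rewrite ge0_integralZl_EFin ?exprn_ge0//; last 2 first.
    by move=> x _; rewrite lee_fin sqnorm_ge0.
    exact/measurable_sqnormE/cmeasurableB.
  apply: (@le_trans _ _ ((4 ^+ j)%:E * ((16 ^- j : R))%:E)%E).
    by rewrite lee_pmul2l ?lte_fin ?exprn_gt0//; exact: g16.
  rewrite -EFinM lee_fin -exprVn -exprMn addn1 natrX exprS invfM mulrA divff// mul1r -exprVn.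
  by rewrite lerXn2r ?nnegrE//; lra.
have : {ae mu, forall x, S x \is a fin_num}.
  have IS : mu.-integrable setT S.
    apply/integrableP; split => //.
    by under eq_integral do rewrite gee0_abs//.
  by have := integrable_ae measurableT IS; apply: filterS => x /(_ I).
apply: filterS => x Sx.
have DS j : D j x <= fine (S x).
  rewrite -lee_fin fineK// /S (nneseries_split 0 j.+1); last by move=> k _; rewrite lee_fin.
  rewrite add0n big_nat_recr//= addeAC -[leLHS]add0e leeD2r//.
  rewrite adde_ge0//; first by apply: sume_ge0 => k _; rewrite lee_fin.
  by apply: nneseries_ge0 => k _ _; rewrite lee_fin.
apply: cvg_climit; apply: (@cvg_weighted_increments _ (fine (S x))) => j.
  apply: le_trans (DS j); rewrite /D ler_wpM2l ?exprn_ge0// sqnormE Re_add Re_opp.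
  by rewrite lerDl sqr_ge0.
apply: le_trans (DS j); rewrite /D ler_wpM2l ?exprn_ge0// sqnormE Im_add Im_opp.
by rewrite lerDr sqr_ge0.
Qed.

(** Riesz-Fischer: a subsequence with geometrically small increments converges
    almost everywhere, and by Fatou's lemma the whole sequence converges in mean
    square to its pointwise limit. *)
Lemma L2_complete (f : nat -> T -> R[i]) : (forall k, cmeasurable (f k)) ->
  (forall e : R, 0 < e -> exists N, forall k l, (N <= k)%N -> (N <= l)%N ->
     (msq mu (fun x => f k x - f l x)%R <= e%:E)%E) ->
  exists2 g, cmeasurable g & forall e : R, 0 < e ->
    exists N, forall k, (N <= k)%N -> (msq mu (fun x => f k x - g x)%R <= e%:E)%E.
Proof.
move=> mf fC.
have /choice[N NP] : forall j, exists N, forall k l, (N <= k)%N -> (N <= l)%N ->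
    (msq mu (fun x => f k x - f l x)%R <= (16 ^- j : R)%:E)%E.
  by move=> j; apply: fC; rewrite invr_gt0 exprn_gt0.
pose M j := (\sum_(i < j.+1) N i)%N.
have NM j : (N j <= M j)%N by rewrite /M big_ord_recr leq_addl.
have MS j : (M j <= M j.+1)%N by rewrite [leqRHS]/M big_ord_recr leq_addr.
(* M dominates N and is nondecreasing; adding j makes the indices unbounded. *)
pose g j := f (j + M j)%N.
have mg j : cmeasurable (g j) by exact: mf.
have gae : {ae mu, forall x,
    (fun j => complex.Re (g j x)) @ \oo --> complex.Re (climit g x) /\
    (fun j => complex.Im (g j x)) @ \oo --> complex.Im (climit g x)}.
  apply: ae_cvg_climit => // j; apply: NP.
    by rewrite (leq_trans (NM j))// (leq_trans (MS j))// leq_addl.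
  by rewrite (leq_trans (NM j))// leq_addl.
have ml := cmeasurable_climit mg.
exists (climit g) => // e e0; have [K KP] := fC e e0; exists K => k Kk.
pose h j x := (sqnorm (f k x - g (j + K)%N x))%:E.
have mh j : measurable_fun setT (h j) by exact/measurable_sqnormE/cmeasurableB.
have h0 j x : (0 <= h j x)%E by rewrite lee_fin sqnorm_ge0.
have -> : msq mu (fun x => f k x - climit g x) = (\int[mu]_x limn_einf (h ^~ x))%E.
  apply: ge0_ae_eq_integral => //.
  - exact/measurable_sqnormE/cmeasurableB.
  - exact: measurable_fun_limn_einf.
  - by move=> x _; rewrite lee_fin sqnorm_ge0.
  - by move=> x _; apply: limn_einf_ge0.
  move: gae; apply: filterS => x [gr gi] _; apply/esym.
  have hx : h ^~ x @ \oo --> (sqnorm (f k x - climit g x))%:E.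
    apply: cvg_EFin; first exact: nearW.
    rewrite (_ : _ \o _ = (fun j => sqnorm (f k x - g j x)) \o addn^~ K)//.
    by apply: cvg_comp (cvg_sqnorm gr gi); exact: cvg_addnr.
  by rewrite is_cvg_limn_einfE ?(cvg_lim _ hx)//; apply/cvg_ex; eexists; exact: hx.
apply: le_trans (fatou mu measurableT mh (fun j x _ => h0 j x)) _.
rewrite limn_einf_lim; apply: lime_le; first exact: is_cvg_einfs.
apply: nearW => j; apply: le_trans (_ : \int[mu]_x h j x <= _)%E.
  by apply: ereal_inf_lbound; exists j => /=.
by apply: KP => //; apply: (@leq_trans (j + K)); rewrite ?leq_addl ?leq_addr.
Qed.

End L2_complete.

(** * Bounded functions with support of finite measure *)

Section bounded_functions.
Context d (T : measurableType d) (R : realType).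
Variable mu : {measure set T -> \bar R}.
Implicit Types f g : T -> R[i].

Definition bmeas f : Prop :=
  cmeasurable f /\ exists M : R, forall x, sqnorm (f x) <= M.

Lemma bmeasM f g : bmeas f -> bmeas g -> bmeas (fun x => f x * g x).
Proof.
move=> [mf [M fM]] [mg [N gN]]; split; first exact: cmeasurableM.
exists (M * N) => x; rewrite sqnormM.
by apply: ler_pM; rewrite ?sqnorm_ge0.
Qed.

Lemma bmeasD f g : bmeas f -> bmeas g -> bmeas (fun x => f x + g x).
Proof.
move=> [mf [M fM]] [mg [N gN]]; split; first exact: cmeasurableD.
exists (2 * M + 2 * N) => x; have := sqnorm_lin 1 (f x) (g x).
rewrite mul1r sqnorm1 mulr1 => /le_trans; apply.
by apply: lerD; rewrite ler_pM2l.
Qed.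

Lemma bmeas_cst c : bmeas (fun=> c).
Proof. by split; [exact: cmeasurable_cst|exists (sqnorm c)]. Qed.

Lemma bmeas_conj f : bmeas f -> bmeas (fun x => (f x)^*%C).
Proof.
move=> [mf [M fM]]; split; first exact: cmeasurable_conj.
by exists M => x; rewrite sqnorm_conj.
Qed.

Lemma bounded_support_integrable (h : T -> R) M (A : set T) :
  measurable_fun setT h -> measurable A -> (mu A < +oo)%E ->
  (forall x, `|h x| <= M) -> (forall x, h x != 0 -> A x) ->
  mu.-integrable setT (EFin \o h).
Proof.
move=> mh mA Aoo hM hA.
have -> : EFin \o h = (EFin \o h) \_ A.
  apply/funext => x; rewrite patchE; case: ifPn => // xA.
  have [/= ->//|/hA Ax] := eqVneq (h x) 0.
  by move: xA; rewrite notin_setE => /(_ Ax).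
apply/(integrable_mkcond _ mA)/measurable_bounded_integrable => //.
  exact: measurable_funS mh.
exists M; split => [|N MN x _]; first exact: num_real.
by apply: le_trans (hM x) _; exact: ltW.
Qed.

Lemma normr_Re_sqnorm (z : R[i]) : `|complex.Re z| <= 1 + sqnorm z.
Proof.
rewrite sqnormE ler_norml; case: z => a b /=.
have := sqr_ge0 (a + 1); have := sqr_ge0 (a - 1); have := sqr_ge0 b.
by move=> *; apply/andP; split; nra.
Qed.

Lemma normr_Im_sqnorm (z : R[i]) : `|complex.Im z| <= 1 + sqnorm z.
Proof.
rewrite sqnormE ler_norml; case: z => a b /=.
have := sqr_ge0 (b + 1); have := sqr_ge0 (b - 1); have := sqr_ge0 a.
by move=> *; apply/andP; split; nra.
Qed.

Lemma Re_neq0 (z : R[i]) : complex.Re z != 0 -> z != 0.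
Proof. by apply: contraNneq => ->. Qed.

Lemma Im_neq0 (z : R[i]) : complex.Im z != 0 -> z != 0.
Proof. by apply: contraNneq => ->. Qed.

Lemma bmeas_cintegrable f (A : set T) : bmeas f -> measurable A ->
  (mu A < +oo)%E -> (forall x, f x != 0 -> A x) -> cintegrable mu f.
Proof.
move=> [[mr mi] [M fM]] mA Aoo fA.
split; apply: (@bounded_support_integrable _ (1 + M) A) => //.
- by move=> x; apply: le_trans (normr_Re_sqnorm _) _; rewrite lerD2l.
- by move=> x /Re_neq0; exact: fA.
- by move=> x; apply: le_trans (normr_Im_sqnorm _) _; rewrite lerD2l.
- by move=> x /Im_neq0; exact: fA.
Qed.

Lemma bmeas_msq_lty f (A : set T) : bmeas f -> measurable A ->
  (mu A < +oo)%E -> (forall x, f x != 0 -> A x) -> (msq mu f < +oo)%E.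
Proof.
move=> [mf [M fM]] mA Aoo fA.
have /integrableP[_] : mu.-integrable setT (EFin \o (fun x => sqnorm (f x))).
  apply: (@bounded_support_integrable _ M A) => //.
  - exact: measurable_sqnorm.
  - by move=> x; rewrite ger0_norm ?sqnorm_ge0.
  - by move=> x s0; apply: fA; apply: contraNneq s0 => ->; rewrite sqnorm0.
rewrite (_ : (\int[mu]_x _)%E = msq mu f)//.
by apply: eq_integral => x _; rewrite /= ger0_norm ?sqnorm_ge0.
Qed.

End bounded_functions.

Section test_functions.
Context d (X : measurableType d) (R : realType).
Variable alpha : {sigma_finite_measure set X -> \bar R}.
Implicit Types phi theta : X -> R[i].

Lemma measurable_support phi : cmeasurable phi -> measurable [set x | phi x != 0].
Proof.
move=> [mr mi].
rewrite (_ : [set x | _] = ((fun x => complex.Re (phi x)) @^-1` [set~ 0]) `|`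
    ((fun x => complex.Im (phi x)) @^-1` [set~ 0])).
  apply: measurableU; rewrite -[X in measurable X]setTI.
    by apply: mr => //; apply: measurableC; exact: measurable_set1.
  by apply: mi => //; apply: measurableC; exact: measurable_set1.
apply/seteqP; split => x /=.
  move=> phi0; have [r0|r0] := eqVneq (complex.Re (phi x)) 0; last by left; exact/eqP.
  right => i0; move/eqP: phi0; apply; exact: eq_complexP.
by move=> [/eqP/Re_neq0|/eqP/Im_neq0].
Qed.

Lemma test_fun_bmeas phi : test_fun alpha phi -> bmeas phi.
Proof.
move=> [mphi [M phiM] _]; split => //; exists (M ^+ 2) => x.
by rewrite /sqnorm lerXn2r ?nnegrE//; [case: (phi x) => a b; exact: sqrtr_ge0|
  apply: le_trans (phiM x); case: (phi x) => a b; exact: sqrtr_ge0].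
Qed.

Lemma bmeas_test_fun phi (A : set X) : bmeas phi -> measurable A ->
  (alpha A < +oo)%E -> (forall x, phi x != 0 -> A x) -> test_fun alpha phi.
Proof.
move=> [mphi [M phiM]] mA Aoo phiA; split => //.
  exists (1 + M) => x; apply: le_trans (_ : 1 + sqnorm (phi x) <= _).
    rewrite /sqnorm; set c := ComplexField.Normc.normc _.
    by have := sqr_ge0 (c - 1); have := sqr_ge0 (c + 1); nra.
  by rewrite lerD2l.
apply: le_lt_trans Aoo; apply: le_measure => //; rewrite inE//.
exact: measurable_support.
Qed.

Lemma test_fun_support phi : test_fun alpha phi ->
  exists A, [/\ measurable A, (alpha A < +oo)%E & forall x, phi x != 0 -> A x].
Proof.
move=> [mphi _ phioo]; exists [set x | phi x != 0]; split => //.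
exact: measurable_support.
Qed.

Lemma test_fun_cintegrable phi : test_fun alpha phi -> cintegrable alpha phi.
Proof.
move=> tphi; have [A [mA Aoo phiA]] := test_fun_support tphi.
exact: (bmeas_cintegrable (test_fun_bmeas tphi) mA Aoo phiA).
Qed.

Lemma test_fun_mul phi theta : bmeas phi -> test_fun alpha theta ->
  test_fun alpha (phi \* theta).
Proof.
move=> bphi tt; have [A [mA Aoo tA]] := test_fun_support tt.
apply: bmeas_test_fun mA Aoo _; first exact: (bmeasM bphi (test_fun_bmeas tt)).
by move=> x /=; rewrite mulf_eq0 negb_or => /andP[_ /tA].
Qed.

Lemma test_fun_conj phi : test_fun alpha phi -> test_fun alpha (cconj phi).
Proof.
move=> tphi; have [A [mA Aoo phiA]] := test_fun_support tphi.
apply: bmeas_test_fun mA Aoo _; first exact: (bmeas_conj (test_fun_bmeas tphi)).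
by move=> x c0; apply: phiA; apply: contraNneq c0; rewrite /cconj => ->; rewrite conj0.
Qed.

Lemma test_fun_lin a phi theta : test_fun alpha phi -> test_fun alpha theta ->
  test_fun alpha (a *: phi + theta).
Proof.
move=> tp tt; have [A [mA Aoo pA]] := test_fun_support tp.
have [B [mB Boo tB]] := test_fun_support tt.
apply: (@bmeas_test_fun _ (A `|` B)).
- apply: bmeasD (test_fun_bmeas tt).
  exact: (bmeasM (bmeas_cst _ a) (test_fun_bmeas tp)).
- exact: measurableU.
- by rewrite (le_lt_trans (measureU2 alpha mA mB))// lte_add_pinfty.
- move=> x; rewrite -[_ x]/(a * phi x + theta x) => s0.
  have [p0|/pA] := eqVneq (phi x) 0; last by left.
  by right; apply: tB; move: s0; rewrite p0 mulr0 add0r.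
Qed.

Lemma test_fun0 : test_fun alpha (fun=> 0).
Proof.
apply: (@bmeas_test_fun _ set0) => //; first exact: bmeas_cst.
  by rewrite measure0.
by move=> x; rewrite eqxx.
Qed.

End test_functions.

Section tame_functions.
Context d (X : measurableType d) (R : realType).
Variable alpha : {sigma_finite_measure set X -> \bar R}.

Definition boxed n (g : n.-tuple X -> R[i]) : Prop := exists A : set X,
  [/\ measurable A, (alpha A < +oo)%E & forall x, g x != 0 -> box (fun=> A) x].

(** The functions for which all the integrals below are finite: lambda_n is finite
    on cubes whose sides have finite measure. *)
Definition tame n (g : n.-tuple X -> R[i]) : Prop := bmeas g /\ boxed g.

Lemma boxedD n (f g : n.-tuple X -> R[i]) :
  boxed f -> boxed g -> boxed (fun x => f x + g x).
Proof.
move=> [A [mA Aoo fA]] [B [mB Boo gB]]; exists (A `|` B); split.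
- exact: measurableU.
- by rewrite (le_lt_trans (measureU2 alpha mA mB))// lte_add_pinfty.
- move=> x s0 i; have [f0|/fA fx] := eqVneq (f x) 0; last by left; exact: fx.
  by right; apply: gB; move: s0; rewrite f0 add0r.
Qed.

Lemma boxedM n (f g : n.-tuple X -> R[i]) : boxed g -> boxed (fun x => f x * g x).
Proof.
move=> [A [mA Aoo gA]]; exists A; split => // x.
by rewrite mulf_eq0 negb_or => /andP[_ /gA].
Qed.

Lemma tame0 n : tame (fun _ : n.-tuple X => 0).
Proof.
split; first exact: bmeas_cst.
by exists set0; split; rewrite ?measure0// => x; rewrite eqxx.
Qed.

Lemma tameD n (f g : n.-tuple X -> R[i]) :
  tame f -> tame g -> tame (fun x => f x + g x).
Proof. by move=> [? ?] [? ?]; split; [exact: bmeasD|exact: boxedD]. Qed.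

Lemma tameM n (f g : n.-tuple X -> R[i]) :
  bmeas f -> tame g -> tame (fun x => f x * g x).
Proof. by move=> ? [? ?]; split; [exact: bmeasM|exact: boxedM]. Qed.

Lemma tameZ n c (g : n.-tuple X -> R[i]) : tame g -> tame (fun x => c * g x).
Proof. by apply: tameM; exact: bmeas_cst. Qed.

Lemma tame_conj n (g : n.-tuple X -> R[i]) : tame g -> tame (fun x => (g x)^*%C).
Proof.
move=> [bg [A [mA Aoo gA]]]; split; first exact: bmeas_conj.
exists A; split => // x; have [->|/gA//] := eqVneq (g x) 0.
by rewrite conj0 eqxx.
Qed.

Lemma tame_sum n (I : Type) (r : seq I) (F : I -> n.-tuple X -> R[i]) :
  (forall i, tame (F i)) -> tame (fun x => \sum_(i <- r) F i x).
Proof.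
move=> bF; elim: r => [|i r IH].
  by under eq_fun do rewrite big_nil; exact: tame0.
by under eq_fun do rewrite big_cons; exact: tameD.
Qed.

Lemma tame_cintegrable n (g : n.-tuple X -> R[i]) :
  tame g -> cintegrable (lambda alpha n) g.
Proof.
move=> [bg [A [mA Aoo gA]]]; apply: (bmeas_cintegrable bg (A := box (fun=> A))) => //.
  exact: measurable_box.
exact: lambda_box_lty.
Qed.

Lemma tame_msq n (g : n.-tuple X -> R[i]) :
  tame g -> (msq (lambda alpha n) g < +oo)%E.
Proof.
move=> [bg [A [mA Aoo gA]]]; apply: (bmeas_msq_lty bg (A := box (fun=> A))) => //.
  exact: measurable_box.
exact: lambda_box_lty.
Qed.

Lemma bmeas_comp_tuple d' (T : measurableType d') n (g : n.-tuple X -> R[i])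
    (h : T -> n.-tuple X) :
  measurable_fun setT h -> bmeas g -> bmeas (g \o h).
Proof.
move=> mh [mg [M gM]]; split; first exact: cmeasurable_comp.
by exists M => x; exact: gM.
Qed.

Lemma tame_section n (g : n.+1.-tuple X -> R[i]) (x : n.-tuple X) :
  tame g -> test_fun alpha (fun y => g [tuple of y :: x]).
Proof.
move=> [bg [A [mA Aoo gA]]]; apply: (@bmeas_test_fun _ _ _ _ _ A) => //.
  by apply: (bmeas_comp_tuple _ bg); exact: measurable_cons.
by move=> y /gA/(_ ord0).
Qed.

(** ** Integration against lambda_{n+1} *)

Section real_recursion.
Variables (n : nat) (A : set X) (M : R).
Hypotheses (mA : measurable A) (Aoo : (alpha A < +oo)%E).

Let controlled (h : n.+1.-tuple X -> R) : Prop :=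
  [/\ measurable_fun setT h, forall x, `|h x| <= M &
      forall x, h x != 0 -> box (fun=> A) x].

Let inner (h : n.+1.-tuple X -> R) (x : n.-tuple X) : R :=
  \int[alpha]_y h [tuple of y :: x].

Let controlled_integrable h : controlled h ->
  (lambda alpha n.+1).-integrable setT (EFin \o h).
Proof.
move=> [mh hM hA]; apply: (bounded_support_integrable mh _ _ hM hA).
  exact: measurable_box.
exact: lambda_box_lty.
Qed.

Let section_integrable h (x : n.-tuple X) : controlled h ->
  alpha.-integrable setT (EFin \o (fun y => h [tuple of y :: x])).
Proof.
move=> [mh hM hA]; apply: (@bounded_support_integrable _ _ _ _ _ M A) => //.
  by apply: measurableT_comp mh _; exact: measurable_cons.
by move=> y /hA/(_ ord0).
Qed.

Let dup_integrable h i : controlled h ->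
  (lambda alpha n).-integrable setT (EFin \o (h \o @dup _ X n i)).
Proof.
move=> [mh hM hA].
apply: (@bounded_support_integrable _ _ _ _ _ M (box (fun=> A))) => //.
- by apply: measurableT_comp mh _; exact: measurable_dup.
- exact: measurable_box.
- exact: lambda_box_lty.
- by move=> x; exact: hM.
- by move=> x /hA bx j; have := bx (lift ord0 j); rewrite tnthS.
Qed.

(* The inner integral is integrable because the left-hand side is finite and all
   the terms on the right are nonnegative. *)
Let ge0_recursion h : controlled h -> (forall x, 0 <= h x) ->
  (lambda alpha n).-integrable setT (EFin \o inner h) /\
  (\int[lambda alpha n.+1]_x h x = \int[lambda alpha n]_x inner h x +
    \sum_(i < n) \int[lambda alpha n]_x h (dup i x)).
Proof.
move=> ch h0; have [mh hM hA] := ch.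
have innerE x : ((inner h x)%:E = \int[alpha]_y (h [tuple of y :: x])%:E)%E.
  by rewrite fineK//; apply: integrable_fin_num => //; exact: section_integrable.
have I1 : (\int[lambda alpha n.+1]_x (h x)%:E \is a fin_num)%E.
  by apply: integrable_fin_num => //; exact: controlled_integrable.
have rec := @ge0_integral_lambda_succ _ X R alpha n (EFin \o h).
have {rec} : (\int[lambda alpha n.+1]_x (h x)%:E =
    \int[lambda alpha n]_x (inner h x)%:E +
    \sum_(i < n) \int[lambda alpha n]_x (h (dup i x))%:E)%E.
  rewrite [LHS]rec; [|exact/measurable_EFinP|by move=> x; rewrite lee_fin].
  by congr (_ + _)%E; apply: eq_integral => x _; rewrite innerE.
have minner : measurable_fun setT (inner h).
  apply: measurableT_comp => //.
  apply: (@measurable_fun_fubini_tonelli_G _ _ _ _ _ alpha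
    (fun p => (h (cons_pair p))%:E)).
    by apply/measurable_EFinP; apply: measurableT_comp mh _; exact: measurable_cons_pair.
  by move=> p; rewrite lee_fin.
have inner0 x : 0 <= inner h x by apply: Rintegral_ge0 => y _; exact: h0.
have Ii i : (\int[lambda alpha n]_x (h (dup i x))%:E \is a fin_num)%E.
  by apply: integrable_fin_num => //; exact: dup_integrable.
have sumfin : (\sum_(i < n) \int[lambda alpha n]_x (h (dup i x))%:E \is a fin_num)%E.
  by apply/sum_fin_numP => i _ _; exact: Ii.
move=> rec.
have Iinner : (\int[lambda alpha n]_x (inner h x)%:E \is a fin_num)%E.
  by move: I1; rewrite rec fin_numD => /andP[].
split.
  apply/integrableP; split; first exact/measurable_EFinP.
  under eq_integral do rewrite gee0_abs ?lee_fin//.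
  by rewrite -ge0_fin_numE// integral_ge0// => x _; rewrite lee_fin.
rewrite /Rintegral rec fineD//; congr (_ + _).
by rewrite -sum_fine.
Qed.

Lemma Rintegral_lambda_succ h : controlled h ->
  (lambda alpha n).-integrable setT (EFin \o inner h) /\
  (\int[lambda alpha n.+1]_x h x = \int[lambda alpha n]_x inner h x +
    \sum_(i < n) \int[lambda alpha n]_x h (dup i x)).
Proof.
move=> [mh hM hA].
have cp : controlled h^\+.
  split; first exact: measurable_funrpos.
    move=> x; apply: le_trans (hM x); rewrite /funrpos.
    by case: (leP (h x) 0) => _; rewrite ?normr0.
  by move=> x; rewrite /funrpos; case: (leP (h x) 0) => [_|_ /hA//]; rewrite eqxx.
have cn : controlled h^\-.
  split; first exact: measurable_funrneg.
    move=> x; apply: le_trans (hM x); rewrite /funrneg.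
    by case: (leP (- h x) 0) => _; rewrite ?normr0 ?normrN.
  by move=> x; rewrite /funrneg; case: (leP (- h x) 0) => [_|_]; rewrite ?eqxx// oppr_eq0 => /hA.
have [Ip rp] := ge0_recursion cp (fun x => funrpos_ge0 _ x).
have [In rn] := ge0_recursion cn (fun x => funrneg_ge0 _ x).
have hE x : h x = h^\+ x - h^\- x by rewrite -[LHS](congr1 (@^~ x) (funrposBneg h)).
have innerE x : inner h x = inner h^\+ x - inner h^\- x.
  rewrite /inner -RintegralB//; [|exact: section_integrable..].
  by apply: eq_Rintegral => y _; rewrite [LHS]hE.
split.
  pose p := inner h^\+; pose q := inner h^\-.
  rewrite (_ : _ \o _ = ((EFin \o p) \- (EFin \o q))%E).
    exact: integrableB.
  by apply/funext => x /=; rewrite innerE EFinB.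
transitivity (\int[lambda alpha n.+1]_x h^\+ x - \int[lambda alpha n.+1]_x h^\- x).
  rewrite -RintegralB//; [|exact: controlled_integrable..].
  by apply: eq_Rintegral => x _; rewrite [LHS]hE.
rewrite rp rn opprD addrACA -sumrB -RintegralB//; congr (_ + _).
  by apply: eq_Rintegral => x _; rewrite innerE.
apply: eq_bigr => i _; rewrite -RintegralB//; [|exact: dup_integrable..].
by apply: eq_Rintegral => x _; rewrite [RHS]hE.
Qed.

End real_recursion.

(** The inner integral runs over the new point, as it does in k^-. *)
Lemma cintegral_lambda_succ n (h : n.+1.-tuple X -> R[i]) : tame h ->
  cintegrable (lambda alpha n)
    (fun x => cintegral alpha (fun y => h [tuple of y :: x])) /\
  cintegral (lambda alpha n.+1) h =
    cintegral (lambda alpha n)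
      (fun x => cintegral alpha (fun y => h [tuple of y :: x])) +
    \sum_(i < n) cintegral (lambda alpha n) (h \o @dup _ X n i).
Proof.
move=> [[[mr mi] [M hM]] [A [mA Aoo hA]]].
have [Ir rr] := @Rintegral_lambda_succ n A (1 + M) mA Aoo (fun x => complex.Re (h x))
  (And3 mr (fun x => le_trans (normr_Re_sqnorm _) (lerD (lexx 1) (hM x)))
    (fun x h0 => hA x (Re_neq0 h0))).
have [Ii ri] := @Rintegral_lambda_succ n A (1 + M) mA Aoo (fun x => complex.Im (h x))
  (And3 mi (fun x => le_trans (normr_Im_sqnorm _) (lerD (lexx 1) (hM x)))
    (fun x h0 => hA x (Im_neq0 h0))).
split; first by split; [exact: Ir|exact: Ii].
have Re_sum (F : 'I_n -> R[i]) : complex.Re (\sum_i F i) = \sum_i complex.Re (F i).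
  by apply: (big_morph (@complex.Re R)) => // a b; rewrite Re_add.
have Im_sum (F : 'I_n -> R[i]) : complex.Im (\sum_i F i) = \sum_i complex.Im (F i).
  by apply: (big_morph (@complex.Im R)) => // a b; rewrite Im_add.
by apply: eq_complexP; [rewrite Re_add Re_sum|rewrite Im_add Im_sum].
Qed.

End tame_functions.

(** * Creation monomials *)

Section linear_span.
Context (K : pzRingType) (V : lmodType K).
Implicit Types (S P : set V).

Lemma lin_span_gen S v : S v -> lin_span S v.
Proof.
move=> Sv; exists 1%N, (fun=> 1), (fun=> v); split => //.
by rewrite big_ord1 scale1r.
Qed.

Lemma lin_span0 S : lin_span S 0.
Proof. by exists 0%N, (fun=> 0), (fun=> 0); split; [case|rewrite big_ord0]. Qed.

Lemma lin_span_lin S a u v :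
  lin_span S u -> lin_span S v -> lin_span S (a *: u + v).
Proof.
move=> [m [c [w [Sw ->]]]] [m' [c' [w' [Sw' ->]]]].
exists (m + m')%N, (fun i => match fintype.split i with inl j => a * c j | inr j => c' j end),
  (fun i => match fintype.split i with inl j => w j | inr j => w' j end); split.
  by move=> i; case: fintype.split => j.
rewrite big_split_ord/= scaler_sumr; congr (_ + _); apply: eq_bigr => i _.
  by rewrite (unsplitK (inl i)) scalerA.
by rewrite (unsplitK (inr i)).
Qed.

Lemma lin_span_ind S P : P 0 -> (forall a u v, P u -> P v -> P (a *: u + v)) ->
  S `<=` P -> lin_span S `<=` P.
Proof.
move=> P0 PD SP _ [m [c [w [Sw ->]]]].
by apply: (big_ind P) => // [u v Pu Pv|i _];
  [rewrite -(scale1r u); exact: PD|rewrite -[_ *: _]addr0; apply: PD => //; exact/SP/Sw].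
Qed.

Lemma lin_span_sum S (I : Type) (r : seq I) (F : I -> V) :
  (forall i, lin_span S (F i)) -> lin_span S (\sum_(i <- r) F i).
Proof.
move=> SF; elim: r => [|i r IH]; first by rewrite big_nil; exact: lin_span0.
by rewrite big_cons -(scale1r (F i)); exact: lin_span_lin.
Qed.

End linear_span.

Section monomials.
Context d (X : measurableType d) (R : realType).
Variable alpha : {sigma_finite_measure set X -> \bar R}.
Local Notation pre_fock := (pre_fock X R).
Implicit Types (f g : pre_fock) (phi theta : X -> R[i]) (fs : seq (X -> R[i])).

Lemma pre_fock_addE f g n x : (f + g) n x = f n x + g n x. Proof. by []. Qed.

Lemma pre_fock_scaleE a f n x : (a *: f) n x = a * f n x. Proof. by []. Qed.

Definition drop_at n (i : 'I_n.+1) (x : n.+1.-tuple X) : n.-tuple X :=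
  [tuple tnth x (lift i j) | j < n].

Lemma k_plusS phi f n x : k_plus phi f n.+1 x =
  \sum_(i < n.+1) phi (tnth x i) * f n (drop_at i x).
Proof. by []. Qed.

Lemma k_plus_linear phi a f g :
  k_plus phi (a *: f + g) = a *: k_plus phi f + k_plus phi g.
Proof.
apply: pre_fockP => -[|n] x; rewrite pre_fock_addE pre_fock_scaleE.
  by rewrite mulr0 addr0.
rewrite !k_plusS mulr_sumr -big_split/=; apply: eq_bigr => i _.
by rewrite pre_fock_addE pre_fock_scaleE mulrDr mulrCA.
Qed.

Lemma k_plus_test_linear a phi theta f :
  k_plus (a *: phi + theta) f = a *: k_plus phi f + k_plus theta f.
Proof.
apply: pre_fockP => -[|n] x; rewrite pre_fock_addE pre_fock_scaleE.
  by rewrite mulr0 addr0.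
rewrite !k_plusS mulr_sumr -big_split/=; apply: eq_bigr => i _.
by rewrite -[(a *: phi + theta) _]/(a * phi _ + theta _) mulrDl mulrA.
Qed.

Lemma k_plus0 phi : k_plus phi 0 = 0 :> pre_fock.
Proof.
apply: pre_fockP => -[|n] x //; rewrite k_plusS big1// => i _.
by rewrite -[X in _ * X]/(0 : R[i]) mulr0.
Qed.

Lemma k_zero_linear phi a f g :
  k_zero alpha phi (a *: f + g) = a *: k_zero alpha phi f + k_zero alpha phi g.
Proof.
apply: pre_fockP => n x.
by rewrite pre_fock_addE pre_fock_scaleE /k_zero pre_fock_addE pre_fock_scaleE mulrDr mulrCA.
Qed.

(** In the i-th summand of k^+(theta) the sum of all the phi(x_j) is phi(x_i) plus
    the sum over the points that the argument of f retains. *)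
Lemma k_zero_plus phi theta f :
  k_zero alpha phi (k_plus theta f) =
  k_plus (phi \* theta) f + k_plus theta (k_zero alpha phi f).
Proof.
apply: pre_fockP => -[|n] x; rewrite pre_fock_addE.
  by rewrite /k_zero/= mulr0 addr0.
rewrite /k_zero !k_plusS mulr_sumr -big_split/=; apply: eq_bigr => i _.
rewrite (bigD1_ord i)//=; set c := 2^-1 * _.
rewrite (eq_bigr (fun j => phi (tnth (drop_at i x) j))); last first.
  by move=> j _; rewrite tnth_mktuple.
by ring.
Qed.

Definition monomial fs : pre_fock := foldr k_plus (@vacuum_seq _ X R) fs.

Arguments monomial : clear implicits.

Lemma monomial_degree fs n : n != size fs -> monomial fs n = fun=> 0.
Proof.
elim: fs n => [|phi fs IH] [|n]//= nfs; apply/funext => x.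
  by rewrite big1// => i _; rewrite IH// mulr0.
Qed.

(** A permutation of n+1 points is the image of 0 together with a permutation of
    the n remaining points. *)
Lemma sum_lift_perm (V : nmodType) n (F : 'S_n.+1 -> V) :
  \sum_(s : 'S_n.+1) F s =
  \sum_(i < n.+1) \sum_(s : 'S_n) F (lift_perm ord0 i s).
Proof.
rewrite pair_bigA/= (reindex (fun p : 'I_n.+1 * 'S_n => lift_perm ord0 p.1 p.2))//=.
apply: onW_bij; apply: inj_card_bij; last first.
  by rewrite card_prod !card_Sn card_ord factS.
move=> [i s] [j t]/= st.
have ij : i = j.
  by have := congr1 (fun u : 'S_n.+1 => u ord0) st; rewrite !lift_perm_id.
congr (_, _) => //; apply/permP => k; move: st; rewrite ij => st.
have := congr1 (fun u : 'S_n.+1 => u (lift ord0 k)) st.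
by rewrite !lift_perm_lift => /lift_inj.
Qed.

(** The successive creation operators choose the arguments for their test
    functions one after the other, which amounts to a permutation. *)
Lemma monomialE n (fs : n.-tuple (X -> R[i])) x :
  monomial fs n x = \sum_(s : 'S_n) \prod_(i < n) tnth fs i (tnth x (s i)).
Proof.
elim: n fs x => [|n IH] fs x.
  rewrite (_ : monomial fs 0%N x = 1); last by rewrite (tuple0 fs).
  rewrite (eq_bigr (fun=> 1)); last by move=> s _; rewrite big_ord0.
  by rewrite sumr_const -[#|_|]/#|{perm 'I_0}| card_Sn.
rewrite (tuple_eta fs) sum_lift_perm/=; apply: eq_bigr => i _.
rewrite (IH [tuple of behead fs]) mulr_sumr; apply: eq_bigr => s _.
rewrite big_ord_recl lift_perm_id tnth0; congr (_ * _).
by apply: eq_bigr => j _; rewrite lift_perm_lift tnthS tnth_mktuple.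
Qed.

(** Symmetry at every point, not only almost everywhere, because the operators
    are computed pointwise. *)
Definition exchangeable f : Prop := forall n (s : 'S_n) x, f n (permute s x) = f n x.

Lemma exchangeable_perm_eq f n (x y : n.-tuple X) :
  exchangeable f -> perm_eq x y -> f n x = f n y.
Proof. by move=> sf /tuple_permP[s xy]; rewrite -(sf n s y); congr (f n); exact: val_inj. Qed.

Lemma exchangeable_lin a f g : exchangeable f -> exchangeable g -> exchangeable (a *: f + g).
Proof.
by move=> sf sg n s x; rewrite !pre_fock_addE !pre_fock_scaleE sf sg.
Qed.

Lemma exchangeable0 : exchangeable 0. Proof. by []. Qed.

Lemma exchangeable_monomial fs : exchangeable (monomial fs).
Proof.
move=> n t x; have [nfs|/monomial_degree->//] := eqVneq n (size fs).
move: t x; rewrite {n}nfs -[fs]/(tval (in_tuple fs)) => t x.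
rewrite !monomialE/= [RHS](reindex_inj (mulIg t)); apply: eq_bigr => s _ /=.
by apply: eq_bigr => i _; rewrite tnth_mktuple permM.
Qed.

Lemma monomial_perm fs gs : perm_eq fs gs -> monomial fs = monomial gs.
Proof.
move=> fg; have sfg := perm_size fg; apply: pre_fockP => n x.
have [nfs|nfs] := eqVneq n (size gs); last by rewrite !monomial_degree// sfg.
move: x; rewrite {n}nfs -[gs]/(tval (in_tuple gs)) => x.
have /tuple_permP[t ->] : perm_eq fs (in_tuple gs) by [].
rewrite !monomialE [RHS](reindex_inj (mulgI t^-1%g)); apply: eq_bigr => s _ /=.
rewrite [RHS](reindex_inj (@perm_inj _ t)); apply: eq_bigr => i _ /=.
by rewrite tnth_mktuple permM permK.
Qed.

Lemma at_degree_sym_tensor n (fs : n.-tuple (X -> R[i])) :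
  at_degree (sym_tensor fs) = (n`!%:R)^-1 *: monomial fs.
Proof.
apply: pre_fockP => m x; rewrite pre_fock_scaleE /at_degree.
have [nm|nm] := eqVneq n m.
  by move: x; rewrite -nm => x; rewrite valK/= /sym_tensor monomialE.
by rewrite insubN ?size_tuple 1?eq_sym//= monomial_degree ?mulr0// size_tuple eq_sym.
Qed.

(** * The common domain *)

Local Notation fock_dom := (fock_dom alpha).

Definition test_monomials : set pre_fock :=
  [set f | exists2 fs : seq (X -> R[i]),
    (forall phi, phi \in fs -> test_fun alpha phi) & f = monomial fs].

(** Creation monomials instead of symmetrized tensor products allow induction on
    the number of creation operators. *)
Lemma fock_domE : fock_dom = lin_span test_monomials.
Proof.
apply/seteqP; split; apply: lin_span_ind.
- exact: lin_span0.
- by move=> a u v; exact: lin_span_lin.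
- move=> _ [->|[n [fs [n0 tfs ->]]]]; first by apply: lin_span_gen; exists [::].
  rewrite at_degree_sym_tensor -[_ *: _]addr0; apply: lin_span_lin; last exact: lin_span0.
  by apply: lin_span_gen; exists fs => // phi /tnthP[i ->].
- exact: lin_span0.
- by move=> a u v; exact: lin_span_lin.
- move=> _ [fs tfs ->]; have [fs0|fs0] := posnP (size fs).
    by apply: lin_span_gen; left; rewrite (size0nil fs0).
  have -> : monomial fs = (size fs)`!%:R *: at_degree (sym_tensor (in_tuple fs)).
    by rewrite at_degree_sym_tensor scalerA divff ?scale1r// pnatr_eq0 -lt0n fact_gt0.
  rewrite -[_ *: _]addr0; apply: lin_span_lin; last exact: lin_span0.
  apply: lin_span_gen; right; exists (size fs), (in_tuple fs); split => // i.
  exact/tfs/mem_tnth.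
Qed.

Lemma fock_dom_ind (P : pre_fock -> Prop) :
  P 0 -> (forall a u v, P u -> P v -> P (a *: u + v)) ->
  (forall fs, (forall phi, phi \in fs -> test_fun alpha phi) -> P (monomial fs)) ->
  forall f, fock_dom f -> P f.
Proof.
move=> P0 PD Pm f; rewrite fock_domE; apply: lin_span_ind => //.
by move=> _ [fs tfs ->]; exact: Pm.
Qed.

Lemma fock_dom0 : fock_dom 0. Proof. exact: lin_span0. Qed.

Lemma fock_dom_lin a f g : fock_dom f -> fock_dom g -> fock_dom (a *: f + g).
Proof. exact: lin_span_lin. Qed.

Lemma fock_domD f g : fock_dom f -> fock_dom g -> fock_dom (f + g).
Proof. by move=> Df Dg; rewrite -(scale1r f); exact: fock_dom_lin. Qed.

Lemma fock_domZ a f : fock_dom f -> fock_dom (a *: f).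
Proof. by move=> Df; rewrite -[_ *: _]addr0; exact: fock_dom_lin fock_dom0. Qed.

Lemma fock_dom_monomial fs :
  (forall phi, phi \in fs -> test_fun alpha phi) -> fock_dom (monomial fs).
Proof. by move=> tfs; rewrite fock_domE; apply: lin_span_gen; exists fs. Qed.

Lemma fock_dom_exchangeable f : fock_dom f -> exchangeable f.
Proof.
apply: fock_dom_ind; [exact: exchangeable0|exact: exchangeable_lin|].
by move=> fs _; exact: exchangeable_monomial.
Qed.

Lemma fock_dom_degree f : fock_dom f ->
  exists N, forall n, (N <= n)%N -> f n = fun=> 0.
Proof.
move: f; apply: (@fock_dom_ind (fun f => exists N, forall n, (N <= n)%N ->
  f n = fun=> 0)) => [|a u v [N uN] [M vM]|fs _]; first by exists 0%N.
  exists (maxn N M) => n; rewrite geq_max => /andP[Nn Mn]; apply/funext => x.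
  by rewrite pre_fock_addE pre_fock_scaleE uN// vM// mulr0 addr0.
by exists (size fs).+1 => n sn; rewrite monomial_degree// gtn_eqF.
Qed.

Lemma measurable_drop_at n (i : 'I_n.+1) : measurable_fun setT (@drop_at n i).
Proof.
apply/measurable_fun_tnthP => j.
rewrite (_ : _ \o _ = (@tnth n.+1 X)^~ (lift i j)); first exact: measurable_tnth.
by apply/funext => t; rewrite /= tnth_mktuple.
Qed.

Lemma bmeas_tnth phi n (i : 'I_n) : bmeas phi ->
  bmeas (fun x : n.-tuple X => phi (tnth x i)).
Proof.
move=> [mphi [M phiM]]; split; last by exists M.
by apply: (cmeasurable_comp _ mphi); exact: measurable_tnth.
Qed.

Lemma tame_k_plus phi f : test_fun alpha phi -> (forall n, tame alpha (f n)) ->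
  forall n, tame alpha (k_plus phi f n).
Proof.
move=> tphi tf [|n]; first exact: tame0.
apply: tame_sum => i; have [bf [A [mA Aoo fA]]] := tf n.
have [B [mB Boo phiB]] := test_fun_support tphi.
split.
  apply: bmeasM; first exact: bmeas_tnth (test_fun_bmeas tphi).
  exact: bmeas_comp_tuple (measurable_drop_at i) bf.
exists (A `|` B); split; first exact: measurableU.
  by rewrite (le_lt_trans (measureU2 alpha mA mB))// lte_add_pinfty.
move=> x; rewrite mulf_eq0 negb_or => /andP[/phiB Bx /fA Ax] j.
case: (unliftP i j) => [k ->|->]; last by right.
by left; have := Ax k; rewrite tnth_mktuple.
Qed.

Lemma fock_dom_tame f : fock_dom f -> forall n, tame alpha (f n).
Proof.
move: f; apply: (@fock_dom_ind (fun f => forall n, tame alpha (f n)))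
  => [n|a u v tu tv n|]; first exact: tame0.
  by apply: tameD => //; exact: tameZ.
elim=> [_|phi fs IH tfs]; last first.
  apply: tame_k_plus; first by apply: tfs; rewrite mem_head.
  by apply: IH => theta fs_theta; apply: tfs; rewrite in_cons fs_theta orbT.
move=> n; split; first exact: bmeas_cst.
case: n => [|n]; last by exists set0; split; rewrite ?measure0// => x /eqP.
by exists set0; split; rewrite ?measure0// => x _ [].
Qed.

Lemma fock_dom_section f n (x : n.-tuple X) : fock_dom f ->
  test_fun alpha (fun y => f n.+1 [tuple of y :: x]).
Proof. by move=> Df; apply: tame_section; exact: fock_dom_tame. Qed.

(** ** Stability under the operators *)

Lemma fock_dom_k_plus phi f : test_fun alpha phi -> fock_dom f ->
  fock_dom (k_plus phi f).
Proof.
move=> tphi; move: f; apply: fock_dom_ind => [|a u v Du Dv|fs tfs].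
- by rewrite k_plus0; exact: fock_dom0.
- by rewrite k_plus_linear; exact: fock_dom_lin.
- apply: (@fock_dom_monomial (phi :: fs)) => theta.
  by rewrite in_cons => /orP[/eqP->//|/tfs].
Qed.

Lemma k_zero0 phi : k_zero alpha phi 0 = 0.
Proof. by apply: pre_fockP => n x; rewrite /k_zero mulr0. Qed.

(** Moving k^0 through the creation operators leaves creation monomials behind;
    on the vacuum it is multiplication by a number. *)
Lemma fock_dom_k_zero phi f : test_fun alpha phi -> fock_dom f ->
  fock_dom (k_zero alpha phi f).
Proof.
move=> tphi; move: f; apply: fock_dom_ind => [|a u v Du Dv|].
- by rewrite k_zero0; exact: fock_dom0.
- by rewrite k_zero_linear; exact: fock_dom_lin.
elim=> [_|theta fs IH tfs].
  rewrite (_ : k_zero _ _ _ = (2^-1 * cintegral alpha phi) *: monomial [::]).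
    by apply: fock_domZ; exact: fock_dom_monomial.
  apply: pre_fockP => -[|n] x; rewrite pre_fock_scaleE /k_zero/= /vacuum_seq/=.
    by rewrite big_ord0 add0r.
  by rewrite !mulr0.
have ttheta : test_fun alpha theta by apply: tfs; rewrite mem_head.
have tfs' psi : psi \in fs -> test_fun alpha psi.
  by move=> fs_psi; apply: tfs; rewrite in_cons fs_psi orbT.
rewrite [monomial _]/(k_plus theta (monomial fs)) k_zero_plus; apply: fock_domD.
  apply: fock_dom_k_plus; last exact: fock_dom_monomial.
  exact: test_fun_mul (test_fun_bmeas tphi) ttheta.
by apply: fock_dom_k_plus => //; exact: IH.
Qed.

(** On symmetric functions both terms of k^- depend on one section of f only;
    as a functional of this section k^- is visibly linear. *)
Definition annih phi n (x : n.-tuple X) (u : X -> R[i]) : R[i] :=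
  cintegral alpha (fun y => (phi y)^*%C * u y) +
  \sum_(i < n) (phi (tnth x i))^*%C * u (tnth x i).

Lemma k_minus_annih phi f n x : exchangeable f ->
  k_minus alpha phi f n x = annih phi x (fun y => f n.+1 [tuple of y :: x]).
Proof.
move=> sf; congr (_ + _); apply: eq_bigr => i _; congr (_ * _).
by apply: exchangeable_perm_eq => //=; rewrite perm_rcons.
Qed.

Lemma annih_linear phi n (x : n.-tuple X) a u v : test_fun alpha phi ->
  test_fun alpha u -> test_fun alpha v ->
  annih phi x (fun y => a * u y + v y) = a * annih phi x u + annih phi x v.
Proof.
move=> tphi tu tv.
have I w : test_fun alpha w -> cintegrable alpha (fun y => (phi y)^*%C * w y).
  move=> tw; apply: test_fun_cintegrable.
  exact: test_fun_mul (bmeas_conj (test_fun_bmeas tphi)) tw.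
rewrite /annih mulrDr addrACA -cintegralZD; [|exact: I..]; congr (_ + _).
  by congr (cintegral alpha _); apply/funext => y; rewrite mulrDr mulrCA.
rewrite mulr_sumr -big_split/=; apply: eq_bigr => i _.
by rewrite mulrDr mulrCA.
Qed.

Lemma annih0 phi n (x : n.-tuple X) : annih phi x (fun=> 0) = 0.
Proof.
rewrite /annih big1; last by move=> i _; rewrite mulr0.
by under eq_fun do rewrite mulr0; rewrite cintegral0 addr0.
Qed.

Lemma test_fun_sum m (c : 'I_m -> R[i]) (u : 'I_m -> X -> R[i]) :
  (forall i, test_fun alpha (u i)) ->
  test_fun alpha (fun y => \sum_(i < m) c i * u i y).
Proof.
elim: m c u => [|m IH] c u tu.
  by under eq_fun do rewrite big_ord0; exact: test_fun0.
under eq_fun do rewrite big_ord_recl.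
by apply: test_fun_lin => //; exact: IH.
Qed.

Lemma annih_sum phi n (x : n.-tuple X) m (c : 'I_m -> R[i]) (u : 'I_m -> X -> R[i]) :
  test_fun alpha phi -> (forall i, test_fun alpha (u i)) ->
  annih phi x (fun y => \sum_(i < m) c i * u i y) = \sum_(i < m) c i * annih phi x (u i).
Proof.
move=> tphi; elim: m c u => [|m IH] c u tu.
  by under [in LHS]eq_fun do rewrite big_ord0; rewrite annih0 big_ord0.
under [in LHS]eq_fun do rewrite big_ord_recl.
rewrite annih_linear//; last exact: test_fun_sum.
by rewrite IH// big_ord_recl.
Qed.

Lemma k_minus_linear phi a f g : test_fun alpha phi -> fock_dom f -> fock_dom g ->
  k_minus alpha phi (a *: f + g) =
  a *: k_minus alpha phi f + k_minus alpha phi g.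
Proof.
move=> tphi Df Dg; apply: pre_fockP => n x.
rewrite pre_fock_addE pre_fock_scaleE !k_minus_annih; do ?exact: fock_dom_exchangeable.
  by rewrite -annih_linear//; exact: fock_dom_section.
by apply: fock_dom_exchangeable; exact: fock_dom_lin.
Qed.

Lemma k_minus0 phi : k_minus alpha phi 0 = 0.
Proof.
apply: pre_fockP => n x; rewrite k_minus_annih; last exact: exchangeable0.
exact: annih0.
Qed.

Lemma k_minus_vacuum phi : k_minus alpha phi (monomial [::]) = 0.
Proof.
apply: pre_fockP => n x; rewrite k_minus_annih; last exact: exchangeable_monomial.
exact: annih0.
Qed.

Lemma drop_at_cons n (j : 'I_n.+1) y (x : n.+1.-tuple X) :
  drop_at (lift ord0 j) [tuple of y :: x] = [tuple of y :: drop_at j x].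
Proof.
apply: eq_from_tnth => k; rewrite tnth_mktuple.
case: (unliftP ord0 k) => [l ->|->]; last first.
  by rewrite (_ : lift _ _ = ord0)//; exact: val_inj.
rewrite tnthS tnth_mktuple (_ : lift _ _ = lift ord0 (lift j l)) ?tnthS//.
by apply: val_inj; rewrite /= /bump/= !add1n ltnS addnS.
Qed.

Lemma drop_at0_cons n y (x : n.-tuple X) : drop_at ord0 [tuple of y :: x] = x.
Proof. by apply: eq_from_tnth => k; rewrite tnth_mktuple tnthS. Qed.

Lemma permute_cons_drop_at n (j : 'I_n.+1) (x : n.+1.-tuple X) :
  permute (lift_perm ord0 j 1%g) x = [tuple of tnth x j :: drop_at j x].
Proof.
apply: eq_from_tnth => k; rewrite tnth_mktuple.
case: (unliftP ord0 k) => [l ->|->]; last by rewrite lift_perm_id.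
by rewrite lift_perm_lift perm1 tnthS tnth_mktuple.
Qed.

(** Let c be conj(phi) * theta and call y the argument that k^-(phi) adds. When
    k^+(theta) acts on y, then k^-(phi) produces the integral of c and the
    sum of the c(x_i), times f. When it acts on an old point x_j, then the summand
    y = x_j of k^-(phi) is the one that k^+(theta) k^-(phi) lacks, because x_j is
    removed before k^- acts; it is c(x_j) times f. In total the sum of the c(x_i)
    occurs twice and the integral once, whence the factor 1/2 in k^0. *)
Lemma k_minus_plus phi theta f :
  test_fun alpha phi -> test_fun alpha theta -> fock_dom f ->
  k_minus alpha phi (k_plus theta f) =
  k_plus theta (k_minus alpha phi f) + 2 *: k_zero alpha (cconj phi \* theta) f.
Proof.
move=> tphi ttheta Df; have sf := fock_dom_exchangeable Df.
apply: pre_fockP => n x; rewrite pre_fock_addE pre_fock_scaleE.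
rewrite k_minus_annih; last exact/fock_dom_exchangeable/fock_dom_k_plus.
have annih_theta (k : nat) (z : k.-tuple X) : annih phi z theta =
    cintegral alpha (cconj phi \* theta) +
    \sum_(i < k) (cconj phi \* theta) (tnth z i) by [].
case: n x => [|n] x.
  have -> : (fun y => k_plus theta f 1%N [tuple of y :: x]) =
      (fun y => f 0%N x * theta y + 0).
    by apply/funext => y; rewrite k_plusS big_ord1 drop_at0_cons tnth0 mulrC addr0.
  rewrite annih_linear//; last exact: test_fun0.
  rewrite annih0 annih_theta /k_zero !big_ord0/=.
  by field.
have -> : (fun y => k_plus theta f n.+2 [tuple of y :: x]) = (fun y =>
    f n.+1 x * theta y +
    \sum_(j < n.+1) theta (tnth x j) * f n.+1 [tuple of y :: drop_at j x]).
  apply/funext => y; rewrite k_plusS big_ord_recl drop_at0_cons tnth0 mulrC.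
  by congr (_ + _); apply: eq_bigr => j _; rewrite drop_at_cons tnthS.
have tsec j : test_fun alpha (fun y => f n.+1 [tuple of y :: drop_at j x]).
  exact: fock_dom_section.
rewrite annih_linear//; last exact: test_fun_sum.
rewrite annih_sum// annih_theta.
have annih_drop j u : annih phi x u =
    annih phi (drop_at j x) u + (phi (tnth x j))^*%C * u (tnth x j).
  rewrite /annih (bigD1_ord j)//= -addrA; congr (_ + _); rewrite addrC.
  by congr (_ + _); apply: eq_bigr => i _; rewrite tnth_mktuple.
have -> : \sum_(j < n.+1) theta (tnth x j) *
      annih phi x (fun y => f n.+1 [tuple of y :: drop_at j x]) =
    \sum_(j < n.+1) (theta (tnth x j) * k_minus alpha phi f n (drop_at j x) +
      (cconj phi \* theta) (tnth x j) * f n.+1 x).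
  apply: eq_bigr => j _; rewrite (annih_drop j) -k_minus_annih// mulrDr; congr (_ + _).
  rewrite -permute_cons_drop_at sf /cconj/=; ring.
rewrite k_plusS big_split -mulr_suml /k_zero.
set c := cconj phi \* theta; set K := \sum_(i < n.+1) theta _ * _.
set S := \sum_(i < n.+1) c _; set I := cintegral _ _.
rewrite -[X in _ + X = _]/(K + S * f n.+1 x); by field.
Qed.

(** Moving k^- through the creation operators leaves elements of the domain
    behind, and k^- kills the vacuum. *)
Lemma fock_dom_k_minus phi f : test_fun alpha phi -> fock_dom f ->
  fock_dom (k_minus alpha phi f).
Proof.
move=> tphi; move: f.
have H fs : (forall psi, psi \in fs -> test_fun alpha psi) ->
    fock_dom (k_minus alpha phi (monomial fs)).
  elim: fs => [_|theta fs IH tfs]; first by rewrite k_minus_vacuum; exact: fock_dom0.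
  have ttheta : test_fun alpha theta by apply: tfs; rewrite mem_head.
  have tfs' psi : psi \in fs -> test_fun alpha psi.
    by move=> fs_psi; apply: tfs; rewrite in_cons fs_psi orbT.
  have Dfs := fock_dom_monomial tfs'.
  rewrite [monomial _]/(k_plus theta (monomial fs)) k_minus_plus//; apply: fock_domD.
    by apply: fock_dom_k_plus => //; exact: IH.
  apply: fock_domZ; apply: fock_dom_k_zero => //.
  exact: test_fun_mul (bmeas_conj (test_fun_bmeas tphi)) ttheta.
(* Linearity of k^- is available on the domain only: carry membership along. *)
suff : forall f, fock_dom f -> fock_dom f /\ fock_dom (k_minus alpha phi f).
  by move=> DD f /DD[].
apply: fock_dom_ind => [|a u v [Du Dku] [Dv Dkv]|fs tfs].
- by rewrite k_minus0; split; exact: fock_dom0.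
- by rewrite k_minus_linear//; split; exact: fock_dom_lin.
- by split; [exact: fock_dom_monomial|exact: H].
Qed.

Lemma k_plusC phi theta f : fock_dom f ->
  k_plus phi (k_plus theta f) = k_plus theta (k_plus phi f).
Proof.
move: f; apply: fock_dom_ind => [|a u v cu cv|fs _].
- by rewrite !k_plus0.
- by rewrite !k_plus_linear cu cv.
- apply: (@monomial_perm (phi :: theta :: fs) (theta :: phi :: fs)).
  by rewrite -[phi :: _]/([:: phi] ++ [:: theta] ++ fs) perm_catCA.
Qed.

End monomials.

(** * Adjoints *)

Section adjoints.
Context d (X : measurableType d) (R : realType).
Variable alpha : {sigma_finite_measure set X -> \bar R}.
Local Notation pre_fock := (pre_fock X R).
Local Notation lambda := (lambda alpha).
Implicit Types (f g : pre_fock) (phi : X -> R[i]).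

Lemma tame_permute n (h : n.-tuple X -> R[i]) (s : 'S_n) :
  tame alpha h -> tame alpha (fun x => h (permute s x)).
Proof.
move=> [bh [A [mA Aoo hA]]]; split.
  exact: bmeas_comp_tuple (measurable_permute s) bh.
exists A; split => // x /hA xA i.
by have := xA (s^-1%g i); rewrite tnth_mktuple permKV.
Qed.

Lemma lambda_pushforward n (s : 'S_n) (D : set (n.-tuple X)) (f : n.-tuple X -> \bar R) :
  (\int[lambda n]_(x in D) f x = \int[pushforward (lambda n) (permute s)]_(x in D) f x)%E.
Proof.
have ms := @measurable_permute _ X n s.
by apply: eq_measure_integral => A mA _; apply/esym; exact: lambda_permute.
Qed.

Lemma cintegral_permute n (h : n.-tuple X -> R[i]) (s : 'S_n) : tame alpha h ->
  cintegral (lambda n) (fun x => h (permute s x)) = cintegral (lambda n) h.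
Proof.
move=> th; have [mr mi] := th.1.1.
have [Ir Ii] := tame_cintegrable (tame_permute s th).
have ms := @measurable_permute _ X n s.
apply: eq_complexP; rewrite /= /Rintegral; congr fine; rewrite [RHS](lambda_pushforward s);
  rewrite [RHS]integral_pushforward//; exact/measurable_EFinP.
Qed.

Lemma msq_permute n (h : n.-tuple X -> R[i]) (s : 'S_n) : cmeasurable h ->
  msq (lambda n) (fun x => h (permute s x)) = msq (lambda n) h.
Proof.
move=> mh; have ms := @measurable_permute _ X n s.
rewrite [RHS](lambda_pushforward s) ge0_integral_pushforward//.
- exact: measurable_sqnormE.
- by move=> x _; rewrite lee_fin sqnorm_ge0.
Qed.

Lemma fock_term_k_plus0 phi f g : fock_term alpha f (k_plus phi g) 0 = 0.
Proof.
by rewrite /fock_term; under eq_fun do rewrite mulr0; rewrite cintegral0 mulr0.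
Qed.

(** All n+1 summands of k^+ contribute equally by symmetry; the recursion for
    lambda_{n+1} turns the first one into the scalar product with k^- f. *)
Lemma fock_term_k_plus phi f g n : test_fun alpha phi ->
  fock_dom alpha f -> fock_dom alpha g ->
  fock_term alpha f (k_plus phi g) n.+1 = fock_term alpha (k_minus alpha phi f) g n.
Proof.
move=> tphi Df Dg; have sf := fock_dom_exchangeable Df.
have tf := fock_dom_tame Df; have tg := fock_dom_tame Dg.
(* The summand of k^+ in which the point 0 is created. *)
pose H (x : n.+1.-tuple X) := (f n.+1 x)^*%C * (phi (tnth x ord0) * g n (drop_at ord0 x)).
have tH : tame alpha H.
  rewrite (_ : H = fun x => (phi (tnth x ord0) * g n (drop_at ord0 x)) * (f n.+1 x)^*%C).
    apply: tameM; last exact: tame_conj.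
    apply: bmeasM; first exact: bmeas_tnth (test_fun_bmeas tphi).
    by apply: bmeas_comp_tuple (tg n).1; exact: measurable_drop_at.
  by apply/funext => x; rewrite /H mulrC.
have HE : (fun x => (f n.+1 x)^*%C * k_plus phi g n.+1 x) =
    fun x => \sum_(i < n.+1) H (permute (lift_perm ord0 i 1%g) x).
  apply/funext => x; rewrite k_plusS mulr_sumr; apply: eq_bigr => i _.
  by rewrite /H sf permute_cons_drop_at tnth0 drop_at0_cons.
have [Iin rec] := cintegral_lambda_succ tH.
have innerE (x : n.-tuple X) : cintegral alpha (fun y => H [tuple of y :: x]) =
    (cintegral alpha (fun y => (phi y)^*%C * f n.+1 [tuple of y :: x]))^*%C * g n x.
  have tphif : test_fun alpha (fun y => (phi y)^*%C * f n.+1 [tuple of y :: x]).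
    apply: test_fun_mul (bmeas_conj (test_fun_bmeas tphi)) _.
    exact: fock_dom_section.
  rewrite -cintegral_conj; last exact: test_fun_cintegrable.
  rewrite mulrC -cintegralZ; last exact/cintegrable_conj/test_fun_cintegrable.
  congr (cintegral alpha _); apply/funext => y.
  rewrite /H tnth0 drop_at0_cons (conjM (phi y)^*%C) conj_conj; ring.
have tdup i : tame alpha (H \o @dup _ X n i).
  have [bH [A [mA Aoo HA]]] := tH; split.
    exact: bmeas_comp_tuple (measurable_dup i) bH.
  by exists A; split => // x /HA xA j; have := xA (lift ord0 j); rewrite tnthS.
rewrite /fock_term HE cintegral_sum; last first.
  by move=> i; exact/tame_cintegrable/tame_permute.
rewrite (eq_bigr (fun=> cintegral (lambda n.+1) H)); last first.
  by move=> i _; exact: cintegral_permute.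
rewrite sumr_const card_ord rec.
rewrite -cintegral_sum; last by move=> i; exact/tame_cintegrable/tdup.
rewrite -cintegralD//; last first.
  by apply: cintegrable_sum => i; exact/tame_cintegrable/tdup.
rewrite -[X in _ * X = _]mulr_natl mulrA; congr (_ * _).
  by rewrite factS natrM invfM mulrAC mulVf ?mul1r// pnatr_eq0.
congr (cintegral _ _); apply/funext => x; rewrite innerE k_minus_annih// /annih conjD mulrDl; congr (_ + _).
rewrite rmorph_sum mulr_suml; apply: eq_bigr => i _.
by rewrite /H /dup /= tnth0 drop_at0_cons rmorphM/= conj_conj; ring.
Qed.

Lemma fock_term_k_zero phi f g n : test_fun alpha phi ->
  fock_term alpha f (k_zero alpha phi g) n =
  fock_term alpha (k_zero alpha (cconj phi) f) g n.
Proof.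
move=> tphi; congr (_ * cintegral _ _); apply/funext => x.
rewrite /k_zero /cconj conjM conjD rmorph_sum conjM cintegral_conj; last first.
  exact: test_fun_cintegrable.
have -> : ((2^-1 : R[i])^*)%C = 2^-1 by rewrite fmorphV rmorph_nat.
rewrite conj_conj mulrCA mulrA; congr ((_ + _) * _ * _).
by apply: eq_bigr => i _; exact/esym/conj_conj.
Qed.

End adjoints.

(** * The extended Fock space *)

Section complex_series.
Context (R : realType).
Implicit Types t : nat -> R[i].

Definition csummable t : Prop :=
  cvgn (series (fun n => complex.Re (t n))) /\
  cvgn (series (fun n => complex.Im (t n))).

Definition csum t : R[i] :=
  Complex (limn (series (fun n => complex.Re (t n))))
          (limn (series (fun n => complex.Im (t n)))).

Lemma csum_lin a t t' : csummable t -> csummable t' ->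
  csum (fun n => a * t n + t' n) = a * csum t + csum t'.
Proof.
move=> [tr ti] [tr' ti'].
have Z (c : R) (u : R^nat) : cvgn (series u) -> cvgn (series (c *: u)).
  by move=> cu; exact: is_cvg_seriesZ.
have ZE (c : R) (u : R^nat) : cvgn (series u) ->
    c * limn (series u) = limn (series (c *: u)).
  by move=> cu; rewrite lim_seriesZ.
apply: eq_complexP; rewrite ?Re_add ?Im_add ?Re_mul ?Im_mul /=.
- rewrite !ZE// -lim_seriesB; [|exact: Z..].
  rewrite -lim_seriesD//; last by apply: is_cvg_seriesB; exact: Z.
  by congr (limn (series _)); apply/funext => n; rewrite Re_add Re_mul.
- rewrite !ZE// -lim_seriesD; [|exact: Z..].
  rewrite -lim_seriesD//; last by apply: is_cvg_seriesD; exact: Z.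
  by congr (limn (series _)); apply/funext => n; rewrite Im_add Im_mul.
Qed.

Lemma csum_conj t : csummable t -> csum (fun n => (t n)^*%C) = (csum t)^*%C.
Proof.
move=> [tr ti]; apply: eq_complexP; rewrite ?Re_of_conj ?Im_of_conj /=.
  by under eq_fun do rewrite Re_of_conj.
rewrite -lim_seriesN//; congr (limn (series _)).
by apply/funext => n; rewrite Im_of_conj.
Qed.

Lemma series_shift1 (u : R^nat) : u 0%N = 0 ->
  series u \o S = series (fun n => u n.+1).
Proof.
move=> u0; apply/funext => n; rewrite /series/= big_nat_recl//.
by rewrite u0 add0r.
Qed.

Lemma csum_shift t : csummable t -> t 0%N = 0 -> csum t = csum (fun n => t n.+1).
Proof.
have E (u : R^nat) : cvgn (series u) -> u 0%N = 0 ->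
    limn (series u) = limn (series (fun n => u n.+1)).
  move=> cu u0; apply/esym/cvg_lim => //.
  by rewrite -series_shift1// (cvg_shiftS (series u)).
by move=> [tr ti] t0; apply: eq_complexP; apply: E => //; rewrite t0.
Qed.

End complex_series.

Section fock_space.
Context d (X : measurableType d) (R : realType).
Variable alpha : {sigma_finite_measure set X -> \bar R}.
Local Notation pre_fock := (pre_fock X R).
Local Notation lambda := (lambda alpha).
Local Notation square_summable := (square_summable alpha).
Implicit Types (f g h : pre_fock) (u v : fock alpha).

(** Total, so that square summability need not be part of the argument. *)
Definition cls f : fock alpha :=
  match pselect (square_summable f) with
  | left sf => fock_class (@FockSeq _ _ _ alpha f (asboolT sf))
  | right _ => 0
  end.

Lemma fock_seq_square_summable (g : fock_seq alpha) : square_summable (fock_fun g).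
Proof. by apply/asboolP; case: g. Qed.

Lemma cls_fock_fun (g : fock_seq alpha) : cls (fock_fun g) = fock_class g.
Proof.
rewrite /cls; case: pselect => [sg|/(_ (fock_seq_square_summable g))//].
by congr fock_class; exact: val_inj.
Qed.

Lemma fock_seqP f : square_summable f -> exists g : fock_seq alpha, f = fock_fun g.
Proof. by move=> sf; exists (@FockSeq _ _ _ alpha f (asboolT sf)). Qed.

Lemma represents_cls f : square_summable f -> represents (cls f) f.
Proof. by move=> /fock_seqP[g ->]; exists g; rewrite ?cls_fock_fun. Qed.

Lemma representsP u f : represents u f -> square_summable f /\ u = cls f.
Proof.
by move=> [g <- <-]; split; [exact: fock_seq_square_summable|rewrite cls_fock_fun].
Qed.

Lemma cls_repr u : exists2 f, square_summable f & u = cls f.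
Proof.
exists (fock_fun (fock_repr u)); first exact: fock_seq_square_summable.
by rewrite cls_fock_fun fock_reprK.
Qed.

Definition same_class f g : Prop :=
  forall n, {ae lambda n, forall x, f n x = g n x}.

Lemma cls_eqP f g : square_summable f -> square_summable g ->
  (cls f = cls g <-> same_class f g).
Proof.
by move=> /fock_seqP[f' ->] /fock_seqP[g' ->]; rewrite !cls_fock_fun; exact: fock_classP.
Qed.

Lemma fock_fun_lin a (f g : fock_seq alpha) :
  a *: fock_fun f + fock_fun g = fock_fun (a *: f + g).
Proof. by []. Qed.

Lemma square_summable_lin a f g :
  square_summable f -> square_summable g -> square_summable (a *: f + g).
Proof.
move=> /fock_seqP[f' ->] /fock_seqP[g' ->].
rewrite fock_fun_lin; exact: fock_seq_square_summable.
Qed.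

Lemma cls_lin a f g : square_summable f -> square_summable g ->
  cls (a *: f + g) = a *: cls f + cls g.
Proof.
move=> /fock_seqP[f' ->] /fock_seqP[g' ->].
rewrite fock_fun_lin !cls_fock_fun fock_classD.
by congr (_ + _); exact: fock_classZ.
Qed.

Lemma square_summable0 : square_summable 0.
Proof. exact: (fock_seq_square_summable 0). Qed.

Lemma cls0 : cls 0 = 0.
Proof.
have := cls_lin (-1) square_summable0 square_summable0.
by rewrite scaler0 addr0 scaleN1r addNr.
Qed.

Lemma clsB f g : square_summable f -> square_summable g ->
  cls (f - g) = cls f - cls g.
Proof.
move=> sf sg; have := cls_lin (-1) sg sf.
by rewrite !scaleN1r addrC => ->; rewrite addrC.
Qed.

Lemma square_summableB f g :
  square_summable f -> square_summable g -> square_summable (f - g).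
Proof.
by move=> sf sg; have := square_summable_lin (-1) sg sf; rewrite scaleN1r addrC.
Qed.

(** ** Norms *)

(** The contribution of degree n to the squared norm. *)
Definition energy f n : \bar R := ((n`!%:R)^-1%:E * msq (lambda n) (f n))%E.

Definition total_energy f : \bar R := (\sum_(0 <= n <oo) energy f n)%E.

Lemma energy_ge0 f n : (0 <= energy f n)%E.
Proof. by rewrite mule_ge0 ?lee_fin ?invr_ge0// msq_ge0. Qed.

Lemma energy_le_total f n : (energy f n <= total_energy f)%E.
Proof.
rewrite /total_energy (nneseries_split 0 n.+1); last by move=> k _; exact: energy_ge0.
rewrite add0n big_nat_recr//= addeAC -[leLHS]add0e leeD2r//.
rewrite adde_ge0//; first by apply: sume_ge0 => k _; exact: energy_ge0.
by apply: nneseries_ge0 => k _ _; exact: energy_ge0.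
Qed.

Lemma partial_energy_le f N : (\sum_(0 <= n < N) energy f n <= total_energy f)%E.
Proof. by apply: nneseries_lim_ge => *; exact: energy_ge0. Qed.

Lemma total_energy_le f (c : \bar R) :
  (forall N, (\sum_(0 <= n < N) energy f n <= c)%E) -> (total_energy f <= c)%E.
Proof.
move=> fc; apply: lime_le; last exact: nearW.
by apply: is_cvg_nneseries => n _ _; exact: energy_ge0.
Qed.

Lemma energy_lty f n : square_summable f -> (energy f n < +oo)%E.
Proof. by move=> [_ _ foo]; exact: le_lt_trans (energy_le_total f n) foo. Qed.

Lemma msq_energy f n : msq (lambda n) (f n) = (n`!%:R%:E * energy f n)%E.
Proof.
by rewrite /energy muleA -EFinM divff ?mul1e// pnatr_eq0 -lt0n fact_gt0.
Qed.

Lemma msq_lty f n : square_summable f -> (msq (lambda n) (f n) < +oo)%E.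
Proof.
by move=> sf; rewrite msq_energy lte_mul_pinfty ?lee_fin//; exact: energy_lty.
Qed.

Lemma energy_fin_num f n : square_summable f -> energy f n \is a fin_num.
Proof. by move=> sf; rewrite ge0_fin_numE ?energy_ge0//; exact: energy_lty. Qed.

Lemma energy_triangle f g h n :
  cmeasurable (f n) -> cmeasurable (g n) -> cmeasurable (h n) ->
  (energy (f - h)%R n <= 2%:E * energy (f - g)%R n + 2%:E * energy (g - h)%R n)%E.
Proof.
move=> mf mg mh; rewrite /energy !(muleCA 2%:E) -ge0_muleDr ?mule_ge0 ?msq_ge0//.
by rewrite lee_pmul2l ?lte_fin ?invr_gt0 ?ltr0n ?fact_gt0//; exact: msq_triangle.
Qed.

Lemma cvg_series_energy f : square_summable f ->
  cvgn (series (fun n => fine (energy f n))).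
Proof.
move=> sf; apply: nnseries_is_cvg => [n|]; first exact: fine_ge0 (energy_ge0 _ _).
rewrite (eq_eseriesr (g := energy f)); first by case: sf.
by move=> n _; rewrite fineK//; exact: energy_fin_num.
Qed.

Lemma lim_series_energy f : square_summable f ->
  limn (series (fun n => fine (energy f n))) = fine (total_energy f).
Proof.
move=> sf; have c := cvg_series_energy sf.
apply: EFin_inj; rewrite -EFin_lim// fineK; last first.
  rewrite ge0_fin_numE; first by case: sf.
  by apply: nneseries_ge0 => n _ _; exact: energy_ge0.
congr (limn _); apply/funext => N; rewrite /series/= -sumEFin.
by apply: eq_bigr => n _; rewrite fineK//; exact: energy_fin_num.
Qed.

Lemma inv_fact_complex n : ((n`!%:R)^-1 : R[i]) = Complex ((n`!%:R)^-1) 0.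
Proof. by rewrite -[RHS]/(real_complex R _) fmorphV rmorph_nat. Qed.

Lemma fock_term_Re f g n : complex.Re (fock_term alpha f g n) =
  (n`!%:R)^-1 * complex.Re (cintegral (lambda n) (fun x => (f n x)^*%C * g n x)).
Proof. by rewrite /fock_term inv_fact_complex Re_mul /= mul0r subr0. Qed.

Lemma fock_term_Im f g n : complex.Im (fock_term alpha f g n) =
  (n`!%:R)^-1 * complex.Im (cintegral (lambda n) (fun x => (f n x)^*%C * g n x)).
Proof. by rewrite /fock_term inv_fact_complex Im_mul /= mul0r addr0. Qed.

Lemma fock_term_self f n : square_summable f ->
  fock_term alpha f f n = Complex (fine (energy f n)) 0.
Proof.
move=> sf; rewrite /fock_term inv_fact_complex cintegral_conj_mul_self /energy.
rewrite fineM//; last by rewrite ge0_fin_numE ?msq_ge0// msq_lty.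
by apply: eq_complexP; rewrite ?Re_mul ?Im_mul /= ?mul0r ?mulr0 ?subr0 ?addr0.
Qed.

Lemma fock_term_bound n f g : square_summable f -> square_summable g ->
  `|complex.Re (fock_term alpha f g n)| <= fine (energy f n) + fine (energy g n) /\
  `|complex.Im (fock_term alpha f g n)| <= fine (energy f n) + fine (energy g n).
Proof.
move=> sf sg; have [mf _ _] := sf; have [mg _ _] := sg.
have [Ir Ii] := cintegrable_conj_mul (mf n) (mg n) (msq_lty n sf) (msq_lty n sg).
have S h : square_summable h ->
    (lambda n).-integrable setT (EFin \o (fun x => sqnorm (h n x))).
  move=> sh; have [mh _ _] := sh; apply/integrableP; split; first exact: measurable_sqnormE.
  by under eq_integral do rewrite gee0_abs ?lee_fin ?sqnorm_ge0//; exact: msq_lty.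
have E h : square_summable h ->
    fine (energy h n) = (n`!%:R)^-1 * \int[lambda n]_x sqnorm (h n x).
  by move=> sh; rewrite fineM// ge0_fin_numE ?msq_ge0// msq_lty.
have main (k : n.-tuple X -> R) : (lambda n).-integrable setT (EFin \o k) ->
    (forall x, `|k x| <= sqnorm (f n x) + sqnorm (g n x)) ->
    `|(n`!%:R)^-1 * \int[lambda n]_x k x| <= fine (energy f n) + fine (energy g n).
  move=> Ik kfg; rewrite !E// -mulrDr normrM ger0_norm ?invr_ge0//.
  rewrite ler_wpM2l ?invr_ge0// (le_trans (le_normr_Rintegral _ Ik))//.
  rewrite -RintegralD//; [|exact: S..].
  apply: le_Rintegral => //; first exact: integrable_norm.
    by apply: (integrableD measurableT (S _ sf) (S _ sg)).
rewrite fock_term_Re fock_term_Im; split; apply: main => // x.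
  exact: Re_conj_mul.
exact: Im_conj_mul.
Qed.

Lemma csummable_fock_term f g : square_summable f -> square_summable g ->
  csummable (fock_term alpha f g).
Proof.
move=> sf sg.
have c : cvgn (series (fun n => fine (energy f n) + fine (energy g n))).
  exact: (is_cvg_seriesD (cvg_series_energy sf) (cvg_series_energy sg)).
have e0 n : 0 <= fine (energy f n) + fine (energy g n).
  by rewrite addr_ge0// fine_ge0// energy_ge0.
by split; apply: (@normed_cvg _ R^o); apply: series_le_cvg c => // n;
  rewrite ?normr_ge0//; have [] := fock_term_bound n sf sg.
Qed.

(** ** The scalar product *)

Lemma fock_term_same_class f g f' g' n :
  square_summable f -> square_summable g -> square_summable f' -> square_summable g' ->
  same_class f f' -> same_class g g' -> fock_term alpha f g n = fock_term alpha f' g' n.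
Proof.
move=> [mf _ _] [mg _ _] [mf' _ _] [mg' _ _] ff' gg'; congr (_ * _).
apply: ae_eq_cintegral.
- by apply: cmeasurableM => //; exact: cmeasurable_conj.
- by apply: cmeasurableM => //; exact: cmeasurable_conj.
- by have := ff' n; have := gg' n; apply: filterS2 => x -> ->.
Qed.

Lemma fock_ip_cls f g : square_summable f -> square_summable g ->
  fock_ip alpha (cls f) (cls g) = csum (fock_term alpha f g).
Proof.
move=> sf sg.
have rep h : square_summable h -> same_class (fock_fun (fock_repr (cls h))) h.
  move=> sh.
  have [+ _] := cls_eqP (fock_seq_square_summable (fock_repr (cls h))) sh.
  by apply; rewrite cls_fock_fun fock_reprK.
have E := fock_term_same_class _ (fock_seq_square_summable _)
  (fock_seq_square_summable _) sf sg (rep _ sf) (rep _ sg).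
by apply: eq_complexP; congr (limn (series _)); apply/funext => n; rewrite E.
Qed.

Lemma fock_term_conj f g n : square_summable f -> square_summable g ->
  fock_term alpha g f n = (fock_term alpha f g n)^*%C.
Proof.
move=> sf sg; have [mf _ _] := sf; have [mg _ _] := sg.
have cr (r : R) : (Complex r 0)^*%C = Complex r 0 by rewrite /= oppr0.
rewrite /fock_term conjM inv_fact_complex cr; congr (_ * _).
rewrite -cintegral_conj; last by apply: cintegrable_conj_mul => //; exact: msq_lty.
by congr (cintegral _ _); apply/funext => x; rewrite conjM conj_conj mulrC.
Qed.

Lemma fock_term_lin f a g h n :
  square_summable f -> square_summable g -> square_summable h ->
  fock_term alpha f (a *: g + h) n = a * fock_term alpha f g n + fock_term alpha f h n.
Proof.
move=> sf sg sh; have [mf _ _] := sf; have [mg _ _] := sg; have [mh _ _] := sh.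
rewrite /fock_term mulrCA -mulrDr; congr (_ * _).
rewrite -cintegralZD; [|by apply: cintegrable_conj_mul => //; exact: msq_lty..].
congr (cintegral _ _); apply/funext => x.
by rewrite pre_fock_addE pre_fock_scaleE mulrDr mulrCA.
Qed.

Lemma fock_ip_self f : square_summable f ->
  fock_ip alpha (cls f) (cls f) = Complex (fine (total_energy f)) 0.
Proof.
move=> sf; rewrite fock_ip_cls//; apply: eq_complexP => /=.
  rewrite -lim_series_energy//; congr (limn (series _)); apply/funext => n.
  by rewrite fock_term_self.
rewrite (_ : (fun n => _) = (fun=> 0)); last first.
  by apply/funext => n; rewrite fock_term_self.
rewrite (_ : series _ = cst 0) ?lim_cst//.
by apply/funext => n; rewrite /series/= big1.
Qed.

Lemma total_energy_fin_num f : square_summable f -> total_energy f \is a fin_num.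
Proof.
move=> sf; rewrite ge0_fin_numE; first by case: sf.
by apply: nneseries_ge0 => n _ _; exact: energy_ge0.
Qed.

Lemma hnorm_cls_lt f (e : R) : square_summable f -> 0 < e ->
  (hnorm (fock_ip alpha) (cls f) < e <-> (total_energy f < (e ^+ 2)%:E)%E).
Proof.
move=> sf e0; rewrite /hnorm fock_ip_self//=.
rewrite -[X in _ < X](ger0_norm (ltW e0)) -sqrtr_sqr ltr_sqrt ?exprn_gt0//.
by rewrite -[X in (X < _)%E]fineK ?total_energy_fin_num// lte_fin.
Qed.

Lemma same_class0 f : square_summable f -> total_energy f = 0%E -> same_class f 0.
Proof.
move=> sf f0 n; have [mf _ _] := sf.
apply: msq_eq0 => //; apply/eqP; rewrite eq_le msq_ge0 andbT msq_energy.
have : (energy f n <= 0)%E by rewrite -f0 energy_le_total.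
move=> en0; have -> : energy f n = 0%E by apply/eqP; rewrite eq_le en0 energy_ge0.
by rewrite mule0.
Qed.

End fock_space.

(** ** Completeness of the Fock space *)

Section fock_complete.
Context d (X : measurableType d) (R : realType).
Variable alpha : {sigma_finite_measure set X -> \bar R}.
Local Notation pre_fock := (pre_fock X R).
Local Notation lambda := (lambda alpha).
Local Notation square_summable := (square_summable alpha).
Local Notation energy := (energy alpha).
Local Notation total_energy := (total_energy alpha).
Implicit Types (f g h : pre_fock) (u v : fock alpha).

Lemma square_summable_permute f n (s : 'S_n) : square_summable f ->
  {ae lambda n, forall x, f n (permute s x) = f n x}.
Proof. by move=> [_ sf _]; exact: sf. Qed.

(** Limits in mean square of almost everywhere symmetric functions are almost
    everywhere symmetric because lambda_n is invariant under permutations. *)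
Lemma ae_symmetric_limit n (F : nat -> n.-tuple X -> R[i]) (g : n.-tuple X -> R[i])
    (s : 'S_n) :
  (forall k, cmeasurable (F k)) ->
  (forall k, {ae lambda n, forall x, F k (permute s x) = F k x}) ->
  cmeasurable g ->
  (forall e : R, 0 < e -> exists k, (msq (lambda n) (fun x => F k x - g x)%R <= e%:E)%E) ->
  {ae lambda n, forall x, g (permute s x) = g x}.
Proof.
move=> mF sF mg Fg; have ms := @measurable_permute _ X n s.
have mgs : cmeasurable (fun x => g (permute s x)) by exact: cmeasurable_comp mg.
suff : {ae lambda n, forall x, g (permute s x) - g x = 0}.
  by apply: filterS => x /eqP; rewrite subr_eq0 => /eqP.
apply: msq_eq0; first exact: cmeasurableB.
apply/eqP; rewrite eq_le msq_ge0 andbT; apply/lee_addgt0Pr => e e0; rewrite add0e.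
have [|k Fk] := Fg (e / 4); first by rewrite divr_gt0.
have mFs : cmeasurable (fun x => F k (permute s x)) by exact: cmeasurable_comp (mF k).
apply: le_trans (msq_triangle _ mgs mFs mg) _.
have -> : msq (lambda n) (fun x => g (permute s x) - F k (permute s x))%R =
    msq (lambda n) (fun x => F k x - g x)%R.
  rewrite (msq_permute alpha s (h := fun x => g x - F k x)); last exact: cmeasurableB.
  by apply: eq_integral => x _; rewrite -sqnormN opprB.
have -> : msq (lambda n) (fun x => F k (permute s x) - g x)%R =
    msq (lambda n) (fun x => F k x - g x)%R.
  apply: ae_eq_msq; [exact: cmeasurableB|exact: cmeasurableB|].
  by have := sF k; apply: filterS => x ->.
apply: le_trans (leeD (lee_wpmul2l _ Fk) (lee_wpmul2l _ Fk)) _; rewrite ?lee_fin//.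
lra.
Qed.

Lemma energy_partial_small (F : nat -> pre_fock) g N :
  (forall n (e : R), 0 < e -> exists L, forall l, (L <= l)%N ->
     (energy (F l - g)%R n <= e%:E)%E) ->
  forall e : R, 0 < e -> exists L, forall l, (L <= l)%N ->
     (\sum_(0 <= n < N) energy (F l - g)%R n <= e%:E)%E.
Proof.
move=> Fg; elim: N => [|N IH] e e0.
  by exists 0%N => l _; rewrite big_nil lee_fin ltW.
have e20 : 0 < e / 2 by rewrite divr_gt0.
have [L LP] := IH _ e20; have [M MP] := Fg N _ e20.
exists (maxn L M) => l; rewrite geq_max => /andP[Ll Ml].
rewrite big_nat_recr//= (splitr e) EFinD; apply: leeD; [exact: LP|exact: MP].
Qed.

(** The limit is taken in every degree. A partial sum of the energies of F k - g is
    bounded through F l with l so large that F l and g are close in the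
    finitely many degrees concerned. *)
Lemma fock_complete (F : nat -> pre_fock) : (forall k, square_summable (F k)) ->
  (forall e : R, 0 < e -> exists N, forall k l, (N <= k)%N -> (N <= l)%N ->
     (total_energy (F k - F l)%R <= e%:E)%E) ->
  exists2 g, square_summable g & forall e : R, 0 < e ->
    exists N, forall k, (N <= k)%N -> (total_energy (F k - g)%R <= e%:E)%E.
Proof.
move=> sF FC; have mF k n : cmeasurable (F k n) by case: (sF k).
have G n : {g : n.-tuple X -> R[i] | cmeasurable g /\ forall e : R, 0 < e ->
    exists N, forall k, (N <= k)%N -> (msq (lambda n) (fun x => F k n x - g x)%R <= e%:E)%E}.
  apply: cid.
  have [||g mg gP] := @L2_complete _ _ R (lambda n) (fun k => F k n).
  - by move=> k; exact: mF.
  - move=> e e0; have f0 : 0 < (n`!%:R : R) by rewrite ltr0n fact_gt0.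
    have [N NP] := FC (e / n`!%:R) (divr_gt0 e0 f0).
    exists N => k l Nk Nl.
    rewrite -[X in (X <= _)%E]/(msq (lambda n) ((F k - F l) n)) msq_energy.
    apply: le_trans (lee_wpmul2l _ (le_trans (energy_le_total _ _ n) (NP k l Nk Nl))) _.
      by rewrite lee_fin ltW.
    by rewrite -EFinM lee_fin mulrC divfK// gt_eqF.
  - by exists g.
pose g : pre_fock := fun n => projT1 (G n).
have mg n : cmeasurable (g n) by have [] := projT2 (G n).
have gP n : forall e : R, 0 < e -> exists N, forall k, (N <= k)%N ->
    (msq (lambda n) (fun x => F k n x - g n x)%R <= e%:E)%E by have [] := projT2 (G n).
have gE n (e : R) : 0 < e -> exists L, forall l, (L <= l)%N ->
    (energy (F l - g)%R n <= e%:E)%E.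
  move=> e0; have f0 : 0 < (n`!%:R : R) by rewrite ltr0n fact_gt0.
  have [L LP] := gP n _ (mulr_gt0 f0 e0); exists L => l Ll.
  apply: le_trans (lee_wpmul2l _ (LP l Ll)) _; first by rewrite lee_fin invr_ge0 ltW.
  by rewrite -EFinM lee_fin mulrA mulVf ?mul1r// gt_eqF.
have conv (e : R) : 0 < e -> exists N, forall k, (N <= k)%N ->
    (total_energy (F k - g)%R <= e%:E)%E.
  move=> e0; have e40 : 0 < e / 4 by rewrite divr_gt0.
  have [K KP] := FC _ e40; exists K => k Kk; apply: total_energy_le => N.
  have [L LP] := energy_partial_small N gE e40.
  pose l := maxn K L.
  apply: (@le_trans _ _ (\sum_(0 <= n < N)
      (2%:E * energy (F k - F l)%R n + 2%:E * energy (F l - g)%R n))%E).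
    by apply: lee_sum => n _; exact: energy_triangle.
  rewrite big_split/= -!ge0_sume_distrr; [|by move=> *; exact: energy_ge0..].
  have Kl := le_trans (partial_energy_le _ (F k - F l) N) (KP k l Kk (leq_maxl _ _)).
  have Ll := LP l (leq_maxr _ _).
  apply: le_trans (leeD (lee_wpmul2l _ Kl) (lee_wpmul2l _ Ll)) _; rewrite ?lee_fin//.
  lra.
exists g => //.
have [K KP] := conv 1 ltr01.
have sFg : square_summable (F K - g).
  split.
  - by move=> n; exact: cmeasurableB.
  - move=> n s.
    have gs : {ae lambda n, forall x, g n (permute s x) = g n x}.
      apply: (@ae_symmetric_limit n (fun k => F k n)) => //.
        by move=> k; exact: square_summable_permute.
      by move=> e /(gP n)[N NP]; exists N; exact: NP.
    have := square_summable_permute s (sF K); move: gs; apply: filterS2 => x gx Fx.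
    by rewrite -[LHS]/(F K n (permute s x) - g n (permute s x)) gx Fx.
  - by apply: le_lt_trans (KP K (leqnn _)) _; rewrite ltry.
(* F K - g is square summable, its energy being at most 1. *)
have -> : g = F K - (F K - g) by rewrite opprB addrC subrK.
exact: square_summableB.
Qed.

Lemma fock_hilbert : hilbert_space (fock_ip alpha).
Proof.
split.
- move=> a u v w; have [f sf ->] := cls_repr u; have [g sg ->] := cls_repr v.
  have [h sh ->] := cls_repr w.
  have sgh := square_summable_lin a sg sh.
  rewrite -[X in fock_ip _ _ X = _](cls_lin a sg sh) (fock_ip_cls sf sgh) (fock_ip_cls sf sg) (fock_ip_cls sf sh).
  rewrite -(csum_lin a (csummable_fock_term sf sg) (csummable_fock_term sf sh)).
  by congr csum; apply/funext => n; exact: fock_term_lin.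
- move=> u v; have [f sf ->] := cls_repr u; have [g sg ->] := cls_repr v.
  rewrite (fock_ip_cls sf sg) (fock_ip_cls sg sf) -(csum_conj (csummable_fock_term sf sg)).
  by congr csum; apply/funext => n; exact: fock_term_conj.
- move=> u; have [f sf ->] := cls_repr u.
  rewrite (fock_ip_self sf) lecE /= eqxx/= fine_ge0//.
  by apply: nneseries_ge0 => n _ _; exact: energy_ge0.
- move=> u; have [f sf ->] := cls_repr u.
  rewrite (fock_ip_self sf) => -[] f0.
  have t0 : total_energy f = 0%E by rewrite -[LHS](fineK (total_energy_fin_num sf)) f0.
  rewrite -[RHS]cls0; apply: (cls_eqP sf (@square_summable0 _ _ _ alpha)).2.
  exact: same_class0.
- move=> u_ uC.
  have /choice[F FP] : forall k, exists f, square_summable f /\ u_ k = cls alpha f.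
    by move=> k; have [f sf uf] := cls_repr (u_ k); exists f.
  have sF k : square_summable (F k) by case: (FP k).
  have [|g sg gP] := fock_complete sF.
    move=> e e0; have s0 : 0 < Num.sqrt e by rewrite sqrtr_gt0.
    have [N NP] := uC (Num.sqrt e) s0; exists N => k l Nk Nl.
    have := NP k l Nk Nl; rewrite (FP k).2 (FP l).2 -(clsB (sF k) (sF l)).
    move=> /(hnorm_cls_lt (square_summableB (sF k) (sF l)) s0).1.
    by rewrite (sqr_sqrtr (ltW e0)) => /ltW.
  exists (cls alpha g) => e e0.
  have [|N NP] := gP (e ^+ 2 / 2); first by rewrite divr_gt0 ?exprn_gt0.
  exists N => k Nk; rewrite (FP k).2 -(clsB (sF k) sg).
  apply: (hnorm_cls_lt (square_summableB (sF k) sg) e0).2.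
  apply: le_lt_trans (NP k Nk) _; rewrite lte_fin ltr_pdivrMr// ltr_pMr ?exprn_gt0//.
  by rewrite ltr1n.
Qed.

End fock_complete.

(** * Density of the domain *)

Section indicators.
Context d (T : measurableType d) (R : realType).
Implicit Types A B : set T.

Lemma real_complex_indic A x : ((\1_A x : R)%:C)%C = \1_A x :> R[i].
Proof. by rewrite !indicE rmorph_nat. Qed.

Lemma sqnorm_real (r : R) : sqnorm (r%:C)%C = r ^+ 2.
Proof. by rewrite sqnormE /= expr0n addr0. Qed.

Lemma cmeasurable_real (r : T -> R) : measurable_fun setT r ->
  cmeasurable (fun x => (r x)%:C%C).
Proof. by move=> mr; split => //; exact: measurable_cst. Qed.

Lemma cmeasurable_indic A : measurable A -> cmeasurable (\1_A : T -> R[i]).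
Proof.
move=> mA; rewrite (_ : \1_A = fun x => ((\1_A x : R)%:C)%C).
  by apply: cmeasurable_real; exact: measurable_indic.
by apply/funext => x; rewrite real_complex_indic.
Qed.

Lemma bmeas_indic A : measurable A -> bmeas (\1_A : T -> R[i]).
Proof.
move=> mA; split; first exact: cmeasurable_indic.
by exists 1 => x; rewrite indicE; case: (x \in A); rewrite ?sqnorm1 ?sqnorm0.
Qed.

Lemma indicU_disjoint A B : A `&` B = set0 ->
  \1_(A `|` B) = (fun x => \1_A x + \1_B x) :> (T -> R[i]).
Proof.
move=> AB; apply/funext => x; rewrite !indicE in_setU.
have : x \notin A `&` B by rewrite AB in_set0.
by rewrite in_setI; case: (x \in A); case: (x \in B); rewrite //= ?addr0 ?add0r.
Qed.

End indicators.

Section density.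
Context d (X : measurableType d) (R : realType).
Variable alpha : {sigma_finite_measure set X -> \bar R}.
Local Notation pre_fock := (pre_fock X R).
Local Notation lambda := (lambda alpha).
Local Notation square_summable := (square_summable alpha).
Local Notation fock_dom := (fock_dom alpha).

Section fixed_degree.
Variable n : nat.
Implicit Types g h : n.-tuple X -> R[i].

Definition symsum g (x : n.-tuple X) : R[i] := \sum_(s : 'S_n) g (permute s x).

(** The symmetrization of g is a mean square limit of elements of the domain
    that are concentrated in degree n. *)
Definition approximable g : Prop := forall e : R, 0 < e ->
  exists w : pre_fock, [/\ fock_dom w, forall m, m != n -> w m = fun=> 0 &
    (msq (lambda n) (fun x => symsum g x - w n x)%R <= e%:E)%E].

Lemma cmeasurable_symsum g : cmeasurable g -> cmeasurable (symsum g).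
Proof.
move=> mg; apply: cmeasurable_sum => s.
exact: (cmeasurable_comp (measurable_permute s) mg).
Qed.

(** Symmetrization is bounded in mean square since lambda_n is invariant under
    permutations; the value of the bound is immaterial. *)
Lemma msq_symsum : exists2 C : R, 0 < C & forall g, cmeasurable g ->
  (msq (lambda n) (symsum g) <= C%:E * msq (lambda n) g)%E.
Proof.
suff H : forall r : seq 'S_n, exists2 C : R, 0 < C & forall g, cmeasurable g ->
    (msq (lambda n) (fun x => \sum_(s <- r) g (permute s x))%R <= C%:E * msq (lambda n) g)%E.
  by have [C C0 CP] := H (index_enum _); exists C.
elim=> [|s r [C C0 IH]].
  exists 1 => // g mg; under eq_fun do rewrite big_nil.
  rewrite /msq integral0_eq ?mul1e ?msq_ge0// => x _.
  by rewrite sqnorm0.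
exists (2 + 2 * C); first by rewrite addr_gt0 ?mulr_gt0.
move=> g mg; under eq_fun do rewrite big_cons.
have mgs (t : 'S_n) : cmeasurable (fun x => g (permute t x)).
  exact: (cmeasurable_comp (measurable_permute t) mg).
have mgr : cmeasurable (fun x => \sum_(s <- r) g (permute s x)).
  exact: cmeasurable_sum.
apply: (@le_trans _ _ (2%:E * msq (lambda n) (fun x => g (permute s x)) +
    2%:E * msq (lambda n) (fun x => \sum_(s <- r) g (permute s x))%R)%E).
  apply: msq_le => //; first exact: cmeasurableD.
  by move=> x; have := sqnorm_lin 1 (g (permute s x)) (\sum_(s <- r) g (permute s x));
    rewrite mul1r sqnorm1 mulr1.
have -> : ((2 + 2 * C)%:E * msq (lambda n) g =
    2%:E * msq (lambda n) g + 2%:E * (C%:E * msq (lambda n) g))%E.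
  by rewrite muleA -EFinM EFinD ge0_muleDl// lee_fin ?mulr_ge0// ltW.
rewrite (msq_permute alpha s mg); apply: leeD => //.
by apply: lee_wpmul2l; [rewrite lee_fin|exact: IH].
Qed.

Lemma approximable0 : approximable (fun=> 0).
Proof.
move=> e e0; exists 0; split => //; first exact: fock_dom0.
rewrite /msq integral0_eq ?lee_fin ?ltW// => x _.
by rewrite /symsum big1// subr0 sqnorm0.
Qed.

Lemma approximableZD a g h : cmeasurable g -> cmeasurable h ->
  approximable g -> approximable h -> approximable (fun x => a * g x + h x).
Proof.
move=> mg mh Ag Ah e e0; pose c := sqnorm a.
have c0 : 0 <= c := sqnorm_ge0 a.
have e1 : 0 < e / (4 * (c + 1)) by rewrite divr_gt0// mulr_gt0// ltr_wpDl.
have [v [Dv v0 gv]] := Ag _ e1.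
have [w [Dw w0 hw]] := Ah (e / 4) (divr_gt0 e0 (ltr0n _ 4)).
exists (a *: v + w); split; first exact: fock_dom_lin.
  move=> m mn; apply/funext => x.
  by rewrite pre_fock_addE pre_fock_scaleE v0// w0// mulr0 addr0.
have mv : cmeasurable (v n) := (fock_dom_tame Dv n).1.1.
have mw : cmeasurable (w n) := (fock_dom_tame Dw n).1.1.
have mgv : cmeasurable (fun x => symsum g x - v n x).
  by apply: cmeasurableB => //; exact: cmeasurable_symsum.
have mhw : cmeasurable (fun x => symsum h x - w n x).
  by apply: cmeasurableB => //; exact: cmeasurable_symsum.
have -> : (fun x => symsum (fun x => a * g x + h x) x - (a *: v + w) n x) =
    (fun x => a * (symsum g x - v n x) + (symsum h x - w n x)).
  apply/funext => x; rewrite pre_fock_addE pre_fock_scaleE /symsum big_split/= -mulr_sumr.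
  by ring.
apply: le_trans (msq_le _ mgv mhw _ _ _ (fun x => sqnorm_lin _ _ _)) _ => //.
- exact: cmeasurable_lin.
- by rewrite mulr_ge0.
have a2 : (0 <= (2 * sqnorm a)%:E)%E by rewrite lee_fin mulr_ge0 ?sqnorm_ge0.
have t2 : (0 <= 2%:E :> \bar R)%E by rewrite lee_fin.
apply: le_trans (leeD (lee_wpmul2l a2 gv) (lee_wpmul2l t2 hw)) _.
rewrite -!EFinM -EFinD lee_fin -/c.
have -> : 2 * c * (e / (4 * (c + 1))) = e / 2 * (c / (c + 1)).
  by field; rewrite gt_eqF// ltr_wpDl.
have c1 : c / (c + 1) <= 1 by rewrite ler_pdivrMr ?mul1r ?lerDl// ltr_wpDl.
by nra.
Qed.

Lemma approximable_sum m (c : 'I_m -> R[i]) (k : 'I_m -> n.-tuple X -> R[i]) :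
  (forall i, cmeasurable (k i)) -> (forall i, approximable (k i)) ->
  approximable (fun x => \sum_(i < m) c i * k i x).
Proof.
elim: m c k => [|m IH] c k mk Ak.
  by under eq_fun do rewrite big_ord0; exact: approximable0.
under eq_fun do rewrite big_ord_recl.
apply: approximableZD => //; last exact: IH.
apply: cmeasurable_sum => i; apply: cmeasurableM => //; exact: cmeasurable_cst.
Qed.

Lemma approximable_closed g : cmeasurable g ->
  (forall e : R, 0 < e -> exists h, [/\ cmeasurable h, approximable h &
     (msq (lambda n) (fun x => g x - h x)%R <= e%:E)%E]) -> approximable g.
Proof.
move=> mg gh e e0; have [C C0 CP] := msq_symsum.
have e1 : 0 < e / (4 * C) by rewrite divr_gt0// mulr_gt0.
have [h [mh Ah ghe]] := gh _ e1.
have [w [Dw w0 hw]] := Ah (e / 4) (divr_gt0 e0 (ltr0n _ 4)).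
exists w; split => //.
have mw : cmeasurable (w n) := (fock_dom_tame Dw n).1.1.
apply: le_trans (msq_triangle _ (cmeasurable_symsum mg) (cmeasurable_symsum mh) mw) _.
have gh_le : (msq (lambda n) (fun x => symsum g x - symsum h x)%R <= (e / 4)%:E)%E.
  have -> : (fun x => symsum g x - symsum h x) = symsum (fun x => g x - h x).
    by apply/funext => x; rewrite /symsum -sumrB.
  apply: le_trans (CP _ (cmeasurableB mg mh)) _.
  apply: le_trans (lee_wpmul2l _ ghe) _; first by rewrite lee_fin ltW.
  rewrite -EFinM lee_fin (_ : C * _ = e / 4)//.
  by field; rewrite gt_eqF.
apply: le_trans (leeD (lee_wpmul2l _ gh_le) (lee_wpmul2l _ hw)) _; rewrite ?lee_fin//.
lra.
Qed.

Lemma approximable_dominated g (h : nat -> n.-tuple X -> R[i]) (G : n.-tuple X -> R) :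
  cmeasurable g -> (forall k, cmeasurable (h k)) -> (forall k, approximable (h k)) ->
  (lambda n).-integrable setT (EFin \o G) ->
  (forall k x, sqnorm (g x - h k x) <= G x) ->
  (forall x, (fun k => sqnorm (g x - h k x)) @ \oo --> (0 : R)) -> approximable g.
Proof.
move=> mg mh Ah IG gG gh; apply: approximable_closed => // e e0.
have mk k : measurable_fun setT (fun x => (sqnorm (g x - h k x))%:E).
  exact: measurable_sqnormE (cmeasurableB mg (mh k)).
have cvg0 : {ae lambda n, forall x, setT x ->
    (fun k => (sqnorm (g x - h k x))%:E) @ \oo --> (0 : R)%:E}.
  by apply: aeW => x _; apply: cvg_EFin; [exact: nearW|exact: gh].
have le_G : {ae lambda n, forall x k, setT x ->
    (`|(sqnorm (g x - h k x))%:E| <= (EFin \o G) x)%E}.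
  by apply: aeW => x k _; rewrite gee0_abs ?lee_fin ?sqnorm_ge0//; exact: gG.
have [_ _] := dominated_convergence measurableT mk (measurable_cst _) cvg0 IG le_G.
rewrite integral0_eq// => /fine_cvgP[fin0 lim0].
move/cvgrPdist_lt : lim0 => /(_ e e0) lim0.
have [k [fink limk]] : exists k, (msq (lambda n) (fun x => g x - h k x) \is a fin_num) /\
    `|0 - fine (msq (lambda n) (fun x => g x - h k x))| < e.
  have /= [K _ KP] := filterI fin0 lim0; exists K; exact: (KP K (leqnn K)).
exists (h k); split => //; rewrite -[X in (X <= _)%E](fineK fink) lee_fin.
by move: limk; rewrite sub0r normrN ger0_norm ?fine_ge0 ?msq_ge0//; exact: ltW.
Qed.

Lemma indic_box (B : 'I_n -> set X) x :
  \1_(box B) x = \prod_(i < n) \1_(B i) (tnth x i) :> R[i].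
Proof.
rewrite indicE; have [/set_mem Bx|/negP Bx] := boolP (x \in box B).
  by rewrite big1// => i _; rewrite indicE mem_set//; exact: Bx.
have [i Bi] : exists i, tnth x i \notin B i.
  apply: contrapT => noti; apply: Bx; apply/mem_set => i.
  by apply: contrapT => nBi; apply: noti; exists i; rewrite memNset.
by rewrite (bigD1 i)//= indicE (negbTE Bi) mul0r.
Qed.

Lemma test_fun_indic (A : set X) : measurable A -> (alpha A < +oo)%E ->
  test_fun alpha (\1_A : X -> R[i]).
Proof.
move=> mA Aoo; apply: (bmeas_test_fun (bmeas_indic R mA) mA Aoo).
by move=> x; rewrite indicE; case: (boolP (x \in A)) => [/set_mem|_]; rewrite ?eqxx.
Qed.

(** Boxes symmetrize to monomials in indicator functions. *)
Lemma approximable_box (B : 'I_n -> set X) :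
  (forall i, measurable (B i) /\ (alpha (B i) < +oo)%E) ->
  approximable (\1_(box B)).
Proof.
move=> mB e e0; pose fs : n.-tuple (X -> R[i]) := [tuple \1_(B i) | i < n].
exists (monomial fs); split.
- apply: fock_dom_monomial => phi /tnthP[i ->]; rewrite tnth_mktuple.
  by apply: test_fun_indic; case: (mB i).
- by move=> m mn; apply: monomial_degree; rewrite size_tuple.
rewrite /msq integral0_eq ?lee_fin ?ltW// => x _.
rewrite monomialE /symsum (_ : \sum_s _ = \sum_(s : 'S_n) \prod_(i < n)
    tnth fs i (tnth x (s i))) ?subrr ?sqnorm0//.
apply: eq_bigr => s _; rewrite indic_box; apply: eq_bigr => i _.
by rewrite !tnth_mktuple.
Qed.

Lemma measurable_cube (E : set X) : measurable E -> measurable (box (fun _ : 'I_n => E)).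
Proof. by move=> mE; exact: measurable_box. Qed.

Lemma integrable_indic_cube (E : set X) : measurable E -> (alpha E < +oo)%E ->
  (lambda n).-integrable setT (EFin \o (\1_(box (fun _ : 'I_n => E)) : _ -> R)).
Proof.
move=> mE Eoo; have mc := measurable_cube mE.
apply: (@bounded_support_integrable _ _ _ _ _ 1 (box (fun=> E))) => //.
- exact: lambda_box_lty.
- by move=> x; rewrite indicE; case: (_ \in _); rewrite ?normr1 ?normr0.
- by move=> x; rewrite indicE; case: (boolP (x \in _)) => [/set_mem//|_]; rewrite eqxx.
Qed.

Lemma sqnorm_indicB (T : Type) (A B : set T) x : A `<=` B ->
  sqnorm (\1_B x - \1_A x : R[i]) = \1_(B `\` A) x.
Proof.
move=> AB; rewrite !indicE in_setD.
have [/set_mem Ax|nA] := boolP (x \in A); rewrite ?andbT ?andbF.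
  by rewrite mem_set ?subrr ?sqnorm0//; exact: AB.
by rewrite subr0; case: (x \in B); rewrite ?sqnorm1 ?sqnorm0.
Qed.

(** Dynkin's argument. The cube keeps complements and countable unions inside a
    set of finite measure. *)
Lemma approximable_indic (E : set X) (D : set (n.-tuple X)) :
  measurable E -> (alpha E < +oo)%E -> measurable D ->
  approximable (\1_(D `&` box (fun=> E))).
Proof.
move=> mE Eoo; set Q := box _; have mQ : measurable Q by exact: measurable_cube.
rewrite measurable_tuple_boxes.
apply: (@dynkin_induction _ (n.-tuple X) (@measurable_boxes _ X n)
  (fun D => approximable (\1_(D `&` Q)))).
- exact: measurable_tuple_boxes.
- exact: measurable_boxes_setI.
- by rewrite setTI; exact: approximable_box.
- move=> _ [B mB ->]; rewrite box_setI; apply: approximable_box => i; split.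
    exact: measurableI.
  by apply: le_lt_trans Eoo; apply: le_measure; rewrite ?inE//; exact: measurableI.
- move=> S mS AS.
  have -> : \1_(~` S `&` Q) = (fun x => - 1 * \1_(S `&` Q) x + \1_Q x) :> (_ -> R[i]).
    apply/funext => x; rewrite !indicE !in_setI in_setC.
    by case: (x \in S); case: (x \in Q); rewrite /= ?mulr1 ?mulr0 ?addNr ?add0r.
  apply: approximableZD => //; last exact: approximable_box.
    by apply: cmeasurable_indic; exact: measurableI.
  exact: cmeasurable_indic.
- move=> F mF tF AF.
  pose U k := \big[setU/set0]_(i < k) F i `&` Q.
  have mU k : measurable (U k).
    by apply: measurableI => //; exact: bigsetU_measurable.
  have mUF : measurable (\bigcup_k F k `&` Q).
    by apply: measurableI => //; exact: bigcup_measurable.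
  have AU k : approximable (\1_(U k)).
    elim: k => [|k IH].
      rewrite /U big_ord0 set0I (_ : \1_set0 = fun=> 0); first exact: approximable0.
      by apply/funext => x; rewrite indicE in_set0.
    rewrite /U big_ord_recr/= setIUl indicU_disjoint; last first.
      rewrite setIACA setIid -(@bigcup_mkord _ k F) setI_bigcupl.
      rewrite bigcup0 ?set0I// => i /= ik.
      by move/trivIsetP : tF => /(_ i k I I); rewrite ltn_eqF//; exact.
    under eq_fun do rewrite -[X in X + _]mul1r.
    apply: approximableZD => //; first exact: cmeasurable_indic (mU k).
    by apply: cmeasurable_indic; exact: measurableI.
  have UF k : U k `<=` \bigcup_k F k `&` Q.
    by apply: setSI; rewrite -bigcup_mkord; move=> x [i _ Fx]; exists i.
  apply: (@approximable_dominated _ (fun k => \1_(U k)) (\1_Q)).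
  + exact: cmeasurable_indic.
  + by move=> k; exact: cmeasurable_indic.
  + exact: AU.
  + exact: integrable_indic_cube.
  + move=> k x; rewrite sqnorm_indicB// !indicE ler_nat.
    case: (boolP (x \in _ `\` _)) => // /set_mem[[_ Qx] _]; by rewrite mem_set.
  + move=> x; apply: cvg_near_cst.
    have [[[K _ FK] Qx]|nx] := pselect ((\bigcup_k F k `&` Q) x).
      exists K.+1 => // k /= Kk; apply/eqP; rewrite sqnorm_indicB// indicE memNset//.
      move=> [_]; apply; split => //; rewrite -bigcup_mkord; exists K => //=.
    apply: nearW => k; apply/eqP; rewrite sqnorm_indicB// indicE memNset//.
    by move=> [].
Qed.

Import HBNNSimple.

(** Simple functions from below, cut off by the cubes of an exhaustion: the error
    is dominated by r^2. *)
Lemma approximable_nonneg (r : n.-tuple X -> R) : measurable_fun setT r ->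
  (forall x, 0 <= r x) -> (\int[lambda n]_x ((r x) ^+ 2)%:E < +oo)%E ->
  approximable (fun x => (r x)%:C%C).
Proof.
move=> mr r0 roo.
have mEr : measurable_fun setT (EFin \o r) by exact/measurable_EFinP.
pose s := nnsfun_approx measurableT mEr.
have sr x : (fun k => s k x) @ \oo --> r x.
  have := @cvg_nnsfun_approx _ _ _ _ measurableT _ mEr (fun x _ => r0 x) x I.
  by move=> /fine_cvgP[].
have s_le k x : s k x <= r x.
  rewrite -(cvg_lim _ (sr x))//.
  apply: (@nondecreasing_cvgn_le _ (fun k => s k x)).
    by move=> i j ij; have /lefP := nd_nnsfun_approx measurableT mEr ij; exact.
  by apply/cvg_ex; exists (r x); exact: sr.
have [F [mF ndF FT _]] := sigma_finite_cubes alpha.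
pose Q k : set (n.-tuple X) := box (fun=> F k).
have mQ k : measurable (Q k) by apply: measurable_cube; case: (mF k).
pose h k x : R[i] := (s k x)%:C%C * \1_(Q k) x.
have ms k : measurable_fun setT (s k) by [].
have mh k : cmeasurable (h k).
  by apply: cmeasurableM; [exact: cmeasurable_real|exact: cmeasurable_indic].
apply: (@approximable_dominated _ h (fun x => r x ^+ 2)).
- exact: cmeasurable_real.
- exact: mh.
- move=> k.
  have [m [c cE]] : exists m (c : 'I_m -> R), forall x,
      s k x = \sum_(i < m) c i * \1_(s k @^-1` [set c i]) x.
    exists #|` fset_set (s k @` setT)|%fset, (fun i => (fset_set (s k @` setT))`_i).
    exact: (fimfunEord (s k)).
  have -> : h k = fun x => \sum_(i < m) (c i)%:C%C * \1_(s k @^-1` [set c i] `&` Q k) x.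
    apply/funext => x; rewrite /h cE rmorph_sum mulr_suml.
    apply: eq_bigr => i _; rewrite rmorphM -mulrA indicI/=; congr (_ * _).
    by rewrite real_complex_indic.
  have mAQ i : measurable (s k @^-1` [set c i]).
    by rewrite -[X in measurable X]setTI; exact: (ms k).
  apply: approximable_sum => i.
    by apply: cmeasurable_indic; apply: measurableI => //; exact: mAQ.
  by apply: approximable_indic => //; case: (mF k).
- apply/integrableP; split; first exact/measurable_EFinP/measurable_funX.
  by under eq_integral do rewrite gee0_abs ?lee_fin ?sqr_ge0//.
- move=> k x; rewrite /h -real_complex_indic -rmorphM -rmorphB sqnorm_real.
  have := s_le k x; have : 0 <= s k x by []; have := r0 x.
  by rewrite indicE; case: (x \in Q k) => /=; nra.
- move=> x.
  have [K Kx] : exists K, forall k, (K <= k)%N -> x \in Q k.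
    have tF i : exists k, F k (tnth x i).
      by have : setT (tnth x i) by []; rewrite -FT => -[k _ ?]; exists k.
    have [k kF] := choice tF; exists (\max_(i < n) k i)%N => l kl.
    apply/mem_set => i; apply: ndF (kF i).
    by apply: leq_trans kl; exact: leq_bigmax.
  have : (fun k => (r x - s k x) ^+ 2) @ \oo --> (0 : R).
    have -> : (0 : R) = (r x - r x) * (r x - r x) by rewrite subrr mul0r.
    by under eq_fun do rewrite expr2; apply: cvgM; apply: cvgB => //; exact: cvg_cst.
  apply: cvg_trans; apply: near_eq_cvg.
  exists K => // k /= Kk; rewrite /h indicE Kx// mulr1 -rmorphB.
  by rewrite sqnorm_real.
Qed.

Lemma approximable_msq g : cmeasurable g -> (msq (lambda n) g < +oo)%E ->
  approximable g.
Proof.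
move=> mg goo; have [mr mi] := mg.
have dom (r : n.-tuple X -> R) : measurable_fun setT r ->
    (forall x, r x ^+ 2 <= sqnorm (g x)) -> approximable (fun x => (r x)%:C%C).
  move=> mr' rg.
  have lty (p : n.-tuple X -> R) : measurable_fun setT p -> (forall x, `|p x| <= `|r x|) ->
      (\int[lambda n]_x ((p x) ^+ 2)%:E < +oo)%E.
    move=> mp pr; apply: le_lt_trans goo; apply: ge0_le_integral => //.
    - by move=> x _; rewrite lee_fin sqr_ge0.
    - exact/measurable_EFinP/measurable_funX.
    - exact: measurable_sqnormE.
    - move=> x _; rewrite lee_fin; apply: le_trans (rg x).
      by rewrite -(real_normK (num_real (p x))) -(real_normK (num_real (r x))) lerXn2r ?nnegrE.
  have -> : (fun x => (r x)%:C%C) =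
      (fun x => - 1 * (r^\- x)%:C%C + (r^\+ x)%:C%C) :> (_ -> R[i]).
    apply/funext => x; rewrite mulN1r addrC -rmorphB.
    by rewrite -[in LHS](congr1 (@^~ x) (funrposBneg r)).
  have mp : measurable_fun setT r^\+ by exact: measurable_funrpos.
  have mn : measurable_fun setT r^\- by exact: measurable_funrneg.
  apply: approximableZD; do ?exact: cmeasurable_real.
    apply: approximable_nonneg => //; apply: lty => // x.
    by rewrite /funrneg; case: (leP (- r x) 0) => _; rewrite ?normr0 ?normrN.
  apply: approximable_nonneg => //; apply: lty => // x.
  by rewrite /funrpos; case: (leP (r x) 0) => _; rewrite ?normr0.
have -> : g = fun x => Complex 0 1 * (complex.Im (g x))%:C%C + (complex.Re (g x))%:C%C.
  apply/funext => x; apply: eq_complexP; rewrite ?Re_add ?Im_add ?Re_mul ?Im_mul /=; ring.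
apply: approximableZD; do ?exact: cmeasurable_real.
  by apply: dom => // x; rewrite sqnormE lerDr sqr_ge0.
by apply: dom => // x; rewrite sqnormE lerDl sqr_ge0.
Qed.

End fixed_degree.

End density.

Section density_in_fock.
Context d (X : measurableType d) (R : realType).
Variable alpha : {sigma_finite_measure set X -> \bar R}.
Local Notation pre_fock := (pre_fock X R).
Local Notation lambda := (lambda alpha).
Local Notation square_summable := (square_summable alpha).
Local Notation fock_dom := (fock_dom alpha).
Local Notation energy := (energy alpha).
Local Notation total_energy := (total_energy alpha).
Implicit Types f g w : pre_fock.

Lemma fock_dom_square_summable f : fock_dom f -> square_summable f.
Proof.
move=> Df; split.
- by move=> n; have [] := (fock_dom_tame Df n).1.
- by move=> n s; apply: aeW => x; exact: (fock_dom_exchangeable Df).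
rewrite -/(total_energy f).
have [N fN] := fock_dom_degree Df.
rewrite /total_energy (nneseries_split 0 N); last by move=> *; exact: energy_ge0.
rewrite eseries0; last first.
  move=> n Nn _; rewrite (_ : energy f n = ((n`!%:R)^-1%:E * msq (lambda n) (f n))%E)//.
  rewrite /msq integral0_eq ?mule0// => x _.
  by rewrite fN ?sqnorm0.
rewrite adde0; apply: lte_sum_pinfty => n _.
by rewrite lte_mul_pinfty ?lee_fin ?invr_ge0//; exact: tame_msq (fock_dom_tame Df n).
Qed.

Lemma ae_symsum f n : square_summable f ->
  {ae lambda n, forall x, f n x = (n`!%:R)^-1 * symsum (f n) x}.
Proof.
move=> sf.
have H (r : seq 'S_n) : {ae lambda n, forall x,
    \sum_(s <- r) f n (permute s x) = \sum_(s <- r) f n x}.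
  elim: r => [|s r IH]; first by apply: aeW => x; rewrite !big_nil.
  have := square_summable_permute s sf; move: IH; apply: filterS2 => x IHx sx.
  by rewrite !big_cons IHx sx.
have := H (index_enum _); apply: filterS => x; rewrite /symsum => ->.
rewrite sumr_const -[#|_|]/#|{perm 'I_n}| card_Sn -[f n x *+ _]mulr_natl mulrA.
by rewrite mulVf ?mul1r// pnatr_eq0 -lt0n fact_gt0.
Qed.

(** Dividing by n! turns the sum over permutations into the symmetrization, which
    does not change f. *)
Lemma density_degree f n (e : R) : square_summable f -> 0 < e ->
  exists w, [/\ fock_dom w, forall m, m != n -> w m = fun=> 0 &
    (energy (f - w)%R n <= e%:E)%E].
Proof.
move=> sf e0; have [mf _ _] := sf.
have [v [Dv v0 fv]] := approximable_msq (mf n) (msq_lty n sf) e0.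
pose c : R[i] := (n`!%:R)^-1; have c1 : sqnorm c <= 1.
  rewrite /c inv_fact_complex sqnormE/= expr0n/= addr0 exprn_ile1 ?invr_ge0//.
  by rewrite invf_le1 ?ltr0n ?fact_gt0// ler1n fact_gt0.
exists (c *: v); split; first exact: fock_domZ.
  by move=> m mn; apply/funext => x; rewrite pre_fock_scaleE v0// mulr0.
have mv : cmeasurable (v n) := (fock_dom_tame Dv n).1.1.
have msv : cmeasurable (fun x => symsum (f n) x - v n x).
  exact: cmeasurableB (cmeasurable_symsum (mf n)) mv.
have mcv : cmeasurable (fun x => c * (symsum (f n) x - v n x)).
  exact: cmeasurableM (cmeasurable_cst _ _) msv.
have -> : energy (f - c *: v)%R n = ((n`!%:R)^-1%:E *
    msq (lambda n) (fun x => c * (symsum (f n) x - v n x))%R)%E.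
  congr (_ * _)%E; apply: ae_eq_msq => //.
    exact: cmeasurableB (mf n) (cmeasurableM (cmeasurable_cst _ _) mv).
  have := ae_symsum n sf; apply: filterS => x fx.
  by rewrite -[LHS]/(f n x - c * v n x) fx mulrBr.
have cmsq : (msq (lambda n) (fun x => c * (symsum (f n) x - v n x))%R <= e%:E)%E.
  apply: le_trans fv; rewrite -[leRHS]adde0 -[X in (_ <= _ + X)%E](mul0e
    (msq (lambda n) (fun x => symsum (f n) x - v n x)%R)) -[X in (_ <= X + _)%E]mul1e.
  apply: msq_le => // x; rewrite mul0r addr0 sqnormM mul1r.
  by rewrite ler_piMl ?sqnorm_ge0.
apply: le_trans (lee_wpmul2l _ cmsq) _; first by rewrite lee_fin invr_ge0.
rewrite -EFinM lee_fin; apply: ler_piMl; first exact: ltW.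
by rewrite invf_le1 ?ltr0n ?fact_gt0// ler1n fact_gt0.
Qed.

Lemma pre_fock_sumE (I : Type) (r : seq I) (W : I -> pre_fock) n x :
  (\sum_(i <- r) W i) n x = \sum_(i <- r) W i n x.
Proof.
by elim: r => [|i r IH]; rewrite ?big_nil// !big_cons pre_fock_addE IH.
Qed.

(** The degrees above some N carry little of the norm; below N the symmetrized
    products are dense degree by degree. *)
Lemma fock_dom_density f (e : R) : square_summable f -> 0 < e ->
  exists2 w, fock_dom w & (total_energy (f - w)%R <= e%:E)%E.
Proof.
move=> sf e0; have e20 : 0 < e / 2 by rewrite divr_gt0.
have [N tail] : exists N, (\sum_(N <= n <oo) energy f n <= (e / 2)%:E)%E.
  have [_ _ foo] := sf.
  have := nneseries_tail_cvg foo (fun n _ => energy_ge0 _ _ _).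
  move=> /fine_cvgP[fin0 lim0]; move/cvgrPdist_lt : lim0 => /(_ _ e20) lim0.
  have /= [N _ NP] := filterI fin0 lim0; have [finN limN] := NP N (leqnn N).
  exists N; move: limN; rewrite sub0r normrN => limN.
  rewrite -[leLHS](fineK finN) lee_fin; apply/ltW/(le_lt_trans _ limN).
  exact: ler_norm.
have eN : 0 < e / 2 / N.+1%:R by rewrite divr_gt0.
have /choice[W WP] : forall n, exists w, [/\ fock_dom w, forall m, m != n -> w m = fun=> 0 &
    (energy (f - w)%R n <= (e / 2 / N.+1%:R)%:E)%E].
  by move=> n; exact: density_degree.
pose w := \sum_(i < N) W i.
have wE n : w n = if (n < N)%N then W n n else fun=> 0.
  apply/funext => x; rewrite /w pre_fock_sumE; case: ltnP => nN.
    rewrite (bigD1 (Ordinal nN))//= big1 ?addr0// => i /eqP ni.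
    have [_ W0 _] := WP i; rewrite W0//; apply/eqP => ni'; apply: ni.
    by apply: val_inj; rewrite /= ni'.
  rewrite big1// => i _; have [_ W0 _] := WP i; rewrite W0//.
  by rewrite gtn_eqF// (leq_trans (ltn_ord i)).
exists w.
  rewrite fock_domE; apply: lin_span_sum => i; rewrite -fock_domE.
  by have [] := WP i.
rewrite /total_energy (nneseries_split 0 N); last by move=> *; exact: energy_ge0.
rewrite add0n (splitr e) EFinD; apply: leeD.
  apply: (@le_trans _ _ (\sum_(0 <= n < N) (e / 2 / N.+1%:R)%:E)%E).
    rewrite !big_mkord; apply: lee_sum => n _.
    have -> : energy (f - w)%R n = energy (f - W n)%R n.
      congr (_ * msq _ _)%E; apply/funext => x.
      by rewrite -[LHS]/(f n x - w n x) wE ltn_ord.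
    by have [] := WP n.
  rewrite sumEFin lee_fin sumr_const_nat subn0 -[_ *+ N]mulr_natr.
  by rewrite mulrAC ler_pdivrMr// ler_pM2l// ler_nat leqnSn.
have shift g := @nneseries_addn R (energy g) N (@energy_ge0 _ _ _ alpha g).
apply: le_trans tail; rewrite -(shift f) -(shift (f - w)).
rewrite (eq_eseriesr (g := fun n => energy f (n + N)%N))// => n _.
congr (_ * msq _ _)%E; apply/funext => x.
by rewrite -[LHS]/(f (n + N)%N x - w (n + N)%N x) wE ltnNge leq_addl subr0.
Qed.

End density_in_fock.

(** * Adjoints on a dense domain *)

Section hilbert_calculus.
Context (R : realType) (H : lmodType R[i]) (ip : H -> H -> R[i]).
Hypothesis Hip : hilbert_space ip.
Implicit Types u v w : H.

Lemma ip0r u : ip u 0 = 0.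
Proof.
have := ip_linear_r Hip (-1) u 0 0.
by rewrite scaler0 addr0 mulN1r addNr.
Qed.

Lemma ipZr u a v : ip u (a *: v) = a * ip u v.
Proof. by have := ip_linear_r Hip a u v 0; rewrite !addr0 ip0r addr0. Qed.

Lemma ipDr u v w : ip u (v + w) = ip u v + ip u w.
Proof. by have := ip_linear_r Hip 1 u v w; rewrite scale1r mul1r. Qed.

Lemma ipNr u v : ip u (- v) = - ip u v.
Proof. by rewrite -scaleN1r ipZr mulN1r. Qed.

Lemma ipBr u v w : ip u (v - w) = ip u v - ip u w.
Proof. by rewrite ipDr ipNr. Qed.

Lemma ip0l u : ip 0 u = 0.
Proof. by rewrite (ip_conj Hip) ip0r conj0. Qed.

Lemma ipDl u v w : ip (u + v) w = ip u w + ip v w.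
Proof. by rewrite (ip_conj Hip w) ipDr conjD -!(ip_conj Hip). Qed.

Lemma ipZl a u v : ip (a *: u) v = a^*%C * ip u v.
Proof. by rewrite (ip_conj Hip v) ipZr conjM -(ip_conj Hip). Qed.

Lemma ipNl u v : ip (- u) v = - ip u v.
Proof. by rewrite (ip_conj Hip v) ipNr conjN -(ip_conj Hip). Qed.

Lemma ipBl u v w : ip (u - v) w = ip u w - ip v w.
Proof.
by rewrite ipDl ipNl.
Qed.

Section domain.
Variable D : set H.
Hypothesis Dlin : forall a u v, D u -> D v -> D (a *: u + v).

Lemma domB u v : D u -> D v -> D (u - v).
Proof. by move=> Du Dv; rewrite addrC -scaleN1r; exact: Dlin. Qed.

Lemma ip_separates u v : D u -> D v -> (forall w, D w -> ip w u = ip w v) -> u = v.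
Proof.
move=> Du Dv uv; apply/eqP; rewrite -subr_eq0; apply/eqP.
by apply: (ip_eq0 Hip); rewrite ipBr uv ?subrr//; exact: domB.
Qed.

Definition adjoint_on (A A' : H -> H) : Prop :=
  [/\ forall u, D u -> D (A u), forall u, D u -> D (A' u) &
      forall u v, D u -> D v -> ip u (A v) = ip (A' u) v].

(** Taking adjoints turns a commutator around. *)
Lemma ip_comm A A' B B' u v : adjoint_on A A' -> adjoint_on B B' -> D u -> D v ->
  ip u (comm A B v) = ip (comm B' A' u) v.
Proof.
move=> [DA DA' AA'] [DB DB' BB'] Du Dv.
rewrite /comm ipBr ipBl (AA' _ _ Du (DB _ Dv)) (BB' _ _ (DA' _ Du) Dv).
by rewrite (BB' _ _ Du (DA _ Dv)) (AA' _ _ (DB' _ Du) Dv).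
Qed.

Lemma dom_comm A A' B B' u : adjoint_on A A' -> adjoint_on B B' -> D u ->
  D (comm A B u).
Proof.
by move=> [DA _ _] [DB _ _] Du; apply: domB; [exact/DA/DB|exact/DB/DA].
Qed.

End domain.
End hilbert_calculus.

(** * The Fock representation *)

Section induced_operators.
Context (R : realType) (V H : lmodType R[i]) (ip : H -> H -> R[i]).
Hypothesis Hip : hilbert_space ip.
Variables (E : set V) (cls : V -> H) (D : set H).
Hypothesis Elin : forall a f g, E f -> E g -> E (a *: f + g).
Hypothesis cls_lin : forall a f g, E f -> E g ->
  cls (a *: f + g) = a *: cls f + cls g.
Hypothesis DP : forall u, D u <-> exists2 f, E f & u = cls f.
Implicit Types (f g : V) (u v : H) (T S : V -> V).

Lemma dom_cls f : E f -> D (cls f).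
Proof. by move=> Ef; apply/DP; exists f. Qed.

Lemma dom_lin a u v : D u -> D v -> D (a *: u + v).
Proof.
move=> /DP[f Ef ->] /DP[g Eg ->]; rewrite -(cls_lin a Ef Eg).
exact/dom_cls/Elin.
Qed.

(** The representative is chosen arbitrarily; when T has an adjoint, the choice
    does not matter. *)
Definition induced T u : H :=
  match pselect (exists f, E f /\ u = cls f) with
  | left ex => cls (T (projT1 (cid ex)))
  | right _ => 0
  end.

(** V carries no scalar product, so that adjointness is required of the classes. *)
Record adjoint_pair T S : Prop := AdjointPair {
  adj_dom : forall f, E f -> E (T f) ;
  adj_dom' : forall f, E f -> E (S f) ;
  adj_lin : forall a f g, E f -> E g -> T (a *: f + g) = a *: T f + T g ;
  adj_lin' : forall a f g, E f -> E g -> S (a *: f + g) = a *: S f + S g ;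
  adj_ip : forall f g, E f -> E g ->
    ip (cls f) (cls (T g)) = ip (cls (S f)) (cls g) }.

Lemma adjoint_pair_sym T S : adjoint_pair T S -> adjoint_pair S T.
Proof.
move=> [ET ES lT lS TS]; split=> // f g Ef Eg.
by rewrite (ip_conj Hip (cls (S g))) -(TS g f Eg Ef) -(ip_conj Hip).
Qed.

(** An operator with an adjoint on the domain sends null functions to null
    functions: T f is orthogonal to the domain, which contains it. *)
Lemma induced_cls T S f : adjoint_pair T S -> E f ->
  induced T (cls f) = cls (T f).
Proof.
move=> [ET ES lT lS TS] Ef; rewrite /induced; case: pselect => [ex|nex]; last first.
  by exfalso; apply: nex; exists f.
case: (cid ex) => g [Eg fg] /=.
have Eh : E (-1 *: f + g) by exact: Elin.
have h0 : cls (-1 *: f + g) = 0 by rewrite (cls_lin _ Ef Eg) -fg scaleN1r addNr.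
have : cls (T (-1 *: f + g)) = 0.
  by apply: (ip_eq0 Hip); rewrite (TS _ _ (ET _ Eh) Eh) h0 (ip0r Hip).
rewrite (lT _ _ _ Ef Eg) (cls_lin _ (ET _ Ef) (ET _ Eg)).
by rewrite scaleN1r addrC => /eqP; rewrite subr_eq0 => /eqP.
Qed.

Lemma induced_adjoint T S : adjoint_pair T S ->
  adjoint_on ip D (induced T) (induced S).
Proof.
move=> TS; have ST := adjoint_pair_sym TS; split.
- move=> _ /DP[f Ef ->]; rewrite (induced_cls TS Ef).
  exact/dom_cls/(adj_dom TS).
- move=> _ /DP[f Ef ->]; rewrite (induced_cls ST Ef).
  exact/dom_cls/(adj_dom ST).
- move=> _ _ /DP[f Ef ->] /DP[g Eg ->].
  rewrite (induced_cls TS Eg) (induced_cls ST Ef); exact: (adj_ip TS).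
Qed.

Lemma induced_lin T S a u v : adjoint_pair T S -> D u -> D v ->
  induced T (a *: u + v) = a *: induced T u + induced T v.
Proof.
move=> TS /DP[f Ef ->] /DP[g Eg ->].
have [ET _ lT _ _] := TS.
rewrite -(cls_lin a Ef Eg) (induced_cls TS (Elin a Ef Eg)).
rewrite (induced_cls TS Ef) (induced_cls TS Eg) (lT a _ _ Ef Eg).
by rewrite (cls_lin a (ET _ Ef) (ET _ Eg)).
Qed.

End induced_operators.

Section representation_on_classes.
Context d (X : measurableType d) (R : realType).
Variable alpha : {sigma_finite_measure set X -> \bar R}.
Context (V H : lmodType R[i]) (ip : H -> H -> R[i]).
Hypothesis Hip : hilbert_space ip.
Variables (E : set V) (cls : V -> H) (D : set H).
Hypothesis E0 : E 0.
Hypothesis Elin : forall a f g, E f -> E g -> E (a *: f + g).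
Hypothesis cls_lin : forall a f g, E f -> E g ->
  cls (a *: f + g) = a *: cls f + cls g.
Hypothesis DP : forall u, D u <-> exists2 f, E f & u = cls f.
Hypothesis D_dense : hdense ip D.
Variables (P M Z : (X -> R[i]) -> V -> V) (Omega : V).
Local Notation test := (test_fun alpha).
Local Notation adjoint_pair := (adjoint_pair ip E cls).
Local Notation adjoint_on := (adjoint_on ip D).
Local Notation k T := (induced E cls T).
Implicit Types (f g : V) (u v w : H) (phi theta : X -> R[i]).
Hypothesis PM : forall phi, test phi -> adjoint_pair (P phi) (M phi).
Hypothesis ZZ : forall phi, test phi -> adjoint_pair (Z phi) (Z (cconj phi)).
Hypothesis P_test_lin : forall a phi theta f, test phi -> test theta -> E f ->
  P (a *: phi + theta) f = a *: P phi f + P theta f.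
Hypothesis Z_test_lin : forall a phi theta f, test phi -> test theta -> E f ->
  Z (a *: phi + theta) f = a *: Z phi f + Z theta f.
Hypothesis comm_MP : forall phi theta f, test phi -> test theta -> E f ->
  comm (M phi) (P theta) f = 2 *: Z (cconj phi \* theta) f.
Hypothesis comm_ZP : forall phi theta f, test phi -> test theta -> E f ->
  comm (Z phi) (P theta) f = P (phi \* theta) f.
Hypothesis comm_PP : forall phi theta f, test phi -> test theta -> E f ->
  comm (P phi) (P theta) f = 0.
Hypothesis comm_ZZ : forall phi theta f, test phi -> test theta -> E f ->
  comm (Z phi) (Z theta) f = 0.
Hypothesis EOmega : E Omega.
Hypothesis Omega_norm : hnorm ip (cls Omega) = 1.
Hypothesis M_Omega : forall phi, test phi -> M phi Omega = 0.
Hypothesis E_span : forall f, E f -> lin_span [set g | exists2 phis : seq (X -> R[i]),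
  {in phis, forall phi, test phi} & g = foldr P Omega phis] f.

Let Dlin := dom_lin Elin cls_lin DP.

Let MP phi (tp : test phi) := adjoint_pair_sym Hip (PM tp).

Let kP phi f (tp : test phi) (Ef : E f) := induced_cls Hip Elin cls_lin (PM tp) Ef.
Let kM phi f (tp : test phi) (Ef : E f) := induced_cls Hip Elin cls_lin (MP tp) Ef.
Let kZ phi f (tp : test phi) (Ef : E f) := induced_cls Hip Elin cls_lin (ZZ tp) Ef.

Let aP phi (tp : test phi) := induced_adjoint Hip Elin cls_lin DP (PM tp).
Let aM phi (tp : test phi) := induced_adjoint Hip Elin cls_lin DP (MP tp).
Let aZ phi (tp : test phi) := induced_adjoint Hip Elin cls_lin DP (ZZ tp).

Let cls0 : cls 0 = 0.
Proof. by have := cls_lin (-1) E0 E0; rewrite scaler0 addr0 scaleN1r addNr. Qed.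

Let clsZ a f : E f -> cls (a *: f) = a *: cls f.
Proof. by move=> Ef; have := cls_lin a Ef E0; rewrite cls0 !addr0. Qed.

Let test_conj_mul phi theta : test phi -> test theta -> test (cconj phi \* theta).
Proof.
by move=> tp tt; exact: test_fun_mul (test_fun_bmeas (test_fun_conj tp)) tt.
Qed.

Let D0 : D 0.
Proof. by rewrite -cls0; exact: (dom_cls DP E0). Qed.

Let DN u : D u -> D (- u).
Proof. by move=> Du; rewrite -scaleN1r -[_ *: _]addr0; exact: Dlin. Qed.

Lemma induced_comm T T' S S' f : adjoint_pair T T' -> adjoint_pair S S' -> E f ->
  comm (k T) (k S) (cls f) = cls (comm T S f).
Proof.
move=> TT' SS' Ef.
have ET := adj_dom TT'; have ES := adj_dom SS'.
rewrite /comm (induced_cls Hip Elin cls_lin SS' Ef).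
rewrite (induced_cls Hip Elin cls_lin TT' Ef).
rewrite (induced_cls Hip Elin cls_lin TT' (ES _ Ef)).
rewrite (induced_cls Hip Elin cls_lin SS' (ET _ Ef)).
rewrite [in RHS]addrC -[in RHS]scaleN1r (cls_lin _ (ES _ (ET _ Ef)) (ET _ (ES _ Ef))).
by rewrite scaleN1r addrC.
Qed.

Let comm_kP phi theta u : test phi -> test theta -> D u ->
  comm (k (P phi)) (k (P theta)) u = 0.
Proof.
move=> tp tt /DP[f Ef ->].
by rewrite (induced_comm (PM tp) (PM tt) Ef) (comm_PP tp tt Ef) cls0.
Qed.

Let comm_kZ phi theta u : test phi -> test theta -> D u ->
  comm (k (Z phi)) (k (Z theta)) u = 0.
Proof.
move=> tp tt /DP[f Ef ->].
by rewrite (induced_comm (ZZ tp) (ZZ tt) Ef) (comm_ZZ tp tt Ef) cls0.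
Qed.

Let comm_kZP phi theta u : test phi -> test theta -> D u ->
  comm (k (Z phi)) (k (P theta)) u = k (P (phi \* theta)) u.
Proof.
move=> tp tt /DP[f Ef ->].
rewrite (induced_comm (ZZ tp) (PM tt) Ef) (comm_ZP tp tt Ef).
by rewrite (kP (test_fun_mul (test_fun_bmeas tp) tt) Ef).
Qed.

Let comm_kMP phi theta u : test phi -> test theta -> D u ->
  comm (k (M phi)) (k (P theta)) u = 2 *: k (Z (cconj phi \* theta)) u.
Proof.
move=> tp tt /DP[f Ef ->].
have tpt := test_conj_mul tp tt.
rewrite (induced_comm (MP tp) (PM tt) Ef) (comm_MP tp tt Ef) (kZ tpt Ef).
by rewrite (clsZ _ (adj_dom (ZZ tpt) Ef)).
Qed.

(** The remaining relations are the adjoints of those between k^0 and k^+: the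
    domain is stable and separates its points. *)
Let comm_kM phi theta u : test phi -> test theta -> D u ->
  comm (k (M phi)) (k (M theta)) u = 0.
Proof.
move=> tp tt Du.
apply: (ip_separates Hip Dlin (dom_comm Dlin (aM tp) (aM tt) Du) D0) => w Dw.
rewrite (ip_comm Hip (aM tp) (aM tt) Dw Du) (comm_kP tt tp Dw).
by rewrite (ip0l Hip) (ip0r Hip).
Qed.

Let comm_kZM phi theta u : test phi -> test theta -> D u ->
  comm (k (Z phi)) (k (M theta)) u = - k (M (cconj phi \* theta)) u.
Proof.
move=> tp tt Du; have tcp := test_fun_conj tp.
have tpt := test_conj_mul tp tt.
have [DM _ adjM] := aM tpt.
apply: (ip_separates Hip Dlin (dom_comm Dlin (aZ tp) (aM tt) Du) (DN (DM u Du))).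
move=> w Dw; rewrite (ip_comm Hip (aZ tp) (aM tt) Dw Du) (ipNr Hip) (adjM _ _ Dw Du).
rewrite -(comm_kZP tcp tt Dw) -(ipNl Hip); congr (ip _ _).
by rewrite /comm opprB.
Qed.

Let kM_test_lin a phi theta u : test phi -> test theta -> D u ->
  k (M (a *: phi + theta)) u = a^*%C *: k (M phi) u + k (M theta) u.
Proof.
move=> tp tt Du; have tl := test_fun_lin a tp tt.
have [Dp _ adjp] := aM tp; have [Dt _ adjt] := aM tt; have [Dl _ adjl] := aM tl.
apply: (ip_separates Hip Dlin (Dl u Du) (Dlin _ (Dp u Du) (Dt u Du))) => w Dw.
rewrite (ip_linear_r Hip) (adjl _ _ Dw Du) (adjp _ _ Dw Du) (adjt _ _ Dw Du).
have -> : k (P (a *: phi + theta)) w = a *: k (P phi) w + k (P theta) w.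
  move: Dw => /DP[f Ef ->]; rewrite (kP tl Ef) (kP tp Ef) (kP tt Ef).
  by rewrite (P_test_lin a tp tt Ef) (cls_lin a (adj_dom (PM tp) Ef) (adj_dom (PM tt) Ef)).
by rewrite (ipDl Hip) (ipZl Hip).
Qed.

Lemma cls_creations phis : {in phis, forall phi, test phi} ->
  E (foldr P Omega phis) /\
  cls (foldr P Omega phis) = foldr (fun phi => k (P phi)) (cls Omega) phis.
Proof.
elim: phis => [//|phi phis IH] tphis /=.
have [Ef <-] := IH (fun psi psiP => tphis psi (mem_behead (s := phi :: phis) psiP)).
have tp := tphis phi (mem_head _ _).
by split; [exact: (adj_dom (PM tp))|rewrite (kP tp Ef)].
Qed.

Lemma cls_cyclic : hdense ip (lin_span [set u | exists2 phis : seq (X -> R[i]),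
  {in phis, forall phi, test phi} &
  u = foldr (fun phi => k (P phi)) (cls Omega) phis]).
Proof.
move=> u e e0; have [v Dv uv] := D_dense u e0; exists v => //.
move: Dv {uv} => /DP[f Ef ->]; set S := [set _ | _].
suff [] : E f /\ lin_span S (cls f) by [].
move: f {Ef} (E_span Ef); apply: lin_span_ind.
- by split; [exact: E0|rewrite cls0; exact: lin_span0].
- move=> a f g [Ef Sf] [Eg Sg]; split; first exact: Elin.
  by rewrite (cls_lin a Ef Eg); exact: lin_span_lin.
- move=> f [phis tphis ->]; have [Ef Sf] := cls_creations tphis.
  by split => //; apply: lin_span_gen; exists phis.
Qed.

(** A representation on functions becomes one on classes. It takes the
    adjoint pairs, the relations among k^0 and k^+ and that of k^- with k^+; the
    rest follows because the domain separates its points. *)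
Lemma representation_on_classes : fock_representation alpha ip D
  (fun phi => k (P phi)) (fun phi => k (M phi)) (fun phi => k (Z phi)) (cls Omega).
Proof.
split.
- exact: Hip.
- by split; [exact: D0|exact: Dlin].
- exact: D_dense.
- move=> phi u tp Du.
  have [DPu DMu _] := aP tp; have [DZu _ _] := aZ tp.
  by split; [exact: DPu|exact: DMu|exact: DZu].
- move=> phi a u v tp Du Dv; split.
  + exact: (induced_lin Hip Elin cls_lin DP a (PM tp) Du Dv).
  + exact: (induced_lin Hip Elin cls_lin DP a (MP tp) Du Dv).
  + exact: (induced_lin Hip Elin cls_lin DP a (ZZ tp) Du Dv).
- move=> a phi theta u tp tt Du; have tl := test_fun_lin a tp tt.
  split; last exact: kM_test_lin.
    move: Du => /DP[f Ef ->]; rewrite (kP tl Ef) (kP tp Ef) (kP tt Ef).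
    by rewrite (P_test_lin a tp tt Ef) (cls_lin a (adj_dom (PM tp) Ef) (adj_dom (PM tt) Ef)).
  move: Du => /DP[f Ef ->]; rewrite (kZ tl Ef) (kZ tp Ef) (kZ tt Ef).
  by rewrite (Z_test_lin a tp tt Ef) (cls_lin a (adj_dom (ZZ tp) Ef) (adj_dom (ZZ tt) Ef)).
- exact: comm_kMP.
- exact: comm_kZP.
- exact: comm_kZM.
- by move=> phi theta u tp tt Du; split; [exact: comm_kZ|exact: comm_kP|exact: comm_kM].
- by move=> phi f g tp; have [_ _] := aZ tp; exact.
- by move=> phi f g tp; have [_ _] := aP tp; exact.
- exact: (dom_cls DP EOmega).
- exact: Omega_norm.
- by move=> phi tp; rewrite (kM tp EOmega) (M_Omega tp) cls0.
- exact: cls_cyclic.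
Qed.

End representation_on_classes.

Section fock_operators.
Context d (X : measurableType d) (R : realType).
Variable alpha : {sigma_finite_measure set X -> \bar R}.
Local Notation pre_fock := (pre_fock X R).
Local Notation H := (fock alpha).
Local Notation ip := (fock_ip alpha).
Local Notation fock_dom := (fock_dom alpha).
Local Notation D := (@fock_dom_class _ X R alpha).
Local Notation cls := (cls alpha).
Local Notation adjoint_pair := (adjoint_pair ip fock_dom cls).
Implicit Types (f g : pre_fock) (u v w : H) (phi theta : X -> R[i]).

Lemma dom_classP u : D u <-> exists2 f, fock_dom f & u = cls f.
Proof.
split=> [[f Df /representsP[_ ->]]|[f Df ->]]; first by exists f.
by exists f => //; apply/represents_cls/fock_dom_square_summable.
Qed.

Lemma cls_dom_lin a f g : fock_dom f -> fock_dom g ->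
  cls (a *: f + g) = a *: cls f + cls g.
Proof.
by move=> Df Dg; apply: cls_lin; exact: fock_dom_square_summable.
Qed.

(** Degree n+1 of the series for k^+ is degree n of the series for k^-; degree 0 of
    k^+ g vanishes. *)
Lemma k_plus_adjoint phi : test_fun alpha phi ->
  adjoint_pair (k_plus phi) (k_minus alpha phi).
Proof.
move=> tphi; split.
- by move=> f; exact: fock_dom_k_plus.
- by move=> f; exact: fock_dom_k_minus.
- by move=> *; exact: k_plus_linear.
- by move=> *; exact: k_minus_linear.
- move=> f g Df Dg.
  have sf := fock_dom_square_summable Df; have sg := fock_dom_square_summable Dg.
  have skg := fock_dom_square_summable (fock_dom_k_plus tphi Dg).
  have skf := fock_dom_square_summable (fock_dom_k_minus tphi Df).
  rewrite (fock_ip_cls sf skg) (fock_ip_cls skf sg).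
  rewrite csum_shift; [|exact: csummable_fock_term|exact: fock_term_k_plus0].
  by congr csum; apply/funext => n; exact: fock_term_k_plus.
Qed.

Lemma k_zero_adjoint phi : test_fun alpha phi ->
  adjoint_pair (k_zero alpha phi) (k_zero alpha (cconj phi)).
Proof.
move=> tphi; split.
- by move=> f; exact: fock_dom_k_zero.
- by move=> f; apply: fock_dom_k_zero; exact: test_fun_conj.
- by move=> *; exact: k_zero_linear.
- by move=> *; exact: k_zero_linear.
- move=> f g Df Dg.
  have sf := fock_dom_square_summable Df; have sg := fock_dom_square_summable Dg.
  have skg := fock_dom_square_summable (fock_dom_k_zero tphi Dg).
  have skf := fock_dom_square_summable (fock_dom_k_zero (test_fun_conj tphi) Df).
  rewrite (fock_ip_cls sf skg) (fock_ip_cls skf sg).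
  by congr csum; apply/funext => n; exact: fock_term_k_zero.
Qed.

Lemma induces_induced (T S : pre_fock -> pre_fock) : adjoint_pair T S ->
  induces T (induced fock_dom cls T).
Proof.
move=> TS f u Df /representsP[_ ->].
rewrite (induced_cls (fock_hilbert alpha) (@fock_dom_lin _ _ _ alpha) cls_dom_lin TS Df).
by apply/represents_cls/fock_dom_square_summable/(adj_dom TS).
Qed.

Lemma dom_class_dense : hdense ip D.
Proof.
move=> u e e0; have [f sf ->] := cls_repr u.
have [|w Dw fw] := @fock_dom_density _ _ _ _ f (e ^+ 2 / 2) sf.
  by rewrite divr_gt0 ?exprn_gt0.
have sw := fock_dom_square_summable Dw.
exists (cls w); first by apply/dom_classP; exists w.
rewrite -(clsB sf sw); apply: (hnorm_cls_lt (square_summableB sf sw) e0).2.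
apply: le_lt_trans fw _; rewrite lte_fin ltr_pdivrMr// ltr_pMr ?exprn_gt0//.
by rewrite ltr1n.
Qed.

Lemma vacuum_cls : vacuum alpha = cls (monomial [::]).
Proof. by rewrite /vacuum -cls_fock_fun. Qed.

Lemma dom_monomial0 : fock_dom (monomial [::]).
Proof. exact: fock_dom_monomial. Qed.

Lemma vacuum_norm : hnorm ip (cls (monomial [::])) = 1.
Proof.
rewrite /hnorm fock_ip_self/=; last exact/fock_dom_square_summable/dom_monomial0.
suff -> : total_energy alpha (monomial [::]) = 1%E by rewrite /= sqrtr1.
rewrite /total_energy (nneseries_split 0 1); last by move=> *; exact: energy_ge0.
rewrite big_nat1 eseries0 => [|n n1 _]; last first.
  rewrite /energy /msq integral0_eq ?mule0// => x _.
  by rewrite monomial_degree ?sqnorm0// gtn_eqF.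
rewrite adde0 /energy fact0 invr1 mul1e /msq (eq_integral (cst 1%E)).
  by rewrite integral_cst// mul1e [LHS]lambda0T.
by move=> x _; rewrite sqnorm1.
Qed.

Lemma k_zero_test_linear a phi theta f :
  test_fun alpha phi -> test_fun alpha theta ->
  k_zero alpha (a *: phi + theta) f = a *: k_zero alpha phi f + k_zero alpha theta f.
Proof.
move=> tp tt; apply: pre_fockP => n x; rewrite pre_fock_addE pre_fock_scaleE /k_zero.
rewrite (cintegralZD a (test_fun_cintegrable tp) (test_fun_cintegrable tt)).
rewrite (eq_bigr (fun i => a * phi (tnth x i) + theta (tnth x i)))// big_split/=.
by rewrite -mulr_sumr; ring.
Qed.

Lemma fock_is_representation : fock_representation alpha ip D
  (fun phi => induced fock_dom cls (k_plus phi))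
  (fun phi => induced fock_dom cls (k_minus alpha phi))
  (fun phi => induced fock_dom cls (k_zero alpha phi)) (vacuum alpha).
Proof.
rewrite vacuum_cls; apply: representation_on_classes.
- exact: fock_hilbert.
- exact: fock_dom0.
- by move=> a f g; exact: fock_dom_lin.
- exact: cls_dom_lin.
- exact: dom_classP.
- exact: dom_class_dense.
- exact: k_plus_adjoint.
- exact: k_zero_adjoint.
- by move=> a phi theta f _ _ _; exact: k_plus_test_linear.
- by move=> a phi theta f tp tt _; exact: k_zero_test_linear.
- by move=> phi theta f tp tt Df; rewrite /comm k_minus_plus// addrC addKr.
- by move=> phi theta f tp tt Df; rewrite /comm k_zero_plus addrK.
- by move=> phi theta f _ _ Df; rewrite /comm (k_plusC _ _ Df) subrr.
- move=> phi theta f _ _ _; apply/eqP; rewrite subr_eq0; apply/eqP.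
  by apply: pre_fockP => n x; rewrite /k_zero mulrCA.
- exact: dom_monomial0.
- exact: vacuum_norm.
- by move=> phi _; exact: k_minus_vacuum.
- by move=> f; rewrite fock_domE.
Qed.

End fock_operators.

Theorem theorem3p2 (R : realType) (d : measure_display) (X : measurableType d)
    (alpha : {sigma_finite_measure set X -> \bar R})
    (borelX : borel_space R X) :
  fock_dom alpha `<=` square_summable alpha /\
  exists kp km k0 : (X -> R[i]) -> fock alpha -> fock alpha,
    (forall phi : X -> R[i], test_fun alpha phi ->
       [/\ induces (k_plus phi) (kp phi),
           induces (k_minus alpha phi) (km phi) &
           induces (k_zero alpha phi) (k0 phi)]) /\
    fock_representation alpha (fock_ip alpha) (fock_dom_class alpha)
      kp km k0 (vacuum alpha).
Proof.
split; first by move=> f; exact: fock_dom_square_summable.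
do 3 eexists; split; last exact: fock_is_representation.
move=> phi tphi; have PM := k_plus_adjoint tphi.
split; first exact: (induces_induced PM).
- exact: (induces_induced (adjoint_pair_sym (fock_hilbert alpha) PM)).
- exact: (induces_induced (k_zero_adjoint tphi)).
Qed.
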